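(* Let $\alpha,\beta>-1$ and $0<\lambda\le1$. There is a constant $c>0$, independent of $l,m,N,v$, such that for all integers $N\ge1$ and $0\le l\le m\le N+1$ and every $v$ such that $x\mapsto v(x^{1/\lambda})$ belongs to $B^{m,1}_{\alpha,\beta}(I)$, $$\big\|D_\lambda^l(v-\pi_{N,\omega^{\alpha,\beta,\lambda}}v)\big\|_{0,\omega^{\alpha+l,\beta+l,\lambda}}\le c\,\sqrt{\frac{(N-m+1)!}{(N-l+1)!}}\;N^{(l-m)/2}\,\big\|\partial_x^m\{v(x^{1/\lambda})\}\big\|_{0,\omega^{\alpha+m,\beta+m,1}} .$$ For fixed $m$ (and $0\le l\le m\le N+1$) this simplifies to $$\big\|D_\lambda^l(v-\pi_{N,\omega^{\alpha,\beta,\lambda}}v)\big\|_{0,\omega^{\alpha+l,\beta+l,\lambda}}\le c_N\,N^{l-m}\,\big\|\partial_x^m\{v(x^{1/\lambda})\}\big\|_{0,\omega^{\alpha+m,\beta+m,1}},$$ where $c_N$ is independent of $v$, bounded in $N$, and $c_N$ may be taken so that $c_N\to1$ as $N\to\infty$. In particular, for $l=0$, and for $l=1$ (with $m\ge1$) respectively, $$\|v-\pi_{N,\omega^{\alpha,\beta,\lambda}}v\|_{0,\omega^{\alpha,\beta,\lambda}}\le c_N N^{-m}\big\|\partial_x^m\{v(x^{1/\lambda})\}\big\|_{0,\omega^{\alpha+m,\beta+m,1}},$$ $$\|\partial_x(v-\pi_{N,\omega^{\alpha,\beta,\lambda}}v)\|_{0,\tilde\omega^{\alpha,\beta,\lambda}}\le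 c_N N^{1-m}\big\|\partial_x^m\{v(x^{1/\lambda})\}\big\|_{0,\omega^{\alpha+m,\beta+m,1}},$$ where $\tilde\omega^{\alpha,\beta,\lambda}(x)=\lambda^{-1}(1-x^\lambda)^{\alpha+1}x^{\beta\lambda+1}$.
   Context: $I=[0,1]$. $\omega^{\alpha,\beta,\lambda}(x)=\lambda(1-x^\lambda)^\alpha x^{(\beta+1)\lambda-1}$, so $\omega^{\alpha,\beta,1}(x)=(1-x)^\alpha x^\beta$; $(u,v)_\omega=\int_0^1uv\,\omega\,dx$ and $\|v\|_{0,\omega}=(v,v)_\omega^{1/2}$. $D_\lambda^1v(x)=\dfrac{d}{dx^\lambda}v(x)=\dfrac{x^{1-\lambda}}{\lambda}v'(x)$, and $D_\lambda^k$ is the $k$-fold composition of $D^1_\lambda$ ($D_\lambda^0$ is the identity). $B^{m,1}_{\alpha,\beta}(I)=\{v:\partial_x^kv\in L^2_{\omega^{\alpha+k,\beta+k,1}}(I),\ 0\le k\le m\}$. $P_N^\lambda(I)=\mathrm{span}\{1,x^\lambda,\dots,x^{N\lambda}\}$, and $\pi_{N,\omega^{\alpha,\beta,\lambda}}:L^2_{\omega^{\alpha,\beta,\lambda}}(I)\to P_N^\lambda(I)$ is the orthogonal projection: $(v-\pi_{N,\omega^{\alpha,\beta,\lambda}}v,v_N)_{\omega^{\alpha,\beta,\lambda}}=0$ for all $v_N\in P_N^\lambda(I)$. *)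

(* Defs.v *)
From HB Require Import structures.
From mathcomp Require Import all_boot all_order all_algebra.
From mathcomp Require Import all_classical all_reals all_analysis.

Set Implicit Arguments.
Unset Strict Implicit.
Unset Printing Implicit Defensive.

Import Order.TTheory GRing.Theory Num.Theory.
Import numFieldNormedType.Exports.

Local Open Scope classical_set_scope.
Local Open Scope ring_scope.

Section MappedJacobi.
Context {R : realType}.
Implicit Types (al be lam : R) (w u v g phi : R -> R).

Definition omega al be lam : R -> R := fun x =>
  lam * (1 - x `^ lam) `^ al * x `^ ((be + 1) * lam - 1).

Definition omega_tilde al be lam : R -> R := fun x =>
  lam^-1 * (1 - x `^ lam) `^ (al + 1) * x `^ (be * lam + 1).

(* Extended-real valued, so that a function that is not square-integrable has
   norm +oo. *)
Definition wdot w u v : \bar R :=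
  (\int[lebesgue_measure]_(x in `[0%R, 1%R]) (u x * v x * w x)%:E)%E.

Definition wnorm w v : \bar R := (wdot w v v `^ 2^-1)%E.

Definition wL2 w v : Prop :=
  measurable_fun (`[0, 1] : set R) v /\ (wnorm w v < +oo)%E.

Definition test_function phi : Prop :=
  (forall n x, derivable (derive1n n phi) x 1) /\
  (exists K : set R, [/\ compact K, K `<=` `]0, 1[ &
     forall x, ~ K x -> phi x = 0]).

(* g is the distributional derivative of order k of u on ]0, 1[. *)
Definition is_weak_derive (k : nat) u g : Prop :=
  [/\ locally_integrable `]0, 1[ u, locally_integrable `]0, 1[ g &
    forall phi, test_function phi ->
      \int[lebesgue_measure]_(x in `]0, 1[) (u x * derive1n k phi x) =
      (- 1) ^+ k * \int[lebesgue_measure]_(x in `]0, 1[) (g x * phi x)].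

(* A representative of the weak derivative, which is unique only up to a null
   set; junk value 0 when there is none.  In particular weak_derive 0 u is only
   almost everywhere equal to u. *)
Definition weak_derive (k : nat) u : R -> R :=
  xget (fun=> 0) [set g | is_weak_derive k u g].

Definition Dlam lam v : R -> R := fun x =>
  x `^ (1 - lam) / lam * weak_derive 1 v x.

Definition Dlam_iter lam (k : nat) v : R -> R := iter k (Dlam lam) v.

(* Existence of the weak derivatives is part of membership. *)
Definition Bspace (m : nat) al be v : Prop :=
  forall k : nat, (k <= m)%N ->
    exists2 g, is_weak_derive k v g & wL2 (omega (al + k%:R) (be + k%:R) 1) g.

Definition Plam (N : nat) lam : set (R -> R) :=
  [set p | exists a : 'I_N.+1 -> R,
     p = fun x => \sum_(i < N.+1) a i * x `^ (i%:R * lam)].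

Definition is_piN (N : nat) al be lam v : set (R -> R) :=
  [set p | Plam N lam p /\
     forall q, Plam N lam q -> wdot (omega al be lam) (v \- p) q = 0%E].

Definition piN (N : nat) al be lam v : R -> R :=
  xget (fun=> 0) (is_piN N al be lam v).

Definition compose_root lam v : R -> R := fun x => v (x `^ lam^-1).

End MappedJacobi.

(* Main.v *)
(* The substitution y = x^lam turns the weighted norm of D_lam^l (v - pi_N v) into the
   norm, with Jacobi weight J(al + l, be + l), of the l-th derivative of u - P, where
   u(y) = v(y^(1/lam)) and P is the orthogonal projection of u onto the polynomials of
   degree at most N.

   The core is a Poincare inequality: if w is orthogonal, for J(al, be), to all
   polynomials of degree < n, then n (n + 1 + al + be) |w|^2 <= |w'|^2, the right-hand
   norm being weighted by J(al + 1, be + 1). It is proved by duality and induction on n,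
   without Jacobi polynomials: with G the primitive of w J(al, be) vanishing at both end
   points, |w|^2 = - int w' G, while g = G / J(al + 1, be + 1) is orthogonal to the
   polynomials of degree < n - 1, so that the inequality for g bounds |g| by |w|.

   The derivative of the error stays orthogonal, for the shifted weight, to polynomials
   of one degree less; iterating from order l to order m multiplies the factors
   (N + 1 - k) (N + 2 + al + be + k) >= (N + 1 - k) N. At order m the error is at most
   the m-th derivative of u, because P^(m) is orthogonal to the error. Weak derivatives
   are handled through locally absolutely continuous representatives. *)
Require Import Defs.
From HB Require Import structures.
From mathcomp Require Import all_boot all_order all_algebra.
From mathcomp Require Import all_classical all_reals all_analysis.
From mathcomp Require Import measurable_realfun.
From mathcomp Require Import ring lra zify.

Import Order.TTheory GRing.Theory Num.Theory.
Import numFieldNormedType.Exports.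

Set Implicit Arguments.
Unset Strict Implicit.

Local Open Scope classical_set_scope.
Local Open Scope ring_scope.

(** * Integrable real functions and the weighted Cauchy-Schwarz inequality *)

Section RealIntegrable.
Context {R : realType}.
Notation mu := (@lebesgue_measure R).
Implicit Types (f g h w : R -> R) (D E : set (measurableTypeR R)) (a b c x y : R).

(** The obstacle lies at the end points. Functions are only known to be locally absolutely
    continuous inside the interval and square-integrable for a weight that may blow up or degenerate
    at 0 and 1, so a boundary term such as [w q J1] has no evident limit there. What integrability
    does give is weaker and suffices: if the square of the boundary term is at most a constant times
    [x (1 - x)] times an integrable function, the term is small at points arbitrarily near each end,
    because 1/x and 1/(1 - x) are not integrable. Integrations by parts are closed at such points.
    In the inductive step of the Poincare inequality, not even the integrability of the squares of
    [g] and [g'] is given; it is extracted from the sign of both terms in the identity that relates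
    them to [w]. The constants add up exactly, since (n + 1) (n + 2 + al + be) = n (n + 3 + al + be)
    + (al + be + 2) and the last summand is the coefficient of the [g^2] term of that identity.
    Nothing is lost from one order to the next, so the first estimate holds with [c = 1]. *)

Definition Rintegrable D f := mu.-integrable D (EFin \o f).

Lemma RintegrableS D E f : measurable D -> measurable E -> D `<=` E ->
  Rintegrable E f -> Rintegrable D f.
Proof. by move=> mD mE DE; exact: integrableS. Qed.

Lemma eq_Rintegrable D f g : measurable D -> (forall x, D x -> f x = g x) ->
  Rintegrable D f -> Rintegrable D g.
Proof. by move=> mD fg; apply: eq_integrable => // x /[!inE] Dx /=; rewrite fg. Qed.

Lemma Rintegrable_measurable D f : Rintegrable D f -> measurable_fun D f.
Proof. by case/integrableP => /measurable_EFinP. Qed.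

Lemma RintegrableD D f g : measurable D -> Rintegrable D f -> Rintegrable D g ->
  Rintegrable D (fun x => f x + g x).
Proof. move=> mD fi gi; exact: (integrableD mD fi gi). Qed.

Lemma RintegrableB D f g : measurable D -> Rintegrable D f -> Rintegrable D g ->
  Rintegrable D (fun x => f x - g x).
Proof. move=> mD fi gi; exact: (integrableB mD fi gi). Qed.

Lemma RintegrableZ D f c : measurable D -> Rintegrable D f ->
  Rintegrable D (fun x => c * f x).
Proof. move=> mD fi; exact: (integrableZl mD c fi). Qed.

Lemma Rintegrable_norm D f : measurable D -> Rintegrable D f ->
  Rintegrable D (fun x => `|f x|).
Proof. by move=> mD; exact: integrable_norm. Qed.

Lemma le_Rintegrable D f g : measurable D -> measurable_fun D f ->
  (forall x, D x -> `|f x| <= g x) -> Rintegrable D g -> Rintegrable D f.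
Proof.
move=> mD mf fg; apply: le_integrable => //; first exact/measurable_EFinP.
by move=> x Dx; rewrite /= lee_fin (le_trans (fg _ Dx))// ler_norm.
Qed.

Lemma RintegrableM_bounded D f h (C : R) : measurable D -> measurable_fun D h ->
  (forall x, D x -> `|h x| <= C) -> Rintegrable D f ->
  Rintegrable D (fun x => f x * h x).
Proof.
move=> mD mh hC fi.
apply: (@le_Rintegrable _ _ (fun x => C * `|f x|)) => //.
- exact: measurable_funM (Rintegrable_measurable fi) mh.
- move=> x Dx; rewrite normrM mulrC; apply: ler_wpM2r => //; exact: hC.
- by apply: RintegrableZ => //; exact: Rintegrable_norm.
Qed.

Lemma EFin_Rintegral D f : measurable D -> Rintegrable D f ->
  (\int[mu]_(x in D) (f x)%:E)%E = (\int[mu]_(x in D) f x)%:E.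
Proof.
move=> mD fi; rewrite /Rintegral fineK//.
have := integrable_fin_num mD fi; exact.
Qed.

Lemma continuous_Rintegrable a b f : {within `[a, b], continuous f} ->
  Rintegrable `[a, b] f.
Proof.
by move=> cf; apply: continuous_compact_integrable => //; exact: segment_compact.
Qed.

(* AM-GM: [2 |f g| <= f^2 + g^2]. *)
Lemma RintegrableM_sqr D f g w : measurable D ->
  measurable_fun D f -> measurable_fun D g -> measurable_fun D w ->
  (forall x, D x -> 0 <= w x) ->
  Rintegrable D (fun x => f x ^+ 2 * w x) ->
  Rintegrable D (fun x => g x ^+ 2 * w x) ->
  Rintegrable D (fun x => f x * g x * w x).
Proof.
move=> mD mf mg mw w0 fi gi.
apply: (@le_Rintegrable _ _ (fun x => f x ^+ 2 * w x + g x ^+ 2 * w x)) => //.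
- by apply: measurable_funM => //; exact: measurable_funM.
- move=> x Dx; rewrite normrM (ger0_norm (w0 _ Dx)) -mulrDl.
  apply: ler_wpM2r; first exact: w0.
  rewrite normrM -(real_normK (num_real (f x))) -(real_normK (num_real (g x))).
  by move: `|f x| `|g x| (normr_ge0 (f x)) (normr_ge0 (g x)) => p q p0 q0; nra.
- exact: RintegrableD.
Qed.

(** The minimum over [t] is attained at [X / B]; when [B = 0] the expression is affine in [t] and
    stays nonnegative only if [X = 0]. *)
Lemma sqr_le_discriminant (A B X : R) : 0 <= A -> 0 <= B ->
  (forall t, 0 <= A - 2 * t * X + t ^+ 2 * B) -> X ^+ 2 <= A * B.
Proof.
move=> A0 B0 H; have [B_eq0|Bn0] := eqVneq B 0.
  have [->|Xn0] := eqVneq X 0; first by rewrite expr0n/= mulr_ge0.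
  (* This [t] would give the value [A - (A + 1) = -1]. *)
  have := H ((A + 1) / (2 * X)).
  rewrite B_eq0 mulr0 addr0.
  have -> : 2 * ((A + 1) / (2 * X)) * X = A + 1 by field.
  by lra.
have Bp : 0 < B by rewrite lt_def Bn0.
have := H (X / B).
have -> : A - 2 * (X / B) * X + (X / B) ^+ 2 * B = A - X ^+ 2 / B by field.
by rewrite subr_ge0 ler_pdivrMr.
Qed.

Lemma Rintegral_cauchy_schwarz D f g w : measurable D ->
  measurable_fun D f -> measurable_fun D g -> measurable_fun D w ->
  (forall x, D x -> 0 <= w x) ->
  Rintegrable D (fun x => f x ^+ 2 * w x) ->
  Rintegrable D (fun x => g x ^+ 2 * w x) ->
  (\int[mu]_(x in D) (f x * g x * w x)) ^+ 2 <=
  (\int[mu]_(x in D) (f x ^+ 2 * w x)) * (\int[mu]_(x in D) (g x ^+ 2 * w x)).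
Proof.
move=> mD mf mg mw w0 fi gi.
have fgi := RintegrableM_sqr mD mf mg mw w0 fi gi.
apply: sqr_le_discriminant.
- by apply: Rintegral_ge0 => x Dx; rewrite mulr_ge0 ?sqr_ge0 ?w0.
- by apply: Rintegral_ge0 => x Dx; rewrite mulr_ge0 ?sqr_ge0 ?w0.
move=> t.
have -> : \int[mu]_(x in D) (f x ^+ 2 * w x) -
   2 * t * \int[mu]_(x in D) (f x * g x * w x) +
   t ^+ 2 * \int[mu]_(x in D) (g x ^+ 2 * w x) =
   \int[mu]_(x in D) ((f x - t * g x) ^+ 2 * w x).
  rewrite -!RintegralZl// -RintegralB//; last exact: RintegrableZ.
  rewrite -RintegralD//; last 2 first.
  - by apply: RintegrableB => //; exact: RintegrableZ.
  - exact: RintegrableZ.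
  by apply: eq_Rintegral => x _; ring.
by apply: Rintegral_ge0 => x Dx; rewrite mulr_ge0 ?sqr_ge0 ?w0.
Qed.

Lemma Rintegral_itv_cat a b c f : a <= b -> b <= c -> Rintegrable `[a, c] f ->
  \int[mu]_(x in `[a, c]) f x =
  \int[mu]_(x in `[a, b]) f x + \int[mu]_(x in `[b, c]) f x.
Proof.
move=> ab bc fi.
have := @Rintegral_itvB R f (BLeft a) (BRight c) b fi.
rewrite !bnd_simp => /(_ ab bc) /eqP; rewrite subr_eq => /eqP ->.
rewrite addrC; congr (_ + _); apply: Rintegral_itv_obnd_cbnd.
apply: RintegrableS fi => //; apply: subset_itv; rewrite bnd_simp//.
Qed.

End RealIntegrable.

(** * Local integrability and exhaustion of the open unit interval *)

Section UnitInterval.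
Context {R : realType}.
Notation mu := (@lebesgue_measure R).
Implicit Types (f g h w : R -> R) (a b c x y e d : R).

(** Segments suffice, since every compact subset of the open interval lies in one. No order between
    [a] and [b] is imposed because a reversed segment is empty. *)
Definition locint f := forall a b, 0 < a -> b < 1 -> Rintegrable `[a, b] f.

Lemma subset_cc_oo a b : 0 < a -> b < 1 -> `[a, b] `<=` (`]0, 1[ : set R).
Proof.
move=> a0 b1 x /=; rewrite !in_itv/= => /andP[ax xb].
by rewrite (lt_le_trans a0 ax) (le_lt_trans xb b1).
Qed.

(** The offset in [n.+2] starts the exhaustion at the single point 1/2, so that no segment is
    empty. *)
Let K01 (n : nat) : set R := `[n.+2%:R^-1, 1 - n.+2%:R^-1].

Lemma unit_itv_bigcup : `]0, 1[%classic = \bigcup_n K01 n.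
Proof.
apply/seteqP; split=> x /=; last first.
  move=> [n _]; apply: subset_cc_oo; first by rewrite invr_gt0 ltr0n.
  by rewrite ltrBlDr ltrDl invr_gt0 ltr0n.
rewrite in_itv/= => /andP[x0 x1].
have m0 : 0 < Num.min x (1 - x) by rewrite lt_min x0 subr_gt0.
have := near_infty_natSinv_lt (PosNum m0) => -[N _ /(_ N.+1 (leqnSn _)) /=].
rewrite lt_min => /andP[h1 h2]; exists N => //=.
by rewrite /K01/= in_itv/= ltW//= lerBrDr addrC -lerBrDr ltW.
Qed.

Lemma unit_itv_nd : nondecreasing_seq K01.
Proof.
move=> m n mn; apply/subsetPset => x; rewrite /K01/= !in_itv/= => /andP[h1 h2].
have : (n.+2%:R^-1 : R) <= m.+2%:R^-1 by rewrite lef_pV2 ?posrE ?ltr0n// ler_nat !ltnS.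
move=> h; rewrite (le_trans h h1)/= (le_trans h2)// lerB//.
Qed.

Lemma locint_measurable f : locint f -> measurable_fun (`]0, 1[ : set R) f.
Proof.
move=> fi; rewrite unit_itv_bigcup; apply/measurable_fun_bigcup.
  by move=> i; exact: measurable_itv.
move=> n; apply: Rintegrable_measurable; apply: fi.
  by rewrite invr_gt0 ltr0n.
by rewrite ltrBlDr ltrDl invr_gt0 ltr0n.
Qed.

Lemma Rintegrable_locint f : Rintegrable `]0, 1[ f -> locint f.
Proof.
move=> fi a b a0 b1; apply: RintegrableS fi => //; exact: subset_cc_oo.
Qed.

(** Monotone convergence along the segments [K01 n], which is where the sign of [f] enters. *)
Lemma Rintegrable_oo_le f (M : R) : locint f ->
  (forall x, 0 < x < 1 -> 0 <= f x) ->
  (forall a b, 0 < a -> a <= b -> b < 1 -> \int[mu]_(x in `[a, b]) f x <= M) ->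
  Rintegrable `]0, 1[ f /\ \int[mu]_(x in `]0, 1[) f x <= M.
Proof.
move=> fi f0 fM.
have mf := locint_measurable fi.
have f0' (x : R) : x \in `]0, 1[ -> (0 <= (f x)%:E)%E.
  by rewrite in_itv/= => xx; rewrite lee_fin f0.
have a0 n : 0 < n.+2%:R^-1 :> R by rewrite invr_gt0 ltr0n.
have b1 n : 1 - n.+2%:R^-1 < 1 :> R by rewrite ltrBlDr ltrDl.
have ab n : n.+2%:R^-1 <= 1 - n.+2%:R^-1 :> R.
  have : n.+2%:R^-1 <= 2^-1 :> R by rewrite lef_pV2 ?posrE// ler_nat.
  by move: (n.+2%:R^-1 : R) => p p2; lra.
have fi_n n : Rintegrable (K01 n) f by apply: fi.
have cvgf : (\int[mu]_(x in K01 n) (f x)%:E @[n --> \oo] -->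
    \int[mu]_(x in `]0%R, 1%R[) (f x)%:E)%E.
  rewrite unit_itv_bigcup; apply: ge0_nondecreasing_set_cvg_integral.
  - exact: unit_itv_nd.
  - by move=> n; exact: measurable_itv.
  - by move=> n; case/integrableP: (fi_n n).
  - by move=> n x Kx; apply: f0'; exact: (subset_cc_oo (a0 n) (b1 n) Kx).
have le : (\int[mu]_(x in `]0%R, 1%R[) (f x)%:E <= M%:E)%E.
  rewrite -(cvg_lim _ cvgf)//; apply: lime_le; first by apply/cvg_ex; eexists; exact: cvgf.
  apply: nearW => n.
  rewrite (@EFin_Rintegral _ (K01 n) f (measurable_itv _) (fi_n n)) lee_fin.
  exact: fM.
have ii : Rintegrable `]0, 1[ f.
  apply/integrableP; split; first exact/measurable_EFinP.
  rewrite (_ : integral _ _ _ = \int[mu]_(x in `]0%R, 1%R[) (f x)%:E)%E.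
    by rewrite (le_lt_trans le)// ltry.
  apply: eq_integral => x; rewrite inE => xD /=.
  by rewrite ger0_norm// -lee_fin; exact: f0'.
by split => //; rewrite -lee_fin -EFin_Rintegral.
Qed.

Lemma Rintegral_split3 f a b : 0 < a -> a <= b -> b < 1 ->
  Rintegrable `]0, 1[ f ->
  \int[mu]_(x in `]0, 1[) f x = \int[mu]_(x in `]0, a]) f x +
    \int[mu]_(x in `[a, b]) f x + \int[mu]_(x in `[b, 1[) f x.
Proof.
move=> a0 ab b1 fi.
have fiS (i : interval R) : [set` i] `<=` `]0, 1[ -> Rintegrable [set` i] f.
  by move=> ii; apply: RintegrableS fi.
have := @Rintegral_itvB R f (BRight 0) (BLeft 1) b fi.
rewrite !bnd_simp => /(_ (ltW (lt_le_trans a0 ab)) b1) /eqP.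
rewrite subr_eq => /eqP ->.
have fi2 : Rintegrable `]0, b] f.
  by apply: fiS; apply: subset_itv; rewrite bnd_simp.
have := @Rintegral_itvB R f (BRight 0) (BRight b) a fi2.
rewrite !bnd_simp => /(_ (ltW a0) ab) /eqP.
rewrite subr_eq => /eqP ->.
rewrite (@Rintegral_itv_obnd_cbnd _ b); last first.
  by apply: fiS; apply: subset_itv; rewrite bnd_simp// (le_trans _ ab)// ltW.
rewrite (@Rintegral_itv_obnd_cbnd _ a); last first.
  by apply: fiS; apply: subset_itv; rewrite bnd_simp// ltW.
by rewrite addrC (addrC (Rintegral _ _ _) (Rintegral _ _ _)).
Qed.

Lemma Rintegral_tails f e : 0 < e -> Rintegrable `]0, 1[ f ->
  exists2 d, 0 < d < 2^-1 &
   (forall a, 0 < a < d -> \int[mu]_(x in `]0, a]) `|f x| < e) /\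
   (forall b, 1 - d < b < 1 -> \int[mu]_(x in `[b, 1[) `|f x| < e).
Proof.
move=> e0 fi.
have fir : mu.-integrable setT (EFin \o (f \_ (`]0, 1[ : set R))).
  by rewrite -restrict_EFin; apply/integrable_restrict => //=; rewrite setTI.
have [d [d0 dP]] := integral_normr_continuous fir e0.
(* The bound 1/3 keeps [d'] strictly below 1/2, so that the two end intervals stay disjoint. *)
pose d' := Num.min d 3^-1.
have d'P : 0 < d' < 2^-1.
  by rewrite lt_min d0/= invr_gt0// ltr0n/= gt_min; apply/orP; right; lra.
exists d' => //; move/andP: d'P => [d'0 d'2].
have d'd : d' <= d by rewrite ge_min lexx.
have H (i : interval R) : (mu [set` i] < d%:E)%E -> [set` i] `<=` `]0, 1[ ->
    \int[mu]_(x in [set` i]) `|f x| < e.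
  move=> mui i01; have := dP [set` i] (measurable_itv i) mui.
  rewrite (_ : Rintegral _ _ _ = \int[mu]_(x in [set` i]) `|f x|)//.
  apply: eq_Rintegral => x /[!inE] xi; rewrite patchE mem_set//.
  exact: i01.
split=> [a /andP[a0 ad]|b /andP[bd b1]]; apply: H.
- rewrite lebesgue_measure_itv/= lte_fin a0 -EFinD lte_fin subr0.
  exact: lt_le_trans ad d'd.
- by apply: subset_itv; rewrite bnd_simp//; lra.
- by rewrite lebesgue_measure_itv/= lte_fin b1 -EFinD lte_fin; lra.
- by apply: subset_itv; rewrite bnd_simp//; lra.
Qed.

End UnitInterval.

(** * Fubini's theorem on a triangle *)

Section Triangle.
Context {R : realType}.
Notation mu := (@lebesgue_measure R).
Implicit Types (f g h w : R -> R) (a b c x y e d : R).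

Lemma Rintegrable_restrictT (D : set (measurableTypeR R)) f : measurable D ->
  Rintegrable D f -> Rintegrable setT (f \_ D).
Proof.
move=> mD fi; rewrite /Rintegrable -restrict_EFin.
by apply/integrable_restrict => //=; rewrite setTI.
Qed.

Lemma integrable_prod f h : Rintegrable setT f -> Rintegrable setT h ->
  (mu \x mu)%E.-integrable setT (fun z : R * R => (f z.2 * h z.1)%:E).
Proof.
move=> fi hi.
have mf := Rintegrable_measurable fi; have mh := Rintegrable_measurable hi.
apply/integrable12ltyP.
  apply/measurable_EFinP; apply: measurable_funM.
  - exact: measurableT_comp mf measurable_snd.
  - exact: measurableT_comp mh measurable_fst.
have fn := Rintegrable_norm (measurableT) fi.
have hn := Rintegrable_norm (measurableT) hi.
rewrite (_ : integral _ _ _ =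
    \int[mu]_x ((\int[mu]_y `|f y|)%R * `|h x|)%:E)%E.
  have := RintegrableZ (\int[mu]_y `|f y|) measurableT hn.
  by move=> ii; have := integrable_fin_num measurableT ii; rewrite ltey_eq => ->.
apply: eq_integral => x _ /=.
under eq_integral do rewrite normrM mulrC EFinM.
rewrite integralZl//.
by rewrite (EFin_Rintegral measurableT fn) -EFinM mulrC.
Qed.

(** Fubini on the triangle [y <= x]. It underlies the product rule for functions known only as
    primitives of integrable functions. *)
Lemma Rintegral_swap_triangle a b f h :
  Rintegrable `[a, b] f -> Rintegrable `[a, b] h ->
  \int[mu]_(x in `[a, b]) (h x * \int[mu]_(y in `[a, x]) f y) =
  \int[mu]_(y in `[a, b]) (f y * \int[mu]_(x in `[y, b]) h x).
Proof.
move=> fi hi.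
pose fa := f \_ `[a, b]; pose ha := h \_ `[a, b].
have fai : Rintegrable setT fa by exact: Rintegrable_restrictT.
have hai : Rintegrable setT ha by exact: Rintegrable_restrictT.
pose F (z : R * R) := if z.2 <= z.1 then fa z.2 * ha z.1 else 0.
have FE z : `|F z| <= `|fa z.2 * ha z.1|.
  by rewrite /F; case: ifP => // _; rewrite normr0.
have Fi : (mu \x mu)%E.-integrable setT (EFin \o F).
  apply: le_integrable (integrable_prod fai hai) => //.
  - apply/measurable_EFinP; apply: measurable_fun_ifT => //.
    + apply: measurable_fun_ler; [exact: measurable_snd|exact: measurable_fst].
    + apply: measurable_funM.
      * exact: measurableT_comp (Rintegrable_measurable fai) measurable_snd.
      * exact: measurableT_comp (Rintegrable_measurable hai) measurable_fst.
  - by move=> z _; rewrite /= lee_fin; exact: FE.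
have L x : (\int[mu]_y (F (x, y))%:E =
    ((fun x => h x * \int[mu]_(y in `[a, x]) f y) \_ `[a, b] x)%:E)%E.
  rewrite patchE; case: ifPn => [|/negP xab]; last first.
    apply: integral0_eq => y _; rewrite /F/= /ha patchE.
    by rewrite memNset ?mulr0 ?if_same// => /mem_set.
  rewrite inE/= in_itv/= => /andP[ax xb].
  have fix_ : Rintegrable `[a, x] f.
    by apply: RintegrableS fi => //; apply: subset_itvl; rewrite bnd_simp.
  rewrite EFinM -EFin_Rintegral// [in RHS]integral_mkcond -integralZl//; last first.
    by rewrite restrict_EFin; exact: Rintegrable_restrictT.
  apply: eq_integral => y _; rewrite /F/= restrict_EFin -EFinM /ha patchE.
  rewrite mem_set/=; last by rewrite in_itv/= ax.
  rewrite /fa !patchE; have [yx|yx] := leP y x; congr EFin.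
  - rewrite mulrC; congr (_ * _).
    have -> : (y \in `[a, b]%classic) = (y \in `[a, x]%classic) => //.
    by rewrite !mem_setE !in_itv/= yx (le_trans yx xb).
  - rewrite memNset ?mulr0//= in_itv/= => /andP[_].
    by rewrite leNgt yx.
have L' y : (\int[mu]_x (F (x, y))%:E =
    ((fun y => f y * \int[mu]_(x in `[y, b]) h x) \_ `[a, b] y)%:E)%E.
  rewrite patchE; case: ifPn => [|/negP yab]; last first.
    apply: integral0_eq => x _; rewrite /F/= /fa patchE.
    by rewrite memNset ?mul0r ?if_same// => /mem_set.
  rewrite inE/= in_itv/= => /andP[ay yb].
  have hix : Rintegrable `[y, b] h.
    by apply: RintegrableS hi => //; apply: subset_itvr; rewrite bnd_simp.
  rewrite EFinM -EFin_Rintegral// [in RHS]integral_mkcond -integralZl//; last first.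
    by rewrite restrict_EFin; exact: Rintegrable_restrictT.
  apply: eq_integral => x _; rewrite /F/= restrict_EFin -EFinM /fa patchE.
  rewrite mem_set/=; last by rewrite in_itv/= ay.
  rewrite /ha !patchE; have [yx|yx] := leP y x; congr EFin.
  - congr (_ * _).
    have -> : (x \in `[a, b]%classic) = (x \in `[y, b]%classic) => //.
    by rewrite !mem_setE !in_itv/= yx (le_trans ay yx).
  - rewrite memNset ?mulr0//= in_itv/= => /andP[].
    by rewrite leNgt yx.
have := Fubini Fi => /=.
under eq_integral do rewrite L.
under [in RHS]eq_integral do rewrite L'.
by move=> E; rewrite Rintegral_mkcond [RHS]Rintegral_mkcond; exact: (congr1 fine E).
Qed.

End Triangle.

(** * Locally absolutely continuous functions and their boundary behaviour *)

Section LocallyAC.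
Context {R : realType}.
Notation mu := (@lebesgue_measure R).
Implicit Types (f g h w v : R -> R) (a b c x y e d : R).

(** Local absolute continuity of [w] with almost-everywhere derivative [f]: [w] is controlled at
    every interior point, [f] only up to a null set. *)
Definition lac w f := locint f /\ forall a b, 0 < a -> a <= b -> b < 1 ->
  w b - w a = \int[mu]_(x in `[a, b]) f x.

Lemma eq_locint f g : (forall x, 0 < x < 1 -> f x = g x) -> locint f -> locint g.
Proof.
move=> fg fi a b a0 b1; apply: eq_Rintegrable (fi _ _ a0 b1) => // x xab.
by apply: fg; have := subset_cc_oo a0 b1 xab; rewrite /= in_itv.
Qed.

Lemma eq_lac w v f g : (forall x, 0 < x < 1 -> w x = v x) ->
  (forall x, 0 < x < 1 -> f x = g x) -> lac w f -> lac v g.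
Proof.
move=> wv fg [fi wf]; split; first exact: eq_locint fg fi.
move=> a b a0 ab b1; rewrite -!wv; last 2 first.
- by rewrite a0 (le_lt_trans ab).
- by rewrite b1 (lt_le_trans a0).
rewrite wf//; apply: eq_Rintegral => x /[!inE] xab; apply: fg.
by have := subset_cc_oo a0 b1 xab; rewrite /= in_itv.
Qed.

Lemma locintB f g : locint f -> locint g -> locint (fun x => f x - g x).
Proof. by move=> fi gi a b a0 b1; apply: RintegrableB => //; [exact: fi|exact: gi]. Qed.

Lemma locintD f g : locint f -> locint g -> locint (fun x => f x + g x).
Proof. by move=> fi gi a b a0 b1; apply: RintegrableD => //; [exact: fi|exact: gi]. Qed.

Lemma lacB w v f g : lac w f -> lac v g ->
  lac (fun x => w x - v x) (fun x => f x - g x).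
Proof.
move=> [fi wf] [gi vg]; split; first exact: locintB.
move=> a b a0 ab b1; rewrite RintegralB//; [|exact: fi|exact: gi].
by rewrite -wf// -vg//; ring.
Qed.

Lemma lac_continuous w f x : lac w f -> 0 < x < 1 -> {for x, continuous w}.
Proof.
move=> [fi wf] /andP[x0 x1].
pose a := x / 2; pose b := (1 + x) / 2.
have a0 : 0 < a by rewrite divr_gt0.
have ax : a < x by rewrite /a; lra.
have xb : x < b by rewrite /b; lra.
have b1 : b < 1 by rewrite /b; lra.
have ab : a < b := lt_trans ax xb.
have := parameterized_integral_continuous (ltW ab) (fi _ _ a0 b1).
move/(continuous_within_itvP _ ab) => -[+ _ _] => /(_ x).
rewrite in_itv/= ax xb => /(_ isT) cG.
have wE y : y \in `]a, b[ -> w y = w a + parameterized_integral mu a y f.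
  rewrite in_itv/= => /andP[ay yb]; rewrite /parameterized_integral.
  by rewrite -wf// ?(ltW ay) ?(lt_trans yb)//; ring.
have nx : \forall y \near x, y \in `]a, b[ by apply: near_in_itvoo; rewrite in_itv/= ax.
rewrite /prop_for /continuous_at wE ?in_itv/= ?ax//.
apply: cvg_trans (cvgD (cvg_cst (w a)) cG).
by apply: near_eq_cvg; near=> y; have /wE -> : y \in `]a, b[ by near: y.
Unshelve. all: by end_near. Qed.

Lemma lac_within_continuous w f a b : lac w f -> 0 < a -> b < 1 ->
  {within `[a, b], continuous w}.
Proof.
move=> wf a0 b1; apply: continuous_in_subspaceT => x /[!inE] /= xab.
apply: lac_continuous wf _; have := subset_cc_oo a0 b1 xab.
by rewrite /= in_itv.
Qed.

Lemma lac_locint w f : lac w f -> locint w.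
Proof.
by move=> wf a b a0 b1; apply: continuous_Rintegrable; exact: lac_within_continuous wf a0 b1.
Qed.

Lemma lac_bounded w f a b : lac w f -> 0 < a -> b < 1 ->
  exists2 C, 0 <= C & forall x, a <= x <= b -> `|w x| <= C.
Proof.
move=> wf a0 b1; have [ab|ba] := leP a b; last first.
  by exists 0 => // x /andP[ax xb]; have := le_trans ax xb; rewrite leNgt ba.
have cw : {within `[a, b], continuous (fun x => `|w x|)}.
  move=> x; apply: continuous_comp; first exact: lac_within_continuous wf a0 b1 x.
  exact: norm_continuous.
have [c cab cmax] := EVT_max ab cw.
by exists `|w c| => // x xab; apply: cmax; rewrite in_itv.
Qed.

Lemma locintM f w g : lac w g -> locint f -> locint (fun x => f x * w x).
Proof.
move=> wg fi a b a0 b1; have [C C0 wC] := lac_bounded wg a0 b1.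
apply: (RintegrableM_bounded (C := C)) => //; last exact: fi.
by have := Rintegrable_measurable (lac_locint wg a0 b1).
Qed.

(** Write [w x] as [w a] plus the integral of [f] over [[a, x]], and [v x] as [v b] minus the
    integral of [g] over [[x, b]]. Anchoring the factors at opposite ends makes the two double
    integrals cancel by the triangle identity. *)
Lemma lacM w v f g : lac w f -> lac v g ->
  lac (fun x => w x * v x) (fun x => f x * v x + g x * w x).
Proof.
move=> wf vg; split.
  by apply: locintD; [exact: locintM vg wf.1|exact: locintM wf vg.1].
move=> a b a0 ab b1.
have fi := wf.1 _ _ a0 b1; have gi := vg.1 _ _ a0 b1.
rewrite RintegralD//; [|exact: (locintM vg wf.1)|exact: (locintM wf vg.1)].
have in01 x : x \in `[a, b]%classic -> a <= x /\ x <= b.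
  by rewrite inE/= in_itv/= => /andP[].
have Eg : \int[mu]_(x in `[a, b]) (g x * w x) =
    \int[mu]_(x in `[a, b]) (w a * g x) +
    \int[mu]_(x in `[a, b]) (g x * \int[mu]_(y in `[a, x]) f y).
  rewrite -RintegralD//; last 2 first.
  - exact: RintegrableZ.
  - apply: (@eq_Rintegrable _ _ (fun x => g x * w x - w a * g x)) => //.
      move=> x; rewrite /= in_itv/= => /andP[ax xb].
      by rewrite -wf.2// ?(le_lt_trans xb)//; ring.
    apply: RintegrableB => //; first exact: (locintM wf vg.1).
    exact: RintegrableZ.
  apply: eq_Rintegral => x /in01[ax xb].
  by rewrite -wf.2// ?(le_lt_trans xb)//; ring.
have Ef : \int[mu]_(x in `[a, b]) (f x * v x) =
    \int[mu]_(x in `[a, b]) (v b * f x) -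
    \int[mu]_(x in `[a, b]) (f x * \int[mu]_(y in `[x, b]) g y).
  rewrite -RintegralB//; last 2 first.
  - exact: RintegrableZ.
  - apply: (@eq_Rintegrable _ _ (fun x => v b * f x - f x * v x)) => //.
      move=> x; rewrite /= in_itv/= => /andP[ax xb].
      by rewrite -vg.2// ?(lt_le_trans a0)//; ring.
    apply: RintegrableB => //; last exact: (locintM vg wf.1).
    exact: RintegrableZ.
  apply: eq_Rintegral => x /in01[ax xb].
  by rewrite -vg.2// ?(lt_le_trans a0)//; ring.
rewrite Eg Ef (Rintegral_swap_triangle fi gi) !RintegralZl//.
by rewrite -wf.2// -vg.2//; ring.
Qed.

Lemma C1_lac w f : (forall x, 0 < x < 1 -> is_derive x 1 w (f x)) ->
  (forall x, 0 < x < 1 -> {for x, continuous f}) -> lac w f.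
Proof.
move=> df cf.
have cfab a b : 0 < a -> b < 1 -> {within `[a, b], continuous f}.
  move=> a0 b1; apply: continuous_in_subspaceT => x /[!inE] /= xab.
  by apply: cf; have := subset_cc_oo a0 b1 xab; rewrite /= in_itv.
split; first by move=> a b a0 b1; exact/continuous_Rintegrable/cfab.
move=> a b a0; rewrite le_eqVlt => /predU1P[<- b1|ab b1].
  by rewrite set_itv1 Rintegral_set1 subrr.
have dw x : 0 < x < 1 -> derivable w x 1 by move=> /df[].
have cw x : 0 < x < 1 -> {for x, continuous w}.
  by move=> /dw/derivable1_diffP/differentiable_continuous.
have a01 : 0 < a < 1 by rewrite a0 (lt_trans ab).
have b01 : 0 < b < 1 by rewrite b1 (lt_trans a0).
have x01 x : x \in `]a, b[ -> 0 < x < 1.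
  by rewrite in_itv/= => /andP[ax xb]; rewrite (lt_trans a0)//= (lt_trans xb).
have dwab : derivable_oo_LRcontinuous w a b.
  split; first by move=> x /x01/dw.
  - exact/cvg_at_right_filter/cw.
  - exact/cvg_at_left_filter/cw.
have := continuous_FTC2 ab (cfab a b a0 b1) dwab.
rewrite /Rintegral => ->; first by rewrite -EFinB.
by move=> x /x01/df[_ <-]; rewrite derive1E.
Qed.

Lemma lac_cst c : lac (fun=> c) (fun=> 0).
Proof.
by apply: C1_lac => x _; exact: cst_continuous.
Qed.

Lemma lac_horner (p : {poly R}) : lac (horner p) (horner (deriv p)).
Proof. by apply: C1_lac => x _; exact: continuous_horner. Qed.

Lemma lacZ c w f : lac w f -> lac (fun x => c * w x) (fun x => c * f x).
Proof.
by move=> wf; apply: eq_lac (lacM (lac_cst c) wf) => // x _; ring.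
Qed.

Lemma lacD w v f g : lac w f -> lac v g ->
  lac (fun x => w x + v x) (fun x => f x + g x).
Proof.
move=> wf vg.
by apply: eq_lac (lacB wf (lacZ (-1) vg)) => // x _; ring.
Qed.

(** Weaker than tending to 0 at both ends: small values at some points near each end are enough to
    cut an integral there, and integrability alone yields only such points. *)
Definition vanishing_ends v := forall e d, 0 < e -> 0 < d ->
  (exists2 a, 0 < a < d & `|v a| < e) /\ (exists2 b, 1 - d < b < 1 & `|v b| < e).

(** Cut at points [a] and [b] where [v] is small and beyond which the tails of [f] are small: the
    two tails and the two boundary values cost [e / 4] each. *)
Lemma lac_int0 v f : lac v f -> vanishing_ends v -> Rintegrable `]0, 1[ f ->
  \int[mu]_(x in `]0, 1[) f x = 0.
Proof.
move=> vf v0 fi; apply/eqP; rewrite -normr_le0; apply/ler_addgt0Pl => e e0.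
rewrite addr0.
have e4 : 0 < e / 4 by rewrite divr_gt0.
have [d /andP[d0 d2] [fa fb]] := Rintegral_tails e4 fi.
have [[a /andP[a0 ad] va] [b /andP[bd b1] vb]] := v0 _ _ e4 d0.
have ab : a <= b by lra.
rewrite (Rintegral_split3 a0 ab b1 fi) -vf.2//.
have := fa a; rewrite a0 ad => /(_ isT) {}fa.
have := fb b; rewrite bd b1 => /(_ isT) {}fb.
have key (i : interval R) : [set` i] `<=` `]0, 1[ ->
    \int[mu]_(x in [set` i]) `|f x| < e / 4 ->
    `|\int[mu]_(x in [set` i]) f x| < e / 4.
  move=> i01; apply: le_lt_trans; apply: le_normr_Rintegral => //.
  exact: RintegrableS fi.
have {}fa : `|\int[mu]_(x in `]0, a]) f x| < e / 4.
  by apply: key => //; apply: subset_itv; rewrite bnd_simp//; lra.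
have {}fb : `|\int[mu]_(x in `[b, 1[) f x| < e / 4.
  by apply: key => //; apply: subset_itv; rewrite bnd_simp//; lra.
move: fa fb va vb; rewrite !ltr_norml.
move=> /andP[? ?] /andP[? ?] /andP[? ?] /andP[? ?].
by rewrite ler_norml; apply/andP; split; lra.
Qed.

(** Over [[a', b']] the integral of [g] is that of [f] minus the increment of [v], which is below 2
    in absolute value when [|v| < 1] at both points. Such segments exhaust the interval, so the sign
    of [g] gives its integrability. *)
Lemma lac_int_ge0 v f g : lac v (fun x => f x - g x) -> vanishing_ends v ->
  Rintegrable `]0, 1[ f -> locint g -> (forall x, 0 < x < 1 -> 0 <= g x) ->
  Rintegrable `]0, 1[ g /\
  \int[mu]_(x in `]0, 1[) g x = \int[mu]_(x in `]0, 1[) f x.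
Proof.
move=> vfg v0 fi gi g0.
have key (p q r s t p' q' : R) : -1 < p' -> p' < 1 -> -1 < q' -> q' < 1 ->
    p <= q -> r <= s -> - r <= t -> t <= r -> q' - p' = t - q -> p <= s + 2.
  by move=> *; lra.
have gl : Rintegrable `]0, 1[ g.
  apply: (proj1 (@Rintegrable_oo_le _ _
    (\int[mu]_(x in `]0, 1[) `|f x| + 2) gi g0 _)) => a b a0 ab b1.
  have d0 : 0 < Num.min a (1 - b) by rewrite lt_min a0 subr_gt0.
  have [[a' /andP[a'0]]] := v0 _ _ ltr01 d0.
  rewrite lt_min => /andP[a'a _] va' [b' /andP[+ b'1] vb'].
  rewrite ltrBlDr -ltrBlDl lt_min => /andP[_ bb'].
  have {}bb' : b < b' by lra.
  have ab' : a' <= b' by lra.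
  have := vfg.2 _ _ a'0 ab' b'1.
  have fi' : Rintegrable `[a', b'] f by exact: Rintegrable_locint.
  have fn := Rintegrable_norm (measurable_itv `]0, 1[) fi.
  rewrite RintegralB//; last exact: gi.
  have := le_normr_Rintegral (mu := mu) (measurable_itv `[a', b']) fi'.
  have : \int[mu]_(t in `[a', b']) `|f t| <= \int[mu]_(t in `]0, 1[) `|f t|.
    rewrite (Rintegral_split3 a'0 ab' b'1 fn).
    by rewrite addrAC lerDr addr_ge0//; apply: Rintegral_ge0 => x _.
  have : \int[mu]_(t in `[a, b]) g t <= \int[mu]_(t in `[a', b']) g t.
    have gi' := gi _ _ a'0 b'1.
    rewrite (Rintegral_itv_cat (ltW a'a) _ gi'); last by lra.
    have giab : Rintegrable `[a, b'] g by apply: gi => //.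
    rewrite (Rintegral_itv_cat ab (ltW bb') giab).
    rewrite addrCA lerDl addr_ge0//; apply: Rintegral_ge0 => x;
      rewrite /= in_itv/= => /andP[x1 x2]; apply: g0; lra.
  move: va' vb'; rewrite !ltr_norml ler_norml => /andP[h1 h2] /andP[h3 h4] h5 h6 /andP[h7 h8] h9.
  exact: key h1 h2 h3 h4 h5 h6 h7 h8 h9.
split => //.
have := lac_int0 vfg v0 (RintegrableB (measurable_itv _) fi gl).
by rewrite RintegralB// => /eqP; rewrite subr_eq0 => /eqP.
Qed.

(* If [v^2 <= C h x (1 - x)] stayed away from [0] near an end point, the
   integral of [h] over every dyadic interval [[a, 2 a]] would be bounded below. *)
Lemma vanishing_ends_sqr v h d0 (C : R) : 0 < d0 -> 0 <= C ->
  Rintegrable `]0, 1[ h ->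
  (forall x, 0 < x < 1 -> 0 <= h x) ->
  (forall x, 0 < x < 1 -> (x < d0) || (1 - d0 < x) ->
     v x ^+ 2 <= C * (h x * (x * (1 - x)))) ->
  vanishing_ends v.
Proof.
move=> d00 C0 hi h0 vh e d e0 d_gt0.
(* This is the least mass that [h] can have on an interval of length [s / 3] where
   [x (1 - x) <= 2 s / 3] and [|v| >= e]; adding 1 to [C] keeps the divisor positive. *)
have e2 : 0 < e ^+ 2 / (2 * (C + 1)) by rewrite divr_gt0 ?exprn_gt0// mulr_gt0// ltr_pwDr.
have [r /andP[r0 r2] [ha hb]] := Rintegral_tails e2 hi.
pose s := Num.min r (Num.min d d0).
have s0 : 0 < s by rewrite !lt_min r0 d_gt0.
have sr : s <= r by rewrite ge_min lexx.
have sd : s <= d by rewrite ge_min ge_min lexx orbT.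
have sd0 : s <= d0 by rewrite !ge_min lexx !orbT.
have ineq x y : 0 < x < 1 -> (x < d0) || (1 - d0 < x) -> e <= `|v x| ->
    x * (1 - x) <= y -> 0 < y -> e ^+ 2 / (C + 1) / y <= `|h x|.
  move=> x01 xd ev xy y0; have hx0 := h0 _ x01.
  rewrite ger0_norm// ler_pdivrMr// ler_pdivrMr; last by rewrite ltr_pwDr.
  apply: (@le_trans _ _ (v x ^+ 2)).
    by rewrite -(real_normK (num_real (v x))) lerXn2r ?nnegrE// ltW.
  apply: (le_trans (vh _ x01 xd)).
  have : 0 <= x * (1 - x) by move/andP: x01 => [? ?]; apply: mulr_ge0; lra.
  move: (x * (1 - x)) xy => z zy z0.
  have : h x * z <= h x * y by rewrite ler_wpM2l.
  have : 0 <= h x * z by exact: mulr_ge0.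
  move: (h x * z) (h x * y) => p q; clear -C0; nra.
have hn := Rintegrable_norm (measurable_itv `]0, 1[) hi.
have s3 : 0 < 2 * s / 3 by lra.
have key p q : 0 < p -> q < 1 -> q - p = s / 3 ->
    (forall x, p <= x <= q -> [/\ 0 < x < 1, (x < d0) || (1 - d0 < x),
      e <= `|v x| & x * (1 - x) <= 2 * s / 3]) ->
    e ^+ 2 / (2 * (C + 1)) <= \int[mu]_(x in `[p, q]) `|h x|.
  move=> p0 q1 qp pq; have pq' : p < q by lra.
  have -> : e ^+ 2 / (2 * (C + 1)) =
      \int[mu]_(x in `[p, q]) (e ^+ 2 / (C + 1) / (2 * s / 3)).
    rewrite Rintegral_cst//= lebesgue_measure_itv/= lte_fin pq' -EFinD/= qp.
    by field; rewrite !gt_eqF//; lra.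
  apply: le_Rintegral => //.
  - by apply: continuous_Rintegrable => x; exact: cst_continuous.
  - by apply: (Rintegrable_locint hn).
  - by move=> x; rewrite /= in_itv/= => /pq[? ? ? ?]; exact: ineq.
have s12 : s < 2^-1 := le_lt_trans sr r2.
split; apply: contrapT => H.
- have Hx x : 0 < x < s -> e <= `|v x|.
    move=> /andP[x0 xs]; rewrite leNgt; apply/negP => vx; apply: H.
    by exists x => //; rewrite x0 (lt_le_trans xs).
  have := ha (2 * s / 3); rewrite s3 => /(_ ltac:(clear -s0 sr; lra)).
  apply/negP; rewrite -leNgt.
  apply: le_trans (key (s / 3) (2 * s / 3) _ _ _ _) _; [clear -s0 s12; lra|clear -s0 s12; lra|clear; lra| |].
    move=> x /andP[x1 x2]; split; [clear -x1 x2 s0 s12; apply/andP; split; lra| | |clear -x1 x2 s0 s12; nra].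
    + by apply/orP; left; clear -x2 s0 sd0; lra.
    + by apply: Hx; clear -x1 x2 s0; apply/andP; split; lra.
  have ht : Rintegrable `]0, 2 * s / 3] (fun x => `|h x|).
    by apply: RintegrableS hn => //; apply: subset_itv; rewrite bnd_simp//; clear -s0 s12; lra.
  have := @Rintegral_itvB R _ (BRight 0) (BRight (2 * s / 3)) (s / 3) ht.
  rewrite !bnd_simp => /(_ ltac:(clear -s0; lra) ltac:(clear -s0; lra)) /eqP.
  rewrite subr_eq => /eqP ->; rewrite Rintegral_itv_obnd_cbnd ?lerDl.
    by apply: Rintegral_ge0.
  by apply: RintegrableS ht => //; apply: subset_itv; rewrite bnd_simp//; clear -s0 s12; lra.
- have Hx x : 1 - s < x < 1 -> e <= `|v x|.
    move=> /andP[x0 xs]; rewrite leNgt; apply/negP => vx; apply: H.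
    by exists x => //; rewrite xs andbT; clear -x0 sd; lra.
  have := hb (1 - 2 * s / 3).
  have -> : 1 - r < 1 - 2 * s / 3 < 1 by clear -s0 sr; apply/andP; split; lra.
  move=> /(_ isT); apply/negP; rewrite -leNgt.
  apply: le_trans (key (1 - 2 * s / 3) (1 - s / 3) _ _ _ _) _; [clear -s0 s12; lra|clear -s0 s12; lra|clear; lra| |].
    move=> x /andP[x1 x2]; split; [clear -x1 x2 s0 s12; apply/andP; split; lra| | |clear -x1 x2 s0 s12; nra].
    + by apply/orP; right; clear -x1 s0 sd0; lra.
    + by apply: Hx; clear -x1 x2 s0; apply/andP; split; lra.
  have ht : Rintegrable `[1 - 2 * s / 3, 1[ (fun x => `|h x|).
    by apply: RintegrableS hn => //; apply: subset_itv; rewrite bnd_simp//; clear -s0 s12; lra.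
  have := @Rintegral_itvB R _ (BLeft (1 - 2 * s / 3)) (BLeft 1) (1 - s / 3) ht.
  rewrite !bnd_simp => /(_ ltac:(clear -s0; lra) ltac:(clear -s0; lra)) /eqP.
  by rewrite subr_eq => /eqP ->; rewrite lerDr; apply: Rintegral_ge0.
Qed.

End LocallyAC.

(** * The Jacobi weight: derivative, integrability, tails *)

Section JacobiWeight.
Context {R : realType}.
Notation mu := (@lebesgue_measure R).
Implicit Types (al be x y a b : R).

(** It agrees with [omega al be 1] at positive points. *)
Definition jacobi al be x := (1 - x) `^ al * x `^ be.

Lemma jacobi_gt0 al be x : 0 < x < 1 -> 0 < jacobi al be x.
Proof.
by move=> /andP[x0 x1]; rewrite mulr_gt0// powR_gt0// subr_gt0.
Qed.

Lemma jacobi_ge0 al be x : 0 <= jacobi al be x.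
Proof. by rewrite mulr_ge0 ?powR_ge0. Qed.

Lemma jacobiS al be x : 0 < x < 1 ->
  jacobi (al + 1) (be + 1) x = jacobi al be x * (x * (1 - x)).
Proof.
move=> /andP[x0 x1]; rewrite /jacobi !powRD; last 2 first.
- by rewrite (gt_eqF x0) implybT.
- by rewrite (@gt_eqF _ _ (1 - x) 0) ?implybT ?subr_gt0.
by rewrite !powRr1 ?subr_ge0 ?ltW//; ring.
Qed.

Lemma jacobi_le1 al be x : 0 <= al -> 0 <= be -> 0 < x < 1 -> jacobi al be x <= 1.
Proof.
move=> al0 be0 /andP[x0 x1].
have pw (c y : R) : 0 <= c -> 0 < y <= 1 -> y `^ c <= 1.
  by move=> c0 y01; have := ger_powR y01 c0; rewrite powRr0.
rewrite -[leRHS]mulr1 ler_pM ?powR_ge0//; apply: pw => //.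
  by rewrite subr_gt0 x1/= gerBl ltW.
by rewrite x0 ltW.
Qed.

Lemma is_derive_jacobi al be x : 0 < x < 1 ->
  is_derive x 1 (jacobi (al + 1) (be + 1))
    (jacobi al be x * ((be + 1) * (1 - x) - (al + 1) * x)).
Proof.
move=> /andP[x0 x1]; have x1' : 0 < 1 - x by rewrite subr_gt0.
have d1 : is_derive x 1 (fun y => 1 - y) (-1 : R).
  by apply: is_derive_eq (is_deriveB (is_derive_cst (1 : R) x 1) (is_derive_id x 1)) _; rewrite sub0r.
have d2 := is_derive1_comp (f := fun y => y `^ (al + 1)) (g := fun y => 1 - y)
  (is_derive1_powR (al + 1) x1') d1.
have d3 := is_deriveM d2 (is_derive1_powR (be + 1) x0).
apply: is_derive_eq d3 _.
rewrite /= !addrK /jacobi /GRing.scale/= !powRD; last 2 first.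
- by rewrite (gt_eqF x0) implybT.
- by rewrite (gt_eqF x1') implybT.
by rewrite !powRr1 ?ltW//; ring.
Qed.

Lemma jacobi_continuous al be x : 0 < x < 1 -> {for x, continuous (jacobi al be)}.
Proof.
move=> x01; have := is_derive_jacobi (al - 1) (be - 1) x01.
by rewrite !subrK => -[/derivable1_diffP/differentiable_continuous].
Qed.

Lemma lac_jacobi al be : lac (jacobi (al + 1) (be + 1))
  (fun x => jacobi al be x * ((be + 1) * (1 - x) - (al + 1) * x)).
Proof.
apply: C1_lac => x x01; first exact: is_derive_jacobi.
apply: continuousM; first exact: jacobi_continuous.
have -> : (fun y : R => (be + 1) * (1 - y) - (al + 1) * y) =
    horner ((be + 1)%:P * (1 - 'X) - (al + 1)%:P * 'X).
  by apply/funext => y; rewrite !hornerE.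
exact: continuous_horner.
Qed.

Lemma lac_jacobi_inv al be : lac (fun x => (jacobi (al + 1) (be + 1) x)^-1)
  (fun x => - (jacobi al be x * ((be + 1) * (1 - x) - (al + 1) * x) /
     jacobi (al + 1) (be + 1) x ^+ 2)).
Proof.
have j0 x : 0 < x < 1 -> jacobi (al + 1) (be + 1) x != 0.
  by move=> x01; rewrite gt_eqF// jacobi_gt0.
apply: C1_lac => x x01.
  have := is_deriveV (j0 _ x01) (is_derive_jacobi al be x01).
  by move=> d; apply: is_derive_eq d _; rewrite /GRing.scale/= mulNr mulrC.
apply: continuousN; apply: continuousM.
  apply: continuousM; first exact: jacobi_continuous.
  have -> : (fun y : R => (be + 1) * (1 - y) - (al + 1) * y) =
      horner ((be + 1)%:P * (1 - 'X) - (al + 1)%:P * 'X).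
    by apply/funext => y; rewrite !hornerE.
  exact: continuous_horner.
apply: continuousV; first by rewrite sqrf_eq0 j0.
by apply: continuousM; exact: jacobi_continuous.
Qed.

Lemma locint_jacobi al be : locint (jacobi al be).
Proof.
have := lac_jacobi (al - 1) (be - 1); rewrite !subrK; exact: lac_locint.
Qed.

Lemma measurable_jacobi al be : measurable_fun (`]0, 1[ : set R) (jacobi al be).
Proof. exact: locint_measurable (locint_jacobi al be). Qed.

(* Near each end point the derivative of [jacobi (al + 1) (be + 1)] is
   comparable to [jacobi al be], which gives integrability and the tail bounds. *)
Lemma jacobi_tail_bounds al be : -1 < al -> -1 < be ->
  exists d C : R, [/\ 0 < d < 2^-1, 0 <= C,
    forall a b, 0 < a -> a <= b -> b < d ->
      \int[mu]_(x in `[a, b]) jacobi al be x <= C * jacobi (al + 1) (be + 1) b &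
    forall a b, 1 - d < a -> a <= b -> b < 1 ->
      \int[mu]_(x in `[a, b]) jacobi al be x <= C * jacobi (al + 1) (be + 1) a].
Proof.
move=> al1 be1; pose m := Num.min (be + 1) (al + 1).
have m0 : 0 < m by rewrite lt_min -ltrBlDr sub0r be1 -ltrBlDr sub0r al1.
have mb : m <= be + 1 by rewrite ge_min lexx.
have ma : m <= al + 1 by rewrite ge_min lexx orbT.
have [lacJi lacJ] := lac_jacobi al be.
have s2 : 0 < 2 * (al + be + 2) by lra.
(* For [x <= d] the factor [(be + 1) (1 - x) - (al + 1) x = be + 1 - (al + be + 2) x] is at least
   [m / 2], and symmetrically near 1 with the opposite sign; hence the constant [2 / m]. *)
pose d := m / (2 * (al + be + 2)).
have d0 : 0 < d by rewrite divr_gt0.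
have dm : d * (2 * (al + be + 2)) = m by rewrite divfK// gt_eqF.
have d2 : d < 2^-1 by move: d0 dm; clear -mb ma m0; move: d => d d0 dm; nra.
have m2 : 0 <= 2 / m by rewrite divr_ge0 ?ltW.
exists d, (2 / m); split=> //.
- by rewrite d0.
- move=> a b a0 ab bd; have b1 : b < 1 by lra.
  have J0 := jacobi_ge0 (al + 1) (be + 1) a.
  apply: (@le_trans _ _ (2 / m * (jacobi (al + 1) (be + 1) b - jacobi (al + 1) (be + 1) a))).
    rewrite lacJ// -RintegralZl//; last exact: lacJi.
    apply: le_Rintegral => //; first exact: locint_jacobi.
      by apply: RintegrableZ => //; exact: lacJi.
    move=> x; rewrite /= in_itv/= => /andP[ax xb].
    rewrite mulrCA -[leLHS]mulr1 ler_wpM2l ?jacobi_ge0//.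
    rewrite mulrAC ler_pdivlMr// mul1r.
    have : x <= d by rewrite (le_trans xb) ?ltW.
    by move: d0 dm; clear -mb ma m0; move: d => d d0 dm xd; nra.
  by rewrite ler_wpM2l// gerBl.
- move=> a b da ab b1; have a0 : 0 < a by lra.
  have J0 := jacobi_ge0 (al + 1) (be + 1) b.
  apply: (@le_trans _ _ (- (2 / m) * (jacobi (al + 1) (be + 1) b - jacobi (al + 1) (be + 1) a))).
    rewrite lacJ// -RintegralZl//; last exact: lacJi.
    apply: le_Rintegral => //; first exact: locint_jacobi.
      by apply: RintegrableZ => //; exact: lacJi.
    move=> x; rewrite /= in_itv/= => /andP[ax xb].
    rewrite mulrCA -[leLHS]mulr1 ler_wpM2l ?jacobi_ge0//.
    rewrite mulNr -mulrN mulrAC ler_pdivlMr// mul1r.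
    have : 1 - x <= d by lra.
    by move: d0 dm; clear -mb ma m0; move: d => d d0 dm xd; nra.
  by rewrite mulNr -mulrN opprB ler_wpM2l// gerBl.
Qed.

Lemma Rintegrable_jacobi al be : -1 < al -> -1 < be ->
  Rintegrable `]0, 1[ (jacobi al be).
Proof.
move=> al1 be1; have [d [C [/andP[d0 d2] C0 H0 H1]]] := jacobi_tail_bounds al1 be1.
have Ji := locint_jacobi al be.
pose p := d / 2.
have p0 : 0 < p by rewrite divr_gt0.
have pd : p < d by rewrite /p; lra.
have p1 : p <= 1 - p by lra.
pose M := C * jacobi (al + 1) (be + 1) p +
  \int[mu]_(x in `[p, 1 - p]) jacobi al be x + C * jacobi (al + 1) (be + 1) (1 - p).
apply: (proj1 (@Rintegrable_oo_le _ _ M Ji _ _)).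
  by move=> x _; exact: jacobi_ge0.
move=> a b a0 ab b1.
(* Enlarging [[a, b]] until it contains [[p, 1 - p]] lets one splitting serve for all positions of
   [a] and [b]. *)
pose a' := Num.min a p; pose b' := Num.max b (1 - p).
have a'0 : 0 < a' by rewrite lt_min a0.
have b'1 : b' < 1 by rewrite gt_max b1/=; lra.
have a'p : a' <= p by rewrite ge_min lexx orbT.
have a'a : a' <= a by rewrite ge_min lexx.
have b'p : 1 - p <= b' by rewrite le_max lexx orbT.
have b'b : b <= b' by rewrite le_max lexx.
have Jg (i : interval R) : 0 <= \int[mu]_(x in [set` i]) jacobi al be x.
  by apply: Rintegral_ge0 => x _; exact: jacobi_ge0.
apply: (@le_trans _ _ (\int[mu]_(x in `[a', b']) jacobi al be x)).
  rewrite (Rintegral_itv_cat a'a (le_trans ab b'b)) ?(Rintegral_itv_cat ab b'b);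
    [|by apply: Ji|by apply: Ji].
  by rewrite addrCA lerDl addr_ge0.
rewrite (Rintegral_itv_cat a'p (le_trans p1 b'p)) ?(Rintegral_itv_cat p1 b'p);
  [|by apply: Ji|by apply: Ji].
rewrite /M -addrA; apply: lerD; first exact: H0.
by rewrite lerD2l; apply: H1 => //; lra.
Qed.

(** Integrability of the weight lets the cut nearest to the end point tend to it in the bounds over
    segments. *)
Lemma jacobi_tails al be : -1 < al -> -1 < be ->
  exists d C : R, [/\ 0 < d < 2^-1, 0 <= C,
    forall b, 0 < b < d ->
      \int[mu]_(x in `]0, b]) jacobi al be x <= C * jacobi (al + 1) (be + 1) b &
    forall a, 1 - d < a < 1 ->
      \int[mu]_(x in `[a, 1[) jacobi al be x <= C * jacobi (al + 1) (be + 1) a].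
Proof.
move=> al1 be1; have Ji := Rintegrable_jacobi al1 be1.
have [d [C [/andP[d0 d2] C0 H0 H1]]] := jacobi_tail_bounds al1 be1.
have Jn : (fun x => `|jacobi al be x|) = jacobi al be.
  by apply/funext => x; rewrite ger0_norm ?jacobi_ge0.
exists d, C; split => //; first by rewrite d0.
- move=> b /andP[b0 bd]; apply/ler_addgt0Pl => e e0.
  have [r /andP[r0 r2] []] := Rintegral_tails e0 Ji; rewrite Jn => h0 _.
  pose a := Num.min b (r / 2).
  have a0 : 0 < a by rewrite lt_min b0 divr_gt0.
  have ab : a <= b by rewrite ge_min lexx.
  have ar : a < r by rewrite (@le_lt_trans _ _ (r / 2))// ?ge_min ?lexx ?orbT//; lra.
  have fi : Rintegrable `]0, b] (jacobi al be).
    by apply: RintegrableS Ji => //; apply: subset_itv; rewrite bnd_simp//; lra.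
  have := @Rintegral_itvB R _ (BRight 0) (BRight b) a fi.
  rewrite !bnd_simp => /(_ (ltW a0) ab) /eqP; rewrite subr_eq => /eqP ->.
  rewrite Rintegral_itv_obnd_cbnd; last first.
    by apply: RintegrableS fi => //; apply: subset_itv; rewrite bnd_simp// ltW.
  rewrite addrC lerD//; first by apply/ltW/h0; rewrite a0.
  exact: H0.
- move=> a /andP[ad a1]; apply/ler_addgt0Pl => e e0.
  have [r /andP[r0 r2] []] := Rintegral_tails e0 Ji; rewrite Jn => _ h1.
  pose b := Num.max a (1 - r / 2).
  have b1 : b < 1 by rewrite gt_max a1/=; lra.
  have ab : a <= b by rewrite le_max lexx.
  have br : 1 - r < b by rewrite (@lt_le_trans _ _ (1 - r / 2))// ?le_max ?lexx ?orbT//; lra.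
  have fi : Rintegrable `[a, 1[ (jacobi al be).
    by apply: RintegrableS Ji => //; apply: subset_itv; rewrite bnd_simp//; lra.
  have := @Rintegral_itvB R _ (BLeft a) (BLeft 1) b fi.
  rewrite !bnd_simp => /(_ ab b1) /eqP; rewrite subr_eq => /eqP ->.
  rewrite Rintegral_itv_obnd_cbnd; last first.
    by apply: RintegrableS fi => //; apply: subset_itv; rewrite bnd_simp.
  rewrite lerD//; first by apply/ltW/h1; rewrite br.
  exact: H1.
Qed.

End JacobiWeight.

(** * The Poincare inequality for Jacobi weights *)

Section Poincare.
Context {R : realType}.
Notation mu := (@lebesgue_measure R).
Notation "\int01 f" := (Rintegral mu (`]0%R, 1%R[%classic : set (measurableTypeR R)) f)
  (at level 10).
Implicit Types (al be x y a b : R) (w f v : R -> R) (p q : {poly R}).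

Lemma Rintegral01D f v : Rintegrable `]0, 1[ f -> Rintegrable `]0, 1[ v ->
  \int01 (fun x => f x + v x) = \int01 f + \int01 v.
Proof. by move=> fi vi; rewrite RintegralD. Qed.

Lemma horner_bounded p : exists2 C, 0 <= C & forall x, 0 < x < 1 -> `|p.[x]| <= C.
Proof.
have cp : {within `[0, 1], continuous (fun x => `|p.[x]|)}.
  apply: continuous_subspaceT => x.
  apply: continuous_comp; first exact: continuous_horner.
  exact: norm_continuous.
have [c c01 cmax] := EVT_max (@ler01 R) cp.
by exists `|p.[c]| => // x /andP[x0 x1]; apply: cmax; rewrite in_itv/= !ltW.
Qed.

Lemma measurable_horner (p : {poly R}) (D : set (measurableTypeR R)) :
  measurable D -> measurable_fun D (horner p).
Proof.
move=> mD; apply: measurable_funTS; apply: continuous_measurable_fun.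
exact: continuous_horner.
Qed.

Lemma Rintegrable_horner_sqr_weight w p : Rintegrable `]0, 1[ w ->
  Rintegrable `]0, 1[ (fun x => p.[x] ^+ 2 * w x).
Proof.
move=> wi; have [C C0 pC] := horner_bounded (p ^+ 2).
apply: (@eq_Rintegrable _ _ (fun x => w x * (p ^+ 2).[x])) => //.
  by move=> x _; rewrite horner_exp mulrC.
by apply: (RintegrableM_bounded (C := C)) => //; exact: measurable_horner.
Qed.

Lemma sqr_jacobi_ge0 a b x y : 0 <= y ^+ 2 * jacobi a b x.
Proof. by rewrite mulr_ge0 ?sqr_ge0 ?jacobi_ge0. Qed.

Lemma deriv_surjective q : exists2 p, deriv p = q & (size p <= (size q).+1)%N.
Proof.
exists (\poly_(i < (size q).+1) (q`_i.-1 / i%:R)); last exact: size_poly.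
apply/polyP => i; rewrite coef_deriv coef_poly ltnS.
case: ltnP => [_|qi]; last by rewrite mul0rn nth_default.
by rewrite -[_ *+ _]mulr_natr divfK// pnatr_eq0.
Qed.

Variables (al be : R).
Hypotheses (al1 : -1 < al) (be1 : -1 < be).

Let J0 := jacobi al be.
Let J1 := jacobi (al + 1) (be + 1).
(** Pearson polynomial of the weight: [J1' = tau J0]. *)
Let tau : {poly R} := (be + 1)%:P * (1 - 'X) - (al + 1)%:P * 'X.

Let tauE x : tau.[x] = (be + 1) * (1 - x) - (al + 1) * x.
Proof. by rewrite !hornerE. Qed.

Let lacJ1 : lac J1 (fun x => J0 x * tau.[x]).
Proof.
by apply: eq_lac (lac_jacobi al be) => // x _; rewrite tauE.
Qed.

Let J0i : Rintegrable `]0, 1[ J0. Proof. exact: Rintegrable_jacobi. Qed.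

Let J1i : Rintegrable `]0, 1[ J1.
Proof. by apply: Rintegrable_jacobi; move: al1 be1; lra. Qed.

Let mJ0 : measurable_fun (`]0, 1[ : set (measurableTypeR R)) J0.
Proof. exact: measurable_jacobi. Qed.

Let mJ1 : measurable_fun (`]0, 1[ : set (measurableTypeR R)) J1.
Proof. exact: measurable_jacobi. Qed.

Let J1E x : 0 < x < 1 -> J1 x = J0 x * (x * (1 - x)).
Proof. exact: jacobiS. Qed.

Let J1_le1 x : 0 < x < 1 -> J1 x <= 1.
Proof. by apply: jacobi_le1; move: al1 be1; lra. Qed.

(** Integrate [(w q J1)' = f q J1 + w p J0] with [p = x (1 - x) q' + tau q]: the degree of [p]
    exceeds that of [q] by at most one, so the orthogonality of [w] removes the second term. *)
Lemma derive_orthogonal n w f : lac w f ->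
  Rintegrable `]0, 1[ (fun x => w x ^+ 2 * J0 x) ->
  Rintegrable `]0, 1[ (fun x => f x ^+ 2 * J1 x) ->
  (forall p, (size p <= n.+1)%N -> \int01 (fun x => w x * p.[x] * J0 x) = 0) ->
  forall q, (size q <= n)%N -> \int01 (fun x => f x * q.[x] * J1 x) = 0.
Proof.
move=> wf hw hf orth q qn.
have mw : measurable_fun (`]0, 1[ : set (measurableTypeR R)) w.
  exact: locint_measurable (lac_locint wf).
have mf : measurable_fun (`]0, 1[ : set (measurableTypeR R)) f.
  exact: locint_measurable wf.1.
pose p := 'X * (1 - 'X) * deriv q + tau * q.
have pn : (size p <= n.+1)%N.
  have s1 : (size (1 - 'X : {poly R})%R <= 2)%N.
    by rewrite (leq_trans (size_polyD _ _))// size_polyN size_polyX size_poly1.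
  have st : (size tau <= 2)%N.
    rewrite (leq_trans (size_polyD _ _))// size_polyN geq_max.
    have H c (r : {poly R}) : (size r <= 2)%N -> (size (c%:P * r)%R <= 2)%N.
      move=> r2; rewrite mul_polyC; exact: leq_trans (size_scale_leq _ _) r2.
    by rewrite !H// size_polyX.
  rewrite (leq_trans (size_polyD _ _))// geq_max; apply/andP; split.
    have [->|q0] := eqVneq q 0; first by rewrite deriv0 mulr0 size_poly0.
    have sq := leq_trans (lt_size_deriv q0) qn.
    have sp : (size ('X * (1 - 'X) : {poly R})%R <= 3)%N.
      rewrite (leq_trans (size_polyMleq _ _))// size_polyX.
      by move: (size _) s1; lia.
    rewrite (leq_trans (size_polyMleq _ _))//.
    by move: (size _) (size _) sp sq => i j; lia.
  rewrite (leq_trans (size_polyMleq _ _))//.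
  by move: (size _) (size _) st qn => i j; lia.
pose v x := w x * (q.[x] * J1 x).
have lv : lac v (fun x => f x * q.[x] * J1 x + w x * p.[x] * J0 x).
  apply: eq_lac (lacM wf (lacM (lac_horner q) lacJ1)) => // x x01.
  have -> : p.[x] = x * (1 - x) * (deriv q).[x] + tau.[x] * q.[x].
    by rewrite /p hornerD (hornerM tau) !hornerE.
  by rewrite J1E//; ring.
have [C C0 qC] := horner_bounded q.
(* Since [J1 <= 1] and [J1 = J0 x (1 - x)], the square of [v] is at most [C^2 w^2 J0 x (1 - x)]. *)
have vv : vanishing_ends v.
  apply: (@vanishing_ends_sqr _ _ (fun x => w x ^+ 2 * J0 x) 1 (C ^+ 2)) => //.
  - by rewrite exprn_ge0.
  - by move=> x _; exact: sqr_jacobi_ge0.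
  move=> x x01 _; rewrite -[X in _ * X]mulrA -J1E// /v.
  have qx : q.[x] ^+ 2 <= C ^+ 2.
    by rewrite -(real_normK (num_real _)) lerXn2r ?nnegrE// qC.
  move: (J1 x) (J1_le1 x01) (jacobi_ge0 _ _ _ : 0 <= J1 x) => j j1 j0.
  rewrite !exprMn mulrCA; apply: ler_pM => //.
  - exact: sqr_ge0.
  - by apply: mulr_ge0; exact: sqr_ge0.
  - by rewrite ler_wpM2l ?sqr_ge0// expr2 ler_piMl.
have i1 : Rintegrable `]0, 1[ (fun x => f x * q.[x] * J1 x).
  apply: RintegrableM_sqr => //; first exact: measurable_horner.
    by move=> x _; exact: jacobi_ge0.
  exact: Rintegrable_horner_sqr_weight.
have i2 : Rintegrable `]0, 1[ (fun x => w x * p.[x] * J0 x).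
  apply: RintegrableM_sqr => //; first exact: measurable_horner.
    by move=> x _; exact: jacobi_ge0.
  exact: Rintegrable_horner_sqr_weight.
have := lac_int0 lv vv (RintegrableD (measurable_itv _) i1 i2).
by rewrite (Rintegral01D i1 i2) orth// addr0.
Qed.

(* The primitive of [w J0] from [0], when its total integral vanishes; Cauchy-Schwarz
   bounds [G^2] near an end point by the tail of [w^2 J0] times the tail of [J0]. *)
Lemma weighted_primitive w : measurable_fun (`]0, 1[ : set (measurableTypeR R)) w ->
  Rintegrable `]0, 1[ (fun x => w x ^+ 2 * J0 x) ->
  \int01 (fun x => w x * J0 x) = 0 ->
  exists2 G, lac G (fun x => w x * J0 x) &
    forall e, 0 < e -> exists2 d, 0 < d & forall x, 0 < x < 1 ->
      (x < d) || (1 - d < x) -> G x ^+ 2 <= e * J1 x.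
Proof.
move=> mw hw w0.
have one_i : Rintegrable `]0, 1[ (fun x => 1 ^+ 2 * J0 x).
  by apply: eq_Rintegrable J0i => // x _; rewrite expr1n mul1r.
have wi1 : Rintegrable `]0, 1[ (fun x => w x * 1 * J0 x).
  apply: (@RintegrableM_sqr _ _ w (fun=> 1) J0) => //.
  by move=> x _; exact: jacobi_ge0.
have wi : Rintegrable `]0, 1[ (fun x => w x * J0 x).
  by apply: eq_Rintegrable wi1 => // x _; rewrite mulr1.
pose G x := \int[mu]_(y in `]0, x]) (w y * J0 y).
(* The vanishing total integral lets [G] be computed from the nearer end, so that each end involves
   only its own tail. *)
have G2 x : 0 < x < 1 -> G x = - \int[mu]_(y in `[x, 1[) (w y * J0 y).
  move=> /andP[x0 x1].
  have := @Rintegral_itvB R _ (BRight 0) (BLeft 1) x wi.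
  rewrite !bnd_simp => /(_ (ltW x0) x1).
  rewrite [X in X - _]w0 sub0r -/(G x) => /eqP; rewrite eqr_oppLR => /eqP ->.
  rewrite Rintegral_itv_obnd_cbnd//.
  by apply: RintegrableS wi => //; apply: subset_itv; rewrite bnd_simp// ltW.
have CS (i : interval R) : [set` i] `<=` `]0, 1[ ->
    (\int[mu]_(y in [set` i]) (w y * J0 y)) ^+ 2 <=
    (\int[mu]_(y in [set` i]) `|w y ^+ 2 * J0 y|) * \int[mu]_(y in [set` i]) J0 y.
  move=> i01.
  have iS g : Rintegrable `]0, 1[ g -> Rintegrable [set` i] g by exact: RintegrableS.
  have mS (g : R -> R) : measurable_fun (`]0, 1[ : set (measurableTypeR R)) g ->
    measurable_fun ([set` i] : set (measurableTypeR R)) g by exact: measurable_funS.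
  have := @Rintegral_cauchy_schwarz _ [set` i] w (fun=> 1) J0 (measurable_itv _)
    (mS _ mw) (@measurable_cst _ _ _ _ _ _) (mS _ mJ0) (fun x _ => jacobi_ge0 _ _ _)
    (iS _ hw) (iS _ one_i).
  under eq_Rintegral do rewrite mulr1.
  under [X in _ <= _ * X]eq_Rintegral do rewrite expr1n mul1r.
  have -> // : \int[mu]_(y in [set` i]) `|w y ^+ 2 * J0 y| =
      \int[mu]_(y in [set` i]) (w y ^+ 2 * J0 y).
    apply: eq_Rintegral => x _; apply: ger0_norm.
    by apply: mulr_ge0; [exact: sqr_ge0|exact: jacobi_ge0].
exists G.
  split; first exact: Rintegrable_locint.
  move=> a b a0 ab b1.
  have wib : Rintegrable `]0, b] (fun x => w x * J0 x).
    by apply: RintegrableS wi => //; apply: subset_itv; rewrite bnd_simp.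
  have := @Rintegral_itvB R _ (BRight 0) (BRight b) a wib.
  rewrite !bnd_simp => /(_ (ltW a0) ab); rewrite -/(G a) -/(G b) => ->.
  rewrite Rintegral_itv_obnd_cbnd//.
  by apply: RintegrableS wib => //; apply: subset_itv; rewrite bnd_simp// ltW.
move=> e e0; have [d [C [/andP[d0 d2] C0 H0 H1]]] := jacobi_tails al1 be1.
have eC : 0 < e / (C + 1) by rewrite divr_gt0// ltr_pwDr.
have [r /andP[r0 r2] [h0 h1]] := Rintegral_tails eC hw.
have fin A B j : 0 <= A -> 0 <= B -> 0 <= j ->
    A < e / (C + 1) -> B <= C * j -> A * B <= e * j.
  move=> A0 B0 j0 Ae Bj.
  apply: (@le_trans _ _ (e / (C + 1) * (C * j))); first by rewrite ler_pM// ltW.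
  rewrite mulrA ler_wpM2r// mulrAC ler_pdivrMr; last by rewrite ltr_pwDr.
  by rewrite ler_pM2l// lerDl.
have Jg (i : interval R) : 0 <= \int[mu]_(x in [set` i]) J0 x.
  by apply: Rintegral_ge0 => x _; exact: jacobi_ge0.
have hg (i : interval R) : 0 <= \int[mu]_(x in [set` i]) `|w x ^+ 2 * J0 x|.
  by apply: Rintegral_ge0.
exists (Num.min d r); first by rewrite lt_min d0.
move=> x x01 /orP[|]; have := x01 => /andP[x0 x1].
- rewrite lt_min => /andP[xd xr]; apply: le_trans (CS `]0, x] _) _.
    by apply: subset_itv; rewrite bnd_simp.
  apply: fin => //; first exact: jacobi_ge0.
    by apply: h0; rewrite x0.
  by apply: H0; rewrite x0.
- rewrite ltrBlDr -ltrBlDl lt_min => /andP[xd xr]; rewrite G2// sqrrN.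
  apply: le_trans (CS `[x, 1[ _) _.
    by apply: subset_itv; rewrite bnd_simp.
  apply: fin => //; first exact: jacobi_ge0.
    by apply: h1; rewrite x1 andbT ltrBlDr -ltrBlDl.
  by apply: H1; rewrite x1 andbT ltrBlDr -ltrBlDl.
Qed.

Let J2 := jacobi (al + 1 + 1) (be + 1 + 1).

Let J2E x : 0 < x < 1 -> J2 x = J0 x * (x * (1 - x)) ^+ 2.
Proof. by move=> x01; rewrite /J2 (jacobiS _ _ x01) -/(J1 x) (J1E x01); ring. Qed.

(** Put [M = (n + 1) (n + 2 + a + b)], which is [n (n + 3 + a + b) + (a + b + 2)]. The hypotheses
    give [M K <= W], whence [M W^2 <= F (M K) <= F W], and [W] cancels. *)
Lemma poincare_arith n (a b W F K H : R) : -1 < a -> -1 < b ->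
  0 <= W -> 0 <= F -> H + (a + b + 2) * K = W ->
  n%:R * (n%:R + 1 + (a + 1) + (b + 1)) * K <= H -> W ^+ 2 <= F * K ->
  n.+1%:R * (n.+1%:R + 1 + a + b) * W <= F.
Proof.
move=> a1 b1 W0 F0 HW HK WFK.
have mu0 : 0 <= n.+1%:R * (n.+1%:R + 1 + a + b).
  by rewrite mulr_ge0 ?ler0n// -natr1; have := ler0n R n; lra.
have muK : n.+1%:R * (n.+1%:R + 1 + a + b) * K <= W.
  rewrite -HW -lerBlDr; apply: le_trans _ HK.
  by rewrite -natr1 le_eqVlt; apply/orP; left; apply/eqP; ring.
have [W_eq0|Wn0] := eqVneq W 0; first by rewrite W_eq0 mulr0.
have Wp : 0 < W by rewrite lt_def Wn0.
rewrite -(@ler_pM2r _ W)//.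
apply: (@le_trans _ _ (n.+1%:R * (n.+1%:R + 1 + a + b) * (F * K))).
  by rewrite -[leLHS]mulrA -expr2 ler_wpM2l.
by rewrite mulrCA ler_wpM2l.
Qed.

Lemma vanishing_ends_near v :
  (forall e, 0 < e -> exists2 d, 0 < d & forall x, 0 < x < 1 ->
     (x < d) || (1 - d < x) -> `|v x| < e) -> vanishing_ends v.
Proof.
move=> H e d e0 d0; have [r r0 vr] := H _ e0.
pose c := Num.min (Num.min d r) 2^-1.
have c0 : 0 < c by rewrite !lt_min d0 r0 invr_gt0 ltr0n.
have c1 : c / 2 < 1.
  have : c <= 2^-1 by rewrite ge_min lexx orbT.
  by move: (c) => c'; lra.
have cd : c <= d by rewrite !ge_min lexx.
have cr : c <= r by rewrite !ge_min lexx orbT.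
split; [exists (c / 2)|exists (1 - c / 2)].
- by move: (c) c0 cd => c' *; apply/andP; split; lra.
- apply: vr; first by rewrite divr_gt0.
  by apply/orP; left; move: (c) c0 cr => c' *; lra.
- by move: (c) c0 cd => c' *; apply/andP; split; lra.
- apply: vr; first by rewrite subr_gt0 c1 ltrBlDr ltrDl divr_gt0.
  by apply/orP; right; move: (c) c0 cr => c' *; lra.
Qed.

(* With [G' = w J0] and [g = G / J1],
   [w^2 J0 = g'^2 J2 + (al + be + 2) g^2 J1 + (tau G^2 / J1)']. *)
Lemma poincare_step n w f :
  (forall g h, lac g h ->
     Rintegrable `]0, 1[ (fun x => g x ^+ 2 * J1 x) ->
     Rintegrable `]0, 1[ (fun x => h x ^+ 2 * J2 x) ->
     (forall p, (size p <= n)%N -> \int01 (fun x => g x * p.[x] * J1 x) = 0) ->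
     n%:R * (n%:R + 1 + (al + 1) + (be + 1)) * \int01 (fun x => g x ^+ 2 * J1 x) <=
     \int01 (fun x => h x ^+ 2 * J2 x)) ->
  lac w f ->
  Rintegrable `]0, 1[ (fun x => w x ^+ 2 * J0 x) ->
  Rintegrable `]0, 1[ (fun x => f x ^+ 2 * J1 x) ->
  (forall p, (size p <= n.+1)%N -> \int01 (fun x => w x * p.[x] * J0 x) = 0) ->
  n.+1%:R * (n.+1%:R + 1 + al + be) * \int01 (fun x => w x ^+ 2 * J0 x) <=
  \int01 (fun x => f x ^+ 2 * J1 x).
Proof.
move=> IH wf hw hf orth.
have mw : measurable_fun (`]0, 1[ : set (measurableTypeR R)) w.
  exact: locint_measurable (lac_locint wf).
have mf : measurable_fun (`]0, 1[ : set (measurableTypeR R)) f.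
  exact: locint_measurable wf.1.
have w0 : \int01 (fun x => w x * J0 x) = 0.
  have := orth 1; rewrite size_poly1 => /(_ isT); apply: etrans.
  by apply: eq_Rintegral => x _; rewrite hornerC mulr1.
have [G lG smallG] := weighted_primitive mw hw w0.
have J1p x : 0 < x < 1 -> 0 < J1 x by exact: jacobi_gt0.
have J0p x : 0 < x < 1 -> 0 < J0 x by exact: jacobi_gt0.
have lJ1V := lac_jacobi_inv al be.
have lg := lacM lG lJ1V.
set g := (X in lac X _) in lg; set h := (X in lac _ X) in lg.
have sig x : 0 < x < 1 -> x != 0 /\ 1 - x != 0.
  by move=> /andP[x0 x1]; rewrite !gt_eqF ?subr_gt0.
pose Phi x := tau.[x] * (G x * G x) * (J1 x)^-1.
pose s := al + be + 2.
have s0 : 0 < s by rewrite /s; move: al1 be1; lra.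
pose k x := h x ^+ 2 * J2 x + s * (g x ^+ 2 * J1 x).
have dtau x : (deriv tau).[x] = - s.
  rewrite /tau derivB !deriv_mulC derivB derivX -polyC1 derivC.
  by rewrite !hornerE /s; ring.
have lPhi : lac Phi (fun x => w x ^+ 2 * J0 x - k x).
  apply: eq_lac (lacM (lacM (lac_horner tau) (lacM lG lG)) lJ1V) => // x x01.
  have [x0 x1] := sig _ x01; have j0 := J0p _ x01.
  rewrite /k /h /g -/J0 -/J1 -/(J1 x) -/(J0 x) -tauE J2E// J1E// dtau.
  have -> : s = al + be + 2 by [].
  rewrite tauE; field.
  by rewrite x0 x1 gt_eqF.
(* Here there is a genuine limit: [G^2 / J1] tends to 0 at both ends by [smallG], and [tau] is
   bounded. *)
have vPhi : vanishing_ends Phi.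
  have [C C0 tC] := horner_bounded tau.
  apply: vanishing_ends_near => e e0.
  have eC : 0 < e / (C + 1) by rewrite divr_gt0// ltr_pwDr.
  have [d d0 Gd] := smallG _ eC; exists d => // x x01 /(Gd _ x01) Gx.
  rewrite /Phi -expr2 -mulrA normrM.
  have Gj : `|G x ^+ 2 / J1 x| <= e / (C + 1).
    by rewrite ger0_norm ?ler_pdivrMr ?J1p// divr_ge0 ?sqr_ge0// ltW// J1p.
  apply: le_lt_trans (ler_pM _ _ (tC _ x01) Gj) _ => //.
  rewrite mulrCA -[ltRHS]mulr1 ltr_pM2l// ltr_pdivrMr; last by rewrite ltr_pwDr.
  by rewrite mul1r ltrDl.
have k0 x : 0 < x < 1 -> 0 <= k x.
  move=> x01; apply: addr_ge0; first exact: sqr_jacobi_ge0.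
  by apply: mulr_ge0; [exact: ltW|exact: sqr_jacobi_ge0].
have ki : locint k.
  apply: (@eq_locint _ (fun x => w x ^+ 2 * J0 x - (w x ^+ 2 * J0 x - k x))).
    by move=> x _; ring.
  by apply: locintB; [exact: Rintegrable_locint|exact: lPhi.1].
(* Neither [g] nor [h] is known to be square-integrable so far. As [k] is a sum of two nonnegative
   terms, its integrability, which follows from that of [w^2 J0], passes to both. *)
have [kint kE] := lac_int_ge0 lPhi vPhi hw ki k0.
have mg : measurable_fun (`]0, 1[ : set (measurableTypeR R)) g.
  exact: locint_measurable (lac_locint lg).
have mh : measurable_fun (`]0, 1[ : set (measurableTypeR R)) h.
  exact: locint_measurable lg.1.
have gi : Rintegrable `]0, 1[ (fun x => g x ^+ 2 * J1 x).
  apply: (@le_Rintegrable _ _ _ (fun x => s^-1 * k x)) => //.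
  - by apply: measurable_funM => //; exact: measurable_funX.
  - move=> x _; rewrite (ger0_norm (sqr_jacobi_ge0 _ _ _ _)) ler_pdivlMl//.
    by rewrite lerDr; exact: sqr_jacobi_ge0.
  - exact: RintegrableZ.
have hi : Rintegrable `]0, 1[ (fun x => h x ^+ 2 * J2 x).
  apply: (@le_Rintegrable _ _ _ k) => //.
  - apply: measurable_funM; last exact: measurable_jacobi.
    exact: measurable_funX.
  - move=> x _; rewrite (ger0_norm (sqr_jacobi_ge0 _ _ _ _)) lerDl.
    by apply: mulr_ge0; [exact: ltW|exact: sqr_jacobi_ge0].
(* As [g J1 = G], pairing [g] with [p = Q'] is, by parts, minus the pairing of [G' = w J0] with [Q],
   whose size is at most [n.+1]. *)
have gorth p : (size p <= n)%N -> \int01 (fun x => g x * p.[x] * J1 x) = 0.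
  move=> pn; have [Q Qp Qn] := deriv_surjective p.
  have lv := lacM lG (lac_horner Q).
  have vv : vanishing_ends (fun x => G x * Q.[x]).
    have [C C0 QC] := horner_bounded Q.
    apply: vanishing_ends_near => e e0.
    have eC : 0 < (e / (C + 1)) ^+ 2 by rewrite exprn_gt0// divr_gt0// ltr_pwDr.
    have [d d0 Gd] := smallG _ eC; exists d => // x x01 /(Gd _ x01) Gx.
    have {}Gx : `|G x| <= e / (C + 1).
      have eC0 : 0 <= e / (C + 1) by rewrite divr_ge0 ?ltW ?ltr_pwDr.
      rewrite -(@ler_pXn2r _ 2)// real_normK ?num_real//.
      by rewrite (le_trans Gx)// ger_pMr// J1_le1.
    rewrite normrM; apply: le_lt_trans (ler_pM _ _ Gx (QC _ x01)) _ => //.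
    rewrite mulrAC ltr_pdivrMr; last by rewrite ltr_pwDr.
    by rewrite ltr_pM2l// ltrDl.
  have gp : Rintegrable `]0, 1[ (fun x => g x * p.[x] * J1 x).
    apply: RintegrableM_sqr => //; first exact: measurable_horner.
      by move=> x _; exact: jacobi_ge0.
    exact: Rintegrable_horner_sqr_weight.
  have wQ : Rintegrable `]0, 1[ (fun x => w x * Q.[x] * J0 x).
    apply: RintegrableM_sqr => //; first exact: measurable_horner.
      by move=> x _; exact: jacobi_ge0.
    exact: Rintegrable_horner_sqr_weight.
  have lv' : lac (fun x => G x * Q.[x])
      (fun x => w x * Q.[x] * J0 x + g x * p.[x] * J1 x).
    apply: eq_lac lv => // x x01.
    by rewrite /g -/(J1 x) -Qp; field; rewrite gt_eqF ?J1p.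
  have := lac_int0 lv' vv (RintegrableD (measurable_itv _) wQ gp).
  rewrite (Rintegral01D wQ gp) orth ?add0r//.
  exact: leq_trans Qn _.
have {}IH := IH _ _ lg gi hi gorth.
have kE' : \int01 (fun x => h x ^+ 2 * J2 x) + s * \int01 (fun x => g x ^+ 2 * J1 x) =
    \int01 (fun x => w x ^+ 2 * J0 x).
  rewrite -kE -RintegralZl// -RintegralD//; exact: RintegrableZ.
(* Near the ends [(w G)^2 <= w^2 J1 = w^2 J0 x (1 - x)], the required form with constant 1. *)
have vwG : vanishing_ends (fun x => w x * G x).
  have [d d0 Gd] := smallG _ ltr01.
  apply: (@vanishing_ends_sqr _ _ (fun x => w x ^+ 2 * J0 x) d 1) => //.
  - by move=> x _; exact: sqr_jacobi_ge0.
  move=> x x01 /(Gd _ x01); rewrite !mul1r -mulrA -J1E// exprMn => Gx.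
  by rewrite ler_wpM2l ?sqr_ge0.
have fgi : Rintegrable `]0, 1[ (fun x => f x * g x * J1 x).
  by apply: RintegrableM_sqr => // x _; exact: jacobi_ge0.
(* Duality: since [f g J1 = f G], the integral of [w^2 J0] is minus that of [f g J1], to which
   Cauchy-Schwarz applies. *)
have lwG : lac (fun x => w x * G x) (fun x => f x * g x * J1 x + w x ^+ 2 * J0 x).
  apply: eq_lac (lacM wf lG) => // x x01.
  by rewrite /g -/(J1 x); field; rewrite gt_eqF ?J1p.
have := lac_int0 lwG vwG (RintegrableD (measurable_itv _) fgi hw).
rewrite (Rintegral01D fgi hw) => /eqP; rewrite addr_eq0 => /eqP fgE.
have := Rintegral_cauchy_schwarz (measurable_itv `]0, 1[) mf mg mJ1
  (fun x _ => jacobi_ge0 _ _ _) hf gi.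
rewrite fgE sqrrN.
have W0 : 0 <= \int01 (fun x => w x ^+ 2 * J0 x).
  by apply: Rintegral_ge0 => x _; rewrite mulr_ge0 ?sqr_ge0 ?jacobi_ge0.
have F0 : 0 <= \int01 (fun x => f x ^+ 2 * J1 x).
  by apply: Rintegral_ge0 => x _; rewrite mulr_ge0 ?sqr_ge0 ?jacobi_ge0.
exact: poincare_arith al1 be1 W0 F0 kE' IH.
Qed.

End Poincare.

(** The induction generalizes over [al] and [be] because the step uses the inequality for the
    shifted weight. *)
Lemma poincare {R : realType} (n : nat) (al be : R) (w f : R -> R) :
  -1 < al -> -1 < be -> lac w f ->
  Rintegrable `]0, 1[ (fun x => w x ^+ 2 * jacobi al be x) ->
  Rintegrable `]0, 1[ (fun x => f x ^+ 2 * jacobi (al + 1) (be + 1) x) ->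
  (forall p : {poly R}, (size p <= n)%N ->
    \int[lebesgue_measure]_(x in `]0, 1[) (w x * p.[x] * jacobi al be x) = 0) ->
  n%:R * (n%:R + 1 + al + be) *
    \int[lebesgue_measure]_(x in `]0, 1[) (w x ^+ 2 * jacobi al be x) <=
  \int[lebesgue_measure]_(x in `]0, 1[) (f x ^+ 2 * jacobi (al + 1) (be + 1) x).
Proof.
elim: n => [|n IH] in al be w f *.
  move=> al1 be1 wf wi fi _; rewrite !mul0r.
  by apply: Rintegral_ge0 => x _; rewrite mulr_ge0 ?sqr_ge0 ?jacobi_ge0.
move=> al1 be1; apply: poincare_step => // g h.
by apply: IH; [move: al1|move: be1]; lra.
Qed.

(** * Smooth functions built from exp(-1/t) *)

Section SmoothBump.
Context {R : realType}.
Implicit Types (f g : R -> R) (a b c x y t : R) (p q : {poly R}) (k n : nat).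

(** Derivatives are taken from the inside, so that closure properties follow by induction on [n]
    with the function generalized. *)
Fixpoint smooth_upto n f : Prop :=
  if n is n'.+1 then (forall x, derivable f x 1) /\ smooth_upto n' (derive1 f)
  else True.

Lemma smooth_uptoP f : (forall n, smooth_upto n f) <->
  forall n x, derivable (derive1n n f) x 1.
Proof.
split=> H n.
  have := H n.+1; elim: n f {H} => [|n IH] f [df sf] x; first exact: df.
  by rewrite derive1Sn; exact: IH sf x.
elim: n f H => [//|n IH] f H; split; first exact: (H 0%N).
by apply: IH => m x; rewrite -derive1Sn.
Qed.

Lemma smooth_uptoD n f g : smooth_upto n f -> smooth_upto n g ->
  smooth_upto n (fun x => f x + g x).
Proof.
elim: n f g => [//|n IH] f g [df sf] [dg sg]; split.
  by move=> x; exact: derivableD.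
rewrite (_ : derive1 _ = fun x => derive1 f x + derive1 g x); first exact: IH.
by apply/funext => x; rewrite !derive1E; exact: deriveD.
Qed.

Lemma smooth_uptoZ n c f : smooth_upto n f -> smooth_upto n (fun x => c * f x).
Proof.
elim: n f => [//|n IH] f [df sf]; split.
  by move=> x; exact: derivableZ.
rewrite (_ : derive1 _ = fun x => c * derive1 f x); first exact: IH.
by apply/funext => x; rewrite !derive1E; exact: deriveZ.
Qed.

(** The flat function exp(-1/t) with a factor [t^(-k)]; the powers close the family, up to linear
    combinations, under differentiation. *)
Definition flat_exp k t : R := if 0 < t then t^-1 ^+ k * expR (- t^-1) else 0.

Lemma flat_exp_ge0 k t : 0 <= flat_exp k t.
Proof.
rewrite /flat_exp; case: ifP => // t0.
by rewrite mulr_ge0 ?expR_ge0// exprn_ge0// invr_ge0 ltW.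
Qed.

(** With [y = 1/t], the bound [y^(k+1) / (k+1)! <= exp y] gives [y^k exp(-y) <= (k+1)! / y]. *)
Lemma flat_exp_le k t : flat_exp k t <= k.+1`!%:R * `|t|.
Proof.
rewrite /flat_exp; case: ifP => [t0|_]; last by rewrite mulr_ge0.
rewrite gtr0_norm//; have y0 : 0 < t^-1 by rewrite invr_gt0.
have := expR_ge1Dxn k (ltW y0).
rewrite expRN ler_pdivrMr ?expR_gt0// => h.
have f0 : 0 < k.+1`!%:R :> R by rewrite ltr0n fact_gt0.
rewrite -mulrA -ler_pdivrMl// -ler_pdivrMl//.
apply: le_trans h; rewrite exprS -mulrCA [_ * (_ * _)]mulrC.
by rewrite [_ / _]mulrC lerDr.
Qed.

Lemma flat_exp_cvg0 k : {for 0, continuous (flat_exp k)}.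
Proof.
have E0 : flat_exp k 0 = 0 by rewrite /flat_exp ltxx.
rewrite /prop_for /continuous_at E0.
apply: (@squeeze_cvgr _ _ _ _ (fun=> 0) (fun t => k.+1`!%:R * `|t|)).
- by apply: nearW => t; rewrite flat_exp_ge0 flat_exp_le.
- exact: cvg_cst.
- have : k.+1`!%:R * `|t| @[t --> (0 : R)] --> k.+1`!%:R * `|0 : R|.
    by apply: cvgM; [exact: cvg_cst|exact: norm_continuous].
  by rewrite normr0 mulr0.
Qed.

(** At 0 the difference quotient is [flat_exp k.+1] itself, continuous there with value 0
    (Caratheodory's form of the derivative). Elsewhere the function coincides locally with one
    branch. *)
Lemma is_derive_flat_exp k t :
  is_derive t 1 (flat_exp k) (- k%:R * flat_exp k.+1 t + flat_exp k.+2 t).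
Proof.
have [t0|t0|<-] := ltgtP 0 t; last 1 first.
- rewrite {2 3}/flat_exp ltxx mulr0 addr0; apply/is_derive1_caratheodory.
  exists (flat_exp k.+1); split; [|exact: flat_exp_cvg0|by rewrite /flat_exp ltxx].
  move=> z; rewrite /flat_exp ltxx !subr0; case: ifP => z0; last by rewrite mul0r.
  by rewrite exprS; field; rewrite gt_eqF.
- apply: (@near_eq_is_derive _ _ _ (fun t => t^-1 ^+ k * expR (- t^-1))).
    near=> s; rewrite /flat_exp ifT//; near: s.
    exact: lt_nbhsr.
  have d1 := is_deriveV (lt0r_neq0 t0) (is_derive_id t (1 : R)).
  have d2 := is_deriveX k d1.
  have d3 := is_derive1_comp (f := expR) (g := fun t : R => - t^-1)
    (is_derive_expR (- t^-1)) (is_deriveN d1).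
  have d := is_deriveM d2 d3.
  rewrite (_ : (fun t1 : R => _) = (GRing.inv : R -> R) ^+ k * (expR \o (fun t1 => - t1^-1))).
    2: by apply/funext => s; rewrite !fctE.
  rewrite /flat_exp t0; apply: is_derive_eq d _; rewrite !fctE.
  rewrite /GRing.scale/= mulr1 exprVn -exprVn [in LHS]mulrN; clear d2.
  move: (expR (- t^-1)) => E; case: k => [|k].
    by rewrite mulr0n !exprS expr0; field; rewrite gt_eqF.
  by rewrite /= -exprVn !exprS; move: (t^-1 ^+ k) (t^-1) => u s; ring.
- apply: (@near_eq_is_derive _ _ _ (fun=> 0)).
    near=> s; rewrite /flat_exp ifF//; apply/negbTE; rewrite -leNgt ltW//; near: s.
    exact: lt_nbhsl.
  rewrite /flat_exp (ltNge 0 t) (ltW t0)/= mulr0 addr0.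
  exact: is_derive_cst.
Unshelve. all: by end_near. Qed.

(** The derivative is a sum of three functions of the same shape, so the induction closes once [p]
    and [k] are generalized. *)
Lemma smooth_flat_exp_horner n p k q :
  smooth_upto n (fun x => p.[x] * flat_exp k q.[x]).
Proof.
elim: n p k => [//|n IH] p k.
have D x : is_derive x 1 (fun x => p.[x] * flat_exp k q.[x])
    ((deriv p).[x] * flat_exp k q.[x] +
     ((- k%:R *: (p * deriv q)).[x] * flat_exp k.+1 q.[x] +
      (p * deriv q).[x] * flat_exp k.+2 q.[x])).
  have d1 := is_derive1_comp (f := flat_exp k) (g := horner q)
     (is_derive_flat_exp k q.[x]) (is_derive_poly q x).
  have := is_deriveM (is_derive_poly p x) d1 => d.
  by apply: is_derive_eq d _; rewrite /GRing.scale/= hornerZ hornerM; ring.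
split; first by move=> x; have [] := D x.
rewrite (_ : derive1 _ = fun x => (deriv p).[x] * flat_exp k q.[x] +
     ((- k%:R *: (p * deriv q)).[x] * flat_exp k.+1 q.[x] +
      (p * deriv q).[x] * flat_exp k.+2 q.[x])).
  by do 2?apply: smooth_uptoD; exact: IH.
by apply/funext => x; rewrite derive1E; have [_ ->] := D x.
Qed.

End SmoothBump.

(** * Test functions and the fundamental lemma of the calculus of variations *)

Section WeakDerivatives.
Context {R : realType}.
Notation mu := (@lebesgue_measure R).
Notation "\int01 f" := (Rintegral mu (`]0%R, 1%R[%classic : set (measurableTypeR R)) f)
  (at level 10).
Implicit Types (f g h w u v phi psi : R -> R) (a b c x y t : R) (k n : nat).

Lemma ae_imp (P Q : R -> Prop) : {ae mu, forall x, P x} ->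
  (forall x, P x -> Q x) -> {ae mu, forall x, Q x}.
Proof.
move=> aP PQ; apply: filterS PQ aP; exact: (ae_filter_ringOfSetsType mu).
Qed.

Lemma ae_and (P Q : R -> Prop) : {ae mu, forall x, P x} -> {ae mu, forall x, Q x} ->
  {ae mu, forall x, P x /\ Q x}.
Proof.
move=> aP aQ; apply: filterI aP aQ; exact: (ae_filter_ringOfSetsType mu).
Qed.

Lemma compact_subset_unit (K : set R) : compact K -> K `<=` `]0, 1[ ->
  exists a b, [/\ 0 < a, a <= b, b < 1 & K `<=` `[a, b]].
Proof.
move=> cK K01; have [K0|/set0P K0] := eqVneq K set0.
  by exists (1 / 2), (1 / 2); rewrite K0; split; [lra..|exact: sub0set].
have cid : {within K, continuous (fun x : R => x)}.
  by apply: continuous_subspaceT => x; exact: cvg_id.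
have [b Kb bmax] := compact_EVT_max K0 cK cid.
have [a Ka amin] := compact_EVT_min K0 cK cid.
exists a, b; move: (K01 _ (set_mem Ka)) (K01 _ (set_mem Kb)); rewrite /= !in_itv/= => /andP[-> _] /andP[_ ->].
split => //; first by apply: amin.
by move=> x Kx; rewrite /= in_itv/= amin ?bmax ?inE.
Qed.

Lemma locally_integrableP f : locally_integrable `]0, 1[ f <-> locint f.
Proof.
split=> [[mf _ fK] a b a0 b1|fi].
  apply/integrableP; split.
    apply/measurable_EFinP; apply: measurable_funS mf => //.
    exact: subset_cc_oo.
  by apply: fK; [exact: subset_cc_oo|exact: segment_compact].
split; [exact: locint_measurable|exact: interval_open|move=> K K01 cK].
have [a [b [a0 ab b1 Kab]]] := compact_subset_unit cK K01.
have /integrableP[_] := Rintegrable_norm (measurable_itv _) (fi _ _ a0 b1).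
apply: le_lt_trans; under [leRHS]eq_integral do rewrite /= normr_id.
apply: ge0_subset_integral => //; first exact: compact_measurable.
by apply/measurable_EFinP; exact: Rintegrable_measurable (Rintegrable_norm _ (fi _ _ a0 b1)).
Qed.

Lemma test_functionP phi : test_function phi <->
  (forall n, smooth_upto n phi) /\
  exists a b, [/\ 0 < a, a <= b, b < 1 & forall x, ~ (a <= x <= b) -> phi x = 0].
Proof.
split=> [[sphi [K [cK K01 Kphi]]]|[sphi [a [b [a0 ab b1 abphi]]]]].
  split; first exact/smooth_uptoP.
  have [a [b [a0 ab b1 Kab]]] := compact_subset_unit cK K01.
  exists a, b; split => // x xab; apply: Kphi => /Kab.
  by rewrite /= in_itv.
split; first by move=> n x; exact: ((smooth_uptoP phi).1 sphi).
exists `[a, b]%classic; split; [exact: segment_compact|exact: subset_cc_oo|].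
by move=> x xab; apply: abphi => xab'; apply: xab; rewrite /= in_itv.
Qed.

Lemma test_functionB phi psi c : test_function phi -> test_function psi ->
  test_function (fun x => phi x - c * psi x).
Proof.
move=> /test_functionP[s1 [a [b [a0 ab b1 ab0]]]].
move=> /test_functionP[s2 [a' [b' [a'0 ab' b'1 ab'0]]]].
apply/test_functionP; split.
  move=> n; have := smooth_uptoD (s1 n) (smooth_uptoZ (- c) (s2 n)).
  by congr smooth_upto; apply/funext => x; rewrite mulNr.
exists (Num.min a a'), (Num.max b b'); split.
- by rewrite lt_min a0.
- by rewrite ge_min le_max ab.
- by rewrite gt_max b1.
move=> x; rewrite ge_min le_max => H; rewrite ab0 ?ab'0 ?mulr0 ?subr0//;
  move=> /andP[h1 h2]; apply: H; rewrite h1 h2 ?orbT//.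
Qed.

Lemma test_function_derive phi : test_function phi -> test_function (derive1 phi).
Proof.
move=> /test_functionP[s1 [a [b [a0 ab b1 ab0]]]]; apply/test_functionP; split.
  by move=> n; have [] := s1 n.+1.
exists a, b; split => // x xab; rewrite derive1E.
rewrite (@near_eq_derive _ _ _ phi (fun=> 0)); first exact: derive_cst.
have : \forall y \near x, (~` `[a, b]%classic) y.
  apply: open_nbhs_nbhs; split; first exact/closed_openC/interval_closed.
  by rewrite /= in_itv.
by apply: filterS => y; rewrite /= in_itv => /ab0.
Qed.

Lemma derivable_test phi x : test_function phi -> derivable phi x 1.
Proof. by case=> + _ => /(_ 0%N); exact. Qed.

Lemma lac_test phi : test_function phi -> lac phi (derive1 phi).
Proof.
move=> tphi; apply: C1_lac => x _.
  by rewrite derive1E; apply: derivableP; exact: derivable_test.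
apply/differentiable_continuous/derivable1_diffP/derivable_test.
exact: test_function_derive.
Qed.

Lemma Rintegrable_compact_support h a b : 0 < a -> b < 1 -> locint h ->
  (forall x, ~ (a <= x <= b) -> h x = 0) -> Rintegrable `]0, 1[ h.
Proof.
move=> a0 b1 hi h0.
have -> : h = h \_ `[a, b].
  apply/funext => x; rewrite patchE; case: ifPn => // /negP xab.
  by apply: h0 => xab'; apply: xab; rewrite inE/= in_itv.
rewrite /Rintegrable -restrict_EFin; apply/integrable_restrict => //=.
rewrite setIidr; first exact: hi.
exact: subset_cc_oo.
Qed.

Lemma Rintegrable_locint_test h phi : locint h -> test_function phi ->
  Rintegrable `]0, 1[ (fun x => h x * phi x).
Proof.
move=> hi tphi; have /test_functionP[_ [a [b [a0 ab b1 ab0]]]] := tphi.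
apply: (Rintegrable_compact_support a0 b1).
  exact: locintM (lac_test tphi) hi.
by move=> x xab; rewrite ab0// mulr0.
Qed.

Lemma lac_weak_derive w f phi : lac w f -> test_function phi ->
  \int01 (fun x => w x * derive1 phi x) = - \int01 (fun x => f x * phi x).
Proof.
move=> wf tphi; have /test_functionP[_ [a [b [a0 ab b1 ab0]]]] := tphi.
have i1 := Rintegrable_locint_test wf.1 tphi.
have i2 := Rintegrable_locint_test (lac_locint wf) (test_function_derive tphi).
have lv : lac (fun x => w x * phi x) (fun x => f x * phi x + w x * derive1 phi x).
  by apply: eq_lac (lacM wf (lac_test tphi)) => // x _; ring.
have vv : vanishing_ends (fun x => w x * phi x).
  apply: vanishing_ends_near => e e0; exists (Num.min a (1 - b)).
    by rewrite lt_min a0 subr_gt0.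
  move=> x _ xab; rewrite ab0 ?mulr0 ?normr0// => /andP[ax xb].
  move: xab; rewrite lt_min ltrBlDr -ltrBlDl lt_min => /orP[/andP[h _]|/andP[_ h]].
    by move: h; rewrite ltNge ax.
  by move: h; rewrite ltrD2l ltrN2 ltNge xb.
have := lac_int0 lv vv (RintegrableD (measurable_itv _) i1 i2).
by rewrite (Rintegral01D i1 i2) => /eqP; rewrite addrC addr_eq0 => /eqP.
Qed.

(** These bumps are positive exactly on []a, b[]; the factor [n.+1] makes them tend to the indicator
    of that interval. *)
Lemma bump_exists a b n : 0 < a -> a < b -> b < 1 ->
  test_function (fun x => flat_exp 0 (n.+1%:R * ((x - a) * (b - x)))).
Proof.
move=> a0 ab b1; apply/test_functionP; split.
  move=> m; have := @smooth_flat_exp_horner R m 1 0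
    (n.+1%:R *: (('X - a%:P) * (b%:P - 'X))).
  by congr smooth_upto; apply/funext => x; rewrite !hornerE.
exists a, b; split => //; first exact: ltW.
move=> x xab; rewrite /flat_exp ifF//; apply/negP => h; apply: xab.
move: h; rewrite pmulr_rgt0 ?ltr0n// => h.
by have [xa|ax] := leP a x; have [bx|xb] := leP x b => //; move: h; nra.
Qed.

Lemma flat_exp_le1 t : flat_exp 0 t <= 1.
Proof.
rewrite /flat_exp; case: ifP => // t0; rewrite expr0 mul1r.
by rewrite -[leRHS]expR0 ler_expR oppr_le0 invr_ge0 ltW.
Qed.

Lemma flat_exp_cvg1 t : 0 < t -> flat_exp 0 (n.+1%:R * t) @[n --> \oo] --> (1 : R).
Proof.
move=> t0.
have -> : (fun n => flat_exp 0 (n.+1%:R * t)) =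
    (fun n => expR (- (n.+1%:R^-1 * t^-1))).
  by apply/funext => n; rewrite /flat_exp mulr_gt0 ?ltr0n// expr0 mul1r invfM.
rewrite -[X in _ --> X]expR0; apply: continuous_cvg; first exact: continuous_expR.
rewrite -[X in _ --> X]oppr0; apply: cvgN; rewrite -[X in _ --> X](mul0r t^-1).
by apply: cvgM; [exact: cvg_harmonic|exact: cvg_cst].
Qed.

(** Dominated convergence with bound [|h|], as the bumps tend pointwise to 1 on []a, b[]. *)
Lemma test_orthogonal_itv h a b : locint h ->
  (forall phi, test_function phi -> \int01 (fun x => h x * phi x) = 0) ->
  0 < a -> a < b -> b < 1 -> \int[mu]_(x in `[a, b]) h x = 0.
Proof.
move=> hi horth a0 ab b1.
pose psi n x := flat_exp 0 (n.+1%:R * ((x - a) * (b - x))).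
have hab : Rintegrable `]a, b[ h.
  by apply: RintegrableS (hi _ _ a0 b1) => //; apply: subset_itv; rewrite bnd_simp.
have mpsi n : measurable_fun (`]a, b[ : set (measurableTypeR R)) (psi n).
  apply: measurable_funTS; apply: continuous_measurable_fun => x.
  apply/differentiable_continuous/derivable1_diffP/derivable_test.
  exact: bump_exists.
have psi1 n x : `|psi n x| <= 1 by rewrite ger0_norm ?flat_exp_ge0// flat_exp_le1.
have I0 n : \int[mu]_(x in `]a, b[) (h x * psi n x) = 0.
  rewrite -(horth _ (bump_exists n a0 ab b1)) Rintegral_mkcond [RHS]Rintegral_mkcond.
  apply: eq_Rintegral => x _; rewrite !patchE.
  case: ifPn => [|/negP xab].
    rewrite inE/= in_itv/= => /andP[ax xb]; rewrite mem_set//= in_itv/=.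
    by rewrite (lt_trans a0)//= (lt_trans xb).
  have px0 : psi n x = 0.
    rewrite /psi /flat_exp ifF//; apply/negP => h'; apply: xab.
    move: h'; rewrite pmulr_rgt0 ?ltr0n// inE/= in_itv/= => h'.
    by have [xa|ax] := ltP a x; have [bx|xb] := ltP x b => //; move: h'; nra.
  by rewrite /= -/(psi n x) px0 mulr0 if_same.
have mF n : measurable_fun (`]a, b[ : set (measurableTypeR R)) (fun x => (h x * psi n x)%:E).
  apply/measurable_EFinP; apply: measurable_funM (mpsi n).
  exact: Rintegrable_measurable hab.
have cF : {ae mu, forall x, `]a, b[%classic x ->
    (fun n => (h x * psi n x)%:E) @ \oo --> (h x)%:E}.
  apply: aeW => x; rewrite /= in_itv/= => /andP[ax xb].
  apply: cvg_EFin; first by apply: nearW.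
  rewrite -[X in _ --> X]mulr1; apply: cvgM; first exact: cvg_cst.
  by apply: flat_exp_cvg1; rewrite mulr_gt0 ?subr_gt0.
have dF : {ae mu, forall x n, `]a, b[%classic x ->
    (`|(h x * psi n x)%:E| <= `|h x|%:E)%E}.
  by apply: aeW => x n _; rewrite lee_fin normrM ler_piMr.
have [_ _] := @dominated_convergence _ _ _ mu `]a, b[ (measurable_itv _)
  (fun n x => (h x * psi n x)%:E) (fun x => (h x)%:E) (fun x => `|h x|%:E) mF
  (measurable_int _ hab) cF (Rintegrable_norm (measurable_itv _) hab) dF.
rewrite (_ : (fun n => _) = fun=> 0%E); last first.
  apply/funext => n; rewrite (@EFin_Rintegral _ `]a, b[) ?I0//.
  by apply: (RintegrableM_bounded (C := 1)).
move=> /(cvg_unique (@ereal_hausdorff R) (cvg_cst 0%E)) H0.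
rewrite /Rintegral integral_itv_bndoo ?[X in fine X](_ : _ = 0%E)//.
exact: measurable_int hab.
Qed.

(* A locally integrable function whose primitives vanish is zero almost everywhere, by
   Lebesgue's differentiation theorem. *)
Lemma test_orthogonal_ae0 h : locint h ->
  (forall phi, test_function phi -> \int01 (fun x => h x * phi x) = 0) ->
  {ae mu, forall x, 0 < x < 1 -> h x = 0}.
Proof.
move=> hi horth.
pose a n : R := n.+2%:R^-1.
have a0 n : 0 < a n by rewrite invr_gt0 ltr0n.
have a2 n : a n <= 1 / 2 by rewrite div1r lef_pV2 ?posrE ?ltr0n// ler_nat.
have b1 n : 1 - a n < 1 by rewrite ltrBlDr ltrDl.
pose hn n := h \_ `[a n, 1 - a n].
have hni n : Rintegrable setT (hn n).
  by apply: Rintegrable_restrictT => //; exact: hi.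
have F0 n x : \int[mu]_(t in `]-oo, x]) hn n t = 0.
  rewrite /hn -Rintegral_mkcondr.
  have [xa|ax] := ltP x (a n).
    rewrite (_ : _ `&` _ = set0) ?Rintegral_set0//.
    apply/seteqP; split => // y [] /=; rewrite !in_itv/= => yx /andP[ay _].
    by have := le_lt_trans (le_trans ay yx) xa; rewrite ltxx.
  have -> : `]-oo, x] `&` `[a n, 1 - a n] = `[a n, Num.min x (1 - a n)]%classic.
    apply/seteqP; split => y /=; rewrite !in_itv/= le_min.
      by move=> [-> /andP[-> ->]].
    by move=> /andP[-> /andP[-> ->]].
  have m1 : Num.min x (1 - a n) < 1 by rewrite (le_lt_trans _ (b1 n))// ge_min lexx orbT.
  have : a n <= Num.min x (1 - a n).
    by rewrite le_min ax/=; have := a2 n; move: (a n) => c; lra.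
  rewrite le_eqVlt => /predU1P[<-|am]; first by rewrite set_itv1 Rintegral_set1.
  exact: test_orthogonal_itv.
have ae n : {ae mu, forall x, hn n x = 0}.
  have := @FTC1Ny R (hn n).
  have i1 y : mu.-integrable `]-oo, y] (EFin \o hn n).
    exact: RintegrableS (hni n).
  have i2 : locally_integrable [set: R] (hn n).
    by apply: integrable_locally_restrict => //; exact: hi.
  move=> /(_ i1 i2) /ae_imp; apply => x [_].
  rewrite (_ : (fun x => _) = fun=> 0) ?derive1_cst//.
  by apply/funext => y; exact: F0.
have : {ae mu, forall x, forall n, hn n x = 0} by apply/ae_foralln.
move=> /ae_imp; apply => x H /andP[x0 x1].
have : (`]0, 1[%classic : set R) x by rewrite /= in_itv/= x0.
rewrite unit_itv_bigcup => -[n _ xn]; have := H n.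
by rewrite /hn patchE mem_set.
Qed.

End WeakDerivatives.

(** * Weak derivatives and absolutely continuous representatives *)

Section WeakDerivativesTheory.
Context {R : realType}.
Notation mu := (@lebesgue_measure R).
Notation "\int01 f" := (Rintegral mu (`]0%R, 1%R[%classic : set (measurableTypeR R)) f)
  (at level 10).
Implicit Types (f g h w u v phi psi : R -> R) (a b c x y t : R) (k n : nat).

Lemma test_function_continuous phi : test_function phi -> continuous phi.
Proof.
by move=> tphi x; apply/differentiable_continuous/derivable1_diffP/derivable_test.
Qed.

(** The primitive from the left vanishes before the support of [h]; beyond it, it equals the total
    integral, hence the zero-mean hypothesis. *)
Lemma test_antiderivative h : test_function h -> \int01 h = 0 ->
  exists2 phi, test_function phi & derive1 phi = h.
Proof.
move=> th h0; have ch := test_function_continuous th.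
have /test_functionP[sh [a [b [a0 ab b1 abh]]]] := th.
have hE : h = h \_ `[a, b].
  apply/funext => x; rewrite patchE; case: ifPn => // /negP xab.
  by apply: abh => xab'; apply: xab; rewrite inE/= in_itv.
have hi : Rintegrable setT h.
  rewrite hE; apply: Rintegrable_restrictT => //.
  by apply: continuous_Rintegrable; exact: continuous_subspaceT.
pose phi x := \int[mu]_(t in `]-oo, x]) h t.
have dphi x : derivable phi x 1 /\ derive1 phi x = h x.
  apply: (@continuous_FTC1 R h -oo%O x (x + 1)).
  - by rewrite ltrDl.
  - exact: RintegrableS hi.
  - exact: ltNyr.
  - exact: ch.
have phiE : derive1 phi = h by apply/funext => x; have [] := dphi x.
exists phi => //; apply/test_functionP; split.
  case=> [//|n]; split; first by move=> x; have [] := dphi x.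
  by rewrite phiE.
exists a, b; split => // x xab; rewrite /phi.
have h01 : \int01 h = \int[mu]_x h x.
  rewrite [LHS]Rintegral_mkcond; apply: eq_Rintegral => y _; rewrite patchE.
  case: ifPn => // /negP yab; apply/esym/abh => /andP[ay yb]; apply: yab.
  by rewrite inE/= in_itv/= (lt_le_trans a0 ay) (le_lt_trans yb b1).
have [xa|ax] := ltP x a.
  rewrite Rintegral_mkcond.
  rewrite (_ : h \_ _ = fun=> 0) ?Rintegral_cst ?mul0r//.
  apply/funext => y; rewrite patchE; case: ifPn => //.
  rewrite inE/= in_itv/= => yx; apply: abh => /andP[ay _].
  by have := le_lt_trans (le_trans ay yx) xa; rewrite ltxx.
rewrite -h0 h01 Rintegral_mkcond; apply: eq_Rintegral => y _; rewrite patchE.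
case: ifPn => // /negP yx; apply/esym/abh => /andP[ay yb]; apply: xab.
rewrite ax/= leNgt; apply/negP => bx; apply: yx; rewrite inE/= in_itv/=.
by rewrite (le_trans yb)// ltW.
Qed.

(** The base point 1/2 is interior because [f] need not be integrable up to 0 or 1. *)
Lemma lac_primitive f : locint f -> exists F, lac F f.
Proof.
move=> fi; pose F x := if 2^-1 <= x then \int[mu]_(t in `[2^-1, x]) f t
  else - \int[mu]_(t in `[x, 2^-1]) f t.
have h0 : 0 < 2^-1 :> R by rewrite invr_gt0.
have h1 : 2^-1 < 1 :> R by rewrite invf_lt1 ?ltr1n.
exists F; split => // a b a0 ab b1; rewrite /F.
have [ha|ah] := leP 2^-1 a.
  by rewrite (le_trans ha ab) (Rintegral_itv_cat ha ab (fi _ _ h0 b1)) addrC addKr.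
have [hb|bh] := leP 2^-1 b.
  by rewrite opprK addrC -(Rintegral_itv_cat (ltW ah) hb (fi _ _ a0 b1)).
by rewrite (Rintegral_itv_cat ab (ltW bh) (fi _ _ a0 h1)); ring.
Qed.

(** Du Bois-Reymond's argument: subtracting from [psi] the multiple of [eta] with the same integral
    leaves the derivative of a test function, so [h] pairs with [psi] as the constant [c] does. *)
Lemma weak_derive0_cst h : locint h ->
  (forall phi, test_function phi -> \int01 (fun x => h x * derive1 phi x) = 0) ->
  exists c, {ae mu, forall x, 0 < x < 1 -> h x = c}.
Proof.
move=> hi h0.
have i1 : locint (fun=> 1 : R) by exact: lac_locint (lac_cst 1).
(* Otherwise the constant 1 would be orthogonal to all test functions and vanish almost
   everywhere. *)
have [eta teta eta0] : exists2 eta, test_function eta & \int01 eta != 0.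
  apply: contrapT => H.
  have : {ae mu, forall x : R, 0 < x < 1 -> 1 = 0 :> R}.
    apply: test_orthogonal_ae0 => // phi tphi.
    rewrite (_ : (fun x => _) = phi); last by apply/funext => x; rewrite mul1r.
    by apply/eqP; apply: contrapT => /negP phi0; apply: H; exists phi.
  move=> [A [mA A0 sub]].
  have : (mu (`]0%R, 1%R[%classic : set R) <= mu A)%E.
    apply: le_measure; rewrite ?inE// => x; rewrite /= in_itv/= => x01.
    by apply: sub => /= /(_ x01)/eqP; rewrite oner_eq0.
  rewrite [X in (_ <= X)%E]A0 lebesgue_measure_itv/= lte_fin ltr01 oppr0 adde0.
  by rewrite lee_fin ler10.
pose c := \int01 (fun x => h x * eta x) / \int01 eta.
exists c.
have hci : locint (fun x => h x - c).
  by apply: locintB => //; exact: lac_locint (lac_cst c).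
suff : {ae mu, forall x, 0 < x < 1 -> h x - c = 0}.
  by move=> /ae_imp; apply => x H /H /eqP; rewrite subr_eq0 => /eqP.
apply: test_orthogonal_ae0 => // psi tpsi.
have int_test phi : test_function phi -> Rintegrable `]0, 1[ phi.
  move=> tphi; have := Rintegrable_locint_test i1 tphi.
  by apply: eq_Rintegrable => // x _; rewrite mul1r.
pose d := \int01 psi / \int01 eta.
have tg := test_functionB d tpsi teta.
have g0 : \int01 (fun x => psi x - d * eta x) = 0.
  rewrite RintegralB//; [|exact: int_test|].
    rewrite RintegralZl//; last exact: int_test.
    by rewrite /d divfK// subrr.
  by apply: RintegrableZ => //; exact: int_test.
have [phi tphi phiE] := test_antiderivative tg g0.
have := h0 _ tphi; rewrite phiE.
have ipsi := Rintegrable_locint_test hi tpsi.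
have ieta := Rintegrable_locint_test hi teta.
rewrite (_ : (fun x => _) = fun x => h x * psi x - d * (h x * eta x)); last first.
  by apply/funext => x; ring.
rewrite RintegralB//; last exact: RintegrableZ.
rewrite RintegralZl// => E.
rewrite (_ : (fun x => _) = fun x => h x * psi x - c * psi x); last first.
  by apply/funext => x; ring.
have i2 := int_test _ tpsi.
rewrite RintegralB//; last exact: RintegrableZ.
rewrite RintegralZl// -[RHS]E; congr (_ - _); rewrite /c /d; field.
exact: eta0.
Qed.

Lemma is_weak_derive_locint k u f : is_weak_derive k u f -> locint u /\ locint f.
Proof. by case=> /locally_integrableP ? /locally_integrableP. Qed.

(** Subtracting a primitive of [f] leaves a function with zero weak derivative, hence almost
    everywhere a constant. *)
Lemma weak_derive_lac w f : is_weak_derive 1 w f ->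
  exists2 v, lac v f & {ae mu, forall x, 0 < x < 1 -> w x = v x}.
Proof.
move=> wf; have [wi fi] := is_weak_derive_locint wf; case: wf => _ _ wf.
have [F lF] := lac_primitive fi.
have hi : locint (fun x => w x - F x) := locintB wi (lac_locint lF).
have [c hc] : exists c, {ae mu, forall x, 0 < x < 1 -> w x - F x = c}.
  apply: weak_derive0_cst => // phi tphi.
  have tphi' := test_function_derive tphi.
  have i1 := Rintegrable_locint_test wi tphi'.
  have i2 := Rintegrable_locint_test (lac_locint lF) tphi'.
  rewrite (_ : (fun x => _) = fun x => w x * derive1 phi x - F x * derive1 phi x).
    2: by apply/funext => x; ring.
  rewrite RintegralB// (lac_weak_derive lF tphi) (wf _ tphi).
  by rewrite expr1 mulN1r subrr.
exists (fun x => F x + c).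
  by apply: eq_lac (lacD lF (lac_cst c)) => // x _; rewrite addr0.
move: hc => /ae_imp; apply => x H /H <-; ring.
Qed.

Lemma ae_eq_int01 f g h : locint f -> locint g -> test_function h ->
  {ae mu, forall x, 0 < x < 1 -> f x = g x} ->
  \int01 (fun x => f x * h x) = \int01 (fun x => g x * h x).
Proof.
move=> fi gi th fg; rewrite /Rintegral; congr fine; apply: ae_eq_integral => //.
- exact: measurable_int (Rintegrable_locint_test fi th).
- exact: measurable_int (Rintegrable_locint_test gi th).
- by move: fg => /ae_imp; apply => x H; rewrite /= in_itv/= => /H ->.
Qed.

Lemma is_weak_derive_unique k u v f g : is_weak_derive k u f ->
  is_weak_derive k v g -> {ae mu, forall x, 0 < x < 1 -> u x = v x} ->
  {ae mu, forall x, 0 < x < 1 -> f x = g x}.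
Proof.
move=> uf vg uv.
have [ui fi] := is_weak_derive_locint uf; case: uf => _ _ uf.
have [vi gi] := is_weak_derive_locint vg; case: vg => _ _ vg.
suff : {ae mu, forall x, 0 < x < 1 -> f x - g x = 0}.
  by move=> /ae_imp; apply => x H /H /eqP; rewrite subr_eq0 => /eqP.
apply: test_orthogonal_ae0; first exact: locintB.
move=> phi tphi.
have tphik : test_function (derive1n k phi).
  by elim: (k) => [//|m IH]; exact: test_function_derive.
have := ae_eq_int01 ui vi tphik uv.
have s0 : (-1) ^+ k != 0 :> R by rewrite signr_eq0.
rewrite (uf _ tphi) (vg _ tphi) => /(mulfI s0) E.
have i1 := Rintegrable_locint_test fi tphi.
have i2 := Rintegrable_locint_test gi tphi.
rewrite (_ : (fun x => _) = fun x => f x * phi x - g x * phi x).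
  2: by apply/funext => x; ring.
by rewrite RintegralB// E subrr.
Qed.

(** In [Bspace] the weak derivatives of all orders are taken from [u] itself; testing with
    [derive1 phi] links consecutive orders. *)
Lemma is_weak_derive_step k u f g : is_weak_derive k u f ->
  is_weak_derive k.+1 u g -> is_weak_derive 1 f g.
Proof.
move=> [ui fi uf] [_ gi ug]; split => // phi tphi.
have s0 : (-1) ^+ k != 0 :> R by rewrite signr_eq0.
apply: (mulfI s0).
rewrite -(uf _ (test_function_derive tphi)) -derive1Sn (ug _ tphi).
by rewrite exprS expr1 -mulrA mulrCA.
Qed.

Lemma lac_is_weak_derive w v f : lac v f -> locint w ->
  {ae mu, forall x, 0 < x < 1 -> w x = v x} -> is_weak_derive 1 w f.
Proof.
move=> vf wi wv; split; [exact/locally_integrableP|exact/locally_integrableP/vf.1|].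
move=> phi tphi; rewrite expr1 mulN1r -(lac_weak_derive vf tphi).
exact: ae_eq_int01 wi (lac_locint vf) (test_function_derive tphi) wv.
Qed.

End WeakDerivativesTheory.

(** * The image measure of the power substitution *)

Section PowerMeasure.
Context {R : realType}.
Notation mu := (@lebesgue_measure R).
Implicit Types (f g h w u v : R -> R) (a b c x y t lam : R).

(* The absolute value keeps the density nonnegative for every [lam]. *)
Definition powR_density lam x := `|lam| * x `^ (lam - 1).

Lemma powR_density_ge0 lam x : 0 <= powR_density lam x.
Proof. by rewrite mulr_ge0 ?powR_ge0. Qed.

Lemma measurable_powR_density lam (D : set (measurableTypeR R)) :
  measurable D -> measurable_fun D (powR_density lam).
Proof.
by move=> mD; apply: measurable_funM => //; apply: measurable_funTS; exact: measurable_powR.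
Qed.

Let e lam x : \bar R := ((powR_density lam \_ `]0, 1[) x)%:E.

Let e_ge0 lam x : (0 <= e lam x)%E.
Proof. by rewrite lee_fin patchE; case: ifP => // _; exact: powR_density_ge0. Qed.

Let e_meas lam : measurable_fun (setT : set (measurableTypeR R)) (e lam).
Proof.
apply/measurable_EFinP; apply/(measurable_restrictT _ _).1 => //.
exact: measurable_powR_density.
Qed.

Definition powR_map lam x := x `^ lam.

Let phi_meas lam : measurable_fun (setT : set (measurableTypeR R)) (powR_map lam : R -> measurableTypeR R).
Proof. exact: measurable_powR. Qed.

(** Push-forward under [powR_map lam] of the density [powR_density lam] on the open interval. The
    change of variables for arbitrary measurable functions thus becomes an equality of measures, to
    be checked on rays. *)
Definition powR_image_measure lam (A : set (measurableTypeR R)) : \bar R :=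
  (\int[mu]_(x in powR_map lam @^-1` A)
    ((powR_density lam \_ (`]0%R, 1%R[%classic : set R)) x)%:E)%E.

Let nu := powR_image_measure.

Let mphi lam (A : set (measurableTypeR R)) : measurable A ->
  measurable (powR_map lam @^-1` A : set (measurableTypeR R)).
Proof. by move=> mA; rewrite -[X in measurable X]setTI; exact: phi_meas. Qed.

Let nu0 lam : nu lam set0 = 0%E.
Proof. by rewrite /nu /powR_image_measure preimage_set0 integral_set0. Qed.

Let nu_ge0 lam A : (0 <= nu lam A)%E.
Proof. by apply: integral_ge0 => x _; exact: e_ge0. Qed.

Let nu_sigma_additive lam : semi_sigma_additive (nu lam).
Proof.
move=> A mA tA mUA; rewrite /nu /powR_image_measure preimage_bigcup.
rewrite ge0_integral_bigcup//.
- by apply: is_cvg_ereal_nneg_natsum_cond => n _ _; exact: nu_ge0.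
- by move=> n; exact: mphi.
- by apply: measurable_funTS; exact: e_meas.
- by move=> x _; exact: e_ge0.
- apply/trivIsetP => /= i j _ _ ij; rewrite -preimage_setI.
  by move/trivIsetP : tA => /(_ _ _ _ _ ij) ->//; rewrite preimage_set0.
Qed.

HB.instance Definition _ lam := isMeasure.Build _ _ _ (powR_image_measure lam)
  (nu0 lam) (@nu_ge0 lam) (@nu_sigma_additive lam).

End PowerMeasure.

(** * Change of variables y = x^lam for nonnegative functions *)

Section PowerSubstitution.
Context {R : realType}.
Notation mu := (@lebesgue_measure R).
Implicit Types (f g h w u v : R -> R) (a b c x y t lam : R).

Lemma powR_lt1 lam x : 0 < lam -> 0 < x < 1 -> 0 < x `^ lam < 1.
Proof.
move=> l0 /andP[x0 x1]; rewrite powR_gt0//=.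
have := @gt0_ltr_powR _ lam l0 x 1; rewrite powR1; apply; rewrite ?nnegrE ?ltW//.
Qed.

Lemma lac_powR lam : 0 < lam -> lac (fun x => x `^ lam) (powR_density lam).
Proof.
move=> l0; apply: C1_lac => x /andP[x0 x1].
  rewrite /powR_density gtr0_norm//; exact: is_derive1_powR.
apply: continuousM; first exact: cst_continuous.
by have [/derivable1_diffP/differentiable_continuous] := is_derive1_powR (lam - 1) x0.
Qed.

Lemma powR_continuous lam x : 0 < x -> {for x, continuous (fun x => x `^ lam)}.
Proof.
by move=> x0; have [/derivable1_diffP/differentiable_continuous] := is_derive1_powR lam x0.
Qed.

Lemma Rintegrable_powR_density lam : 0 < lam ->
  Rintegrable `]0, 1[ (powR_density lam).
Proof.
move=> l0; have [di dE] := lac_powR l0.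
apply: (proj1 (@Rintegrable_oo_le _ _ 1 di _ _)).
  by move=> x _; exact: powR_density_ge0.
move=> a b a0 ab b1; rewrite -dE//.
have b0 := lt_le_trans a0 ab.
have : b `^ lam < 1 by have /andP[] := @powR_lt1 lam b l0 (introT andP (conj b0 b1)).
by have := powR_ge0 a lam; lra.
Qed.

Lemma powR_near0 lam e : 0 < lam -> 0 < e ->
  exists2 d, 0 < d & forall x, 0 < x < d -> x `^ lam < e.
Proof.
move=> l0 e0; exists (e `^ lam^-1); first by rewrite powR_gt0.
move=> x /andP[x0 xe].
have := @gt0_ltr_powR _ lam l0 x (e `^ lam^-1).
rewrite -powRrM mulVf ?gt_eqF// powRr1 ?ltW//; apply; rewrite ?nnegrE ?powR_ge0//.
exact: ltW.
Qed.

Lemma powR_near1 lam e : 0 < e ->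
  exists2 d, 0 < d & forall x, 1 - d < x < 1 -> `|x `^ lam - 1| < e.
Proof.
move=> e0; have /cvgrPdist_lt/(_ _ e0) := @powR_continuous lam 1 (@ltr01 R).
move=> [d /= d0 dP]; exists d => // x /andP[xd x1].
have := dP x; rewrite /= powR1 distrC [`|x `^ _ - _|]distrC; apply.
by rewrite ltr_norml; apply/andP; split; lra.
Qed.

Lemma Rintegral_powR_tail lam r : 0 < lam -> 0 <= r <= 1 ->
  \int[mu]_(x in `]r, 1[) powR_density lam x = 1 - r `^ lam.
Proof.
move=> l0 /andP[r0 r1]; have di := Rintegrable_powR_density l0.
have ld := lac_powR l0.
move: r0; rewrite le_eqVlt => /predU1P[<-|r0].
  rewrite powR0 ?gt_eqF// subr0.
  have d1i : Rintegrable `]0, 1[ (fun=> 1 : R).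
    have := Rintegrable_jacobi (al := 0) (be := 0) (ltrN10 R) (ltrN10 R).
    by apply: eq_Rintegrable => // x _; rewrite /jacobi !powRr0 mulr1.
  have lx : lac (fun x : R => x) (fun=> 1).
    by apply: C1_lac => x _; exact: cst_continuous.
  (* The power [x^lam] is not small near 1, but [x^lam - x] is small near both ends, and the
     derivative of [x] has integral 1. *)
  have vx : vanishing_ends (fun x => x `^ lam - x).
    apply: vanishing_ends_near => e0 e00.
    have e2 : 0 < e0 / 2 by rewrite divr_gt0.
    have [d d0 dP] := powR_near0 l0 e2.
    have [d' d'0 d'P] := powR_near1 lam e2.
    exists (Num.min (Num.min d d') (e0 / 2)); first by rewrite !lt_min d0 d'0.
    move=> x /andP[x0 x1]; rewrite !lt_min ltrBlDr -ltrBlDl !lt_min.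
    move=> /orP[/andP[/andP[xd _] xe]|/andP[/andP[_ xd] xe]].
      have := dP x; rewrite x0 xd => /(_ isT) h; have := powR_ge0 x lam => h'.
      by rewrite ltr_norml; apply/andP; split; lra.
    have := d'P x; rewrite x1 andbT ltrBlDr -ltrBlDl xd => /(_ isT).
    by rewrite !ltr_norml => /andP[h h']; apply/andP; split; lra.
  have := lac_int0 (lacB ld lx) vx (RintegrableB (measurable_itv _) di d1i).
  rewrite RintegralB// => /eqP; rewrite subr_eq0 => /eqP ->.
  by rewrite Rintegral_cst//= lebesgue_measure_itv/= lte_fin ltr01 -EFinD/= subr0 mulr1.
move: r1; rewrite le_eqVlt => /predU1P[->|r1].
  by rewrite set_itv_ge ?Rintegral_set0 ?powR1 ?subrr// -leNgt bnd_simp.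
apply/eqP; rewrite -subr_eq0 -normr_le0; apply/ler_addgt0Pl => e0 e00; rewrite addr0.
have e2 : 0 < e0 / 2 by rewrite divr_gt0.
have [d /andP[d0 d2] [_ dP]] := Rintegral_tails e2 di.
have [d' d'0 d'P] := powR_near1 lam e2.
(* Beyond [b] the tail is small and [b^lam] is already close to 1; on [[r, b]] the primitive is
   exact. *)
pose b := Num.max r (1 - Num.min d d' / 2).
have m0 : 0 < Num.min d d' by rewrite lt_min d0.
have md : Num.min d d' <= d by rewrite ge_min lexx.
have md' : Num.min d d' <= d' by rewrite ge_min lexx orbT.
have b1 : b < 1 by rewrite gt_max r1/=; lra.
have rb : r <= b by rewrite le_max lexx.
have bm : 1 - Num.min d d' / 2 <= b by rewrite le_max lexx orbT.
have fi : Rintegrable `]r, 1[ (powR_density lam).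
  by apply: RintegrableS di => //; apply: subset_itv; rewrite bnd_simp// ltW.
have := @Rintegral_itvB R _ (BRight r) (BLeft 1) b fi.
rewrite !bnd_simp => /(_ rb b1) /eqP; rewrite subr_eq => /eqP ->.
have fi2 : Rintegrable `[b, 1[ (powR_density lam).
  by apply: RintegrableS di => //; apply: subset_itv; rewrite bnd_simp// (lt_le_trans r0).
have fi3 : Rintegrable `[r, b] (powR_density lam) by exact: ld.1.
rewrite !Rintegral_itv_obnd_cbnd -?ld.2//; last 2 first.
- by apply: RintegrableS fi3 => //; apply: subset_itv; rewrite bnd_simp.
- by apply: RintegrableS fi2 => //; apply: subset_itv; rewrite bnd_simp.
have := dP b; have -> : 1 - d < b < 1 by rewrite b1 andbT; lra.
move=> /(_ isT); have := d'P b; have -> : 1 - d' < b < 1 by rewrite b1 andbT; lra.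
move=> /(_ isT) h1 /ltW h2.
have := le_trans (le_normr_Rintegral (mu := mu) (measurable_itv `[b, 1[) fi2) h2.
move: h1; rewrite ltr_norml !ler_norml => /andP[? ?] /andP[? ?].
by apply/andP; split; lra.
Qed.

Lemma powR_image_measure_ray lam t : 0 < lam ->
  powR_image_measure lam `]t, +oo[ = (1 - Num.max 0 (Num.min t 1))%:E.
Proof.
(* Clamping [t] to [0, 1] treats all rays at once; [r] is the point with [r^lam = c]. *)
move=> l0; pose c := Num.max 0 (Num.min t 1); pose r := c `^ lam^-1.
have c0 : 0 <= c by rewrite le_max lexx.
have c1 : c <= 1 by rewrite ge_max ler01 ge_min lexx orbT.
have rl : r `^ lam = c by rewrite -powRrM mulVf ?gt_eqF// powRr1.
have r0 : 0 <= r by exact: powR_ge0.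
have r1 : r <= 1.
  have := @ge0_ler_powR _ lam^-1 _ c 1; rewrite powR1; apply; rewrite ?nnegrE//.
  by rewrite invr_ge0 ltW.
have -> : powR_image_measure lam `]t, +oo[ =
    (\int[mu]_(x in `]r, 1%R[) (powR_density lam x)%:E)%E.
  have H x : (x \in `]r, 1[) = (t < x `^ lam) && (0 < x < 1).
    apply/idP/idP; rewrite in_itv/=.
      move=> /andP[rx x1]; have x0 := le_lt_trans r0 rx; rewrite x0 x1 !andbT.
      have : c < x `^ lam.
        by rewrite -rl; apply: gt0_ltr_powR => //; rewrite nnegrE// ltW.
      have /andP[_ xl1] := @powR_lt1 lam x l0 (introT andP (conj x0 x1)).
      by rewrite gt_max gt_min => /andP[_ /orP[//|]]; rewrite ltNge ltW.
    move=> /andP[tx /andP[x0 x1]]; rewrite x1 andbT ltNge; apply/negP => xr.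
    have : x `^ lam <= c.
      by rewrite -rl; apply: ge0_ler_powR => //; rewrite ?nnegrE// ltW.
    rewrite le_max le_min [_ <= 0]leNgt powR_gt0//=.
    by rewrite leNgt tx.
  rewrite /powR_image_measure [LHS]integral_mkcond [RHS]integral_mkcond.
  apply: eq_integral => x _; rewrite !patchE.
  have -> : (x \in powR_map lam @^-1` `]t, +oo[) = (t < x `^ lam).
    by apply/idP/idP; rewrite inE/= in_itv/= andbT.
  have -> : (x \in `]0, 1[%classic) = (0 < x < 1) by rewrite mem_setE in_itv.
  have -> : (x \in `]r, 1[%classic) = (t < x `^ lam) && (0 < x < 1).
    by rewrite mem_setE H.
  by case: ifP => //= _; case: ifP.
rewrite (@EFin_Rintegral _ `]r, 1[) ?Rintegral_powR_tail ?r0 ?rl//.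
by apply: RintegrableS (Rintegrable_powR_density l0) => //; apply: subset_itv; rewrite bnd_simp.
Qed.

(** Open rays are stable under intersection, generate the Borel sets and cover the line with finite
    mass, so agreement on them suffices. The reference exponent 1 gives Lebesgue measure on the open
    interval. *)
Lemma powR_image_measureE lam (A : set (measurableTypeR R)) : 0 < lam -> measurable A ->
  powR_image_measure lam A = powR_image_measure 1 A.
Proof.
move=> l0 mA.
apply: (measure_unique [set B : set (measurableTypeR R) | exists x : R, B = `]x, +oo[%classic] (fun n => `](- n%:R)%R, +oo[%classic)).
- exact: RGenOInfty.measurableE.
- move=> _ _ [x ->] [y ->]; exists (Num.max x y).
  by apply/seteqP; split => z /=; rewrite !in_itv/= !andbT gt_max => /andP.
- by move=> n; exists (- n%:R).
- apply/seteqP; split => // x _; exists (Num.bound `|x|) => //=.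
  rewrite in_itv/= andbT ltrNl (le_lt_trans (ler_norm _))// normrN.
  exact: archi_boundP.
- by move=> _ [t ->]; rewrite /= !powR_image_measure_ray.
- by move=> n; rewrite /= powR_image_measure_ray// ltry.
- exact: mA.
Qed.

Import HBNNSimple.

Let powR_weight lam x : \bar R := ((powR_density lam \_ `]0%R, 1%R[) x)%:E.

Let powR_weight_ge0 lam x : (0 <= powR_weight lam x)%E.
Proof. by rewrite lee_fin patchE; case: ifP => // _; exact: powR_density_ge0. Qed.

Let measurable_powR_weight lam (D : set (measurableTypeR R)) : measurable D ->
  measurable_fun D (powR_weight lam).
Proof.
move=> mD; apply: measurable_funTS; apply/measurable_EFinP.
apply/(measurable_restrictT _ _).1 => //; exact: measurable_powR_density.
Qed.

Let measurable_powR_comp lam (F : R -> \bar R) :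
  measurable_fun (setT : set (measurableTypeR R)) F ->
  measurable_fun (setT : set (measurableTypeR R)) (fun x => F (x `^ lam)).
Proof.
by move=> mF; apply: (measurableT_comp (f := F)) => //; exact: measurable_powR.
Qed.

Lemma integral_powR_image_nnsfun lam (h : {nnsfun (measurableTypeR R) >-> R}) :
  (\int[powR_image_measure lam]_x (h x)%:E =
   \int[mu]_x ((h (x `^ lam)%R)%:E * powR_weight lam x))%E.
Proof.
under [LHS]eq_integral do rewrite fimfunE -fsumEFin//.
rewrite [LHS]ge0_integral_fsum//; last 2 first.
- by move=> r; exact/measurable_EFinP/measurableT_comp.
- by move=> n x _; rewrite EFinM nnfun_muleindic_ge0.
under [RHS]eq_integral.
  move=> x _; rewrite (fimfunE h (x `^ lam)) -fsumEFin//.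
  rewrite ge0_mule_fsuml; last by move=> r; rewrite EFinM nnfun_muleindic_ge0.
  over.
rewrite [RHS]ge0_integral_fsum//; last 2 first.
- move=> r; apply: emeasurable_funM; last exact: measurable_powR_weight.
  apply: (measurable_powR_comp lam (F := fun y => (r * \1_(h @^-1` [set r]) y)%:E)).
  by apply/measurable_EFinP; apply: measurable_funM.
- by move=> n x _; rewrite mule_ge0 ?EFinM ?nnfun_muleindic_ge0 ?powR_weight_ge0.
apply: eq_fsbigr => r _.
rewrite integralZl_indic_nnsfun//= integral_indic// setIT.
have [r0|r0] := ltP r 0.
  rewrite preimage_nnfun0// measure0 mule0 integral0_eq// => x _.
  by rewrite indic0 mulr0 mul0e.
under [RHS]eq_integral do rewrite EFinM -muleA.
rewrite ge0_integralZl//; last 2 first.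
- apply: emeasurable_funM; last exact: measurable_powR_weight.
  apply: (measurable_powR_comp lam (F := fun y => (\1_(h @^-1` [set r]) y)%:E)).
  by apply/measurable_EFinP.
- by move=> x _; rewrite mule_ge0 ?powR_weight_ge0// lee_fin.
congr (_ * _)%E; rewrite /= /powR_image_measure [LHS]integral_mkcond.
apply: eq_integral => x _; rewrite patchE indicE.
have -> : (x \in powR_map lam @^-1` (h @^-1` [set r])) = (x `^ lam \in h @^-1` [set r]).
  by apply/idP/idP; rewrite !inE.
by case: ifP => _; rewrite ?mul1e ?mul0e.
Qed.

(** Simple functions increase to [F], and monotone convergence applies on both sides. *)
Lemma integral_powR_image lam (F : R -> \bar R) :
  (forall x, 0 <= F x)%E -> measurable_fun (setT : set (measurableTypeR R)) F ->
  (\int[powR_image_measure lam]_x F x =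
   \int[mu]_x (F (x `^ lam)%R * powR_weight lam x))%E.
Proof.
move=> F0 mF; pose h := nnsfun_approx measurableT mF.
transitivity (lim (\int[powR_image_measure lam]_x (h n x)%:E @[n --> \oo])%E).
  rewrite -monotone_convergence//=.
  - apply: eq_integral => x _; apply/esym/cvg_lim => //=.
    exact: cvg_nnsfun_approx.
  - by move=> n; exact/measurable_EFinP/measurable_funTS.
  - by move=> n x _; rewrite lee_fin.
  - by move=> x _ i j ij; rewrite lee_fin; exact/lefP/nd_nnsfun_approx.
under eq_fun do rewrite integral_powR_image_nnsfun.
rewrite -monotone_convergence//=.
- apply: eq_integral => x _; apply/cvg_lim => //=.
  by apply: cvgeZr => //; exact: cvg_nnsfun_approx.
- move=> n; apply: emeasurable_funM; last exact: measurable_powR_weight.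
  apply: (measurable_powR_comp lam (F := EFin \o h n)).
  exact/measurable_EFinP.
- by move=> n x _; rewrite mule_ge0 ?powR_weight_ge0// lee_fin.
- move=> x _ i j ij; rewrite lee_wpmul2r ?powR_weight_ge0// lee_fin.
  by have /lefP := nd_nnsfun_approx measurableT mF ij; apply.
Qed.

(** Both sides are integrals of [F] against image measures, for the exponents [lam] and 1, and these
    measures coincide. *)
Lemma ge0_integral_powR lam (F : R -> \bar R) : 0 < lam ->
  (forall x, 0 <= F x)%E -> measurable_fun (`]0%R, 1%R[%classic : set (measurableTypeR R)) F ->
  (\int[mu]_(x in `]0%R, 1%R[) (F (x `^ lam)%R * (powR_density lam x)%:E) =
   \int[mu]_(x in `]0%R, 1%R[) F x)%E.
Proof.
move=> l0 F0 mF; pose G := F \_ `]0%R, 1%R[%classic.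
have G0 x : (0 <= G x)%E by rewrite /G patchE; case: ifP.
have mG : measurable_fun (setT : set (measurableTypeR R)) G.
  by apply/(measurable_restrictT _ _).1.
have E (k : R) : 0 < k -> (\int[powR_image_measure k]_x G x =
    \int[mu]_(x in `]0%R, 1%R[) (F (x `^ k)%R * (powR_density k x)%:E))%E.
  move=> k0; rewrite integral_powR_image// [RHS]integral_mkcond.
  apply: eq_integral => x _; rewrite /powR_weight !patchE.
  have [xI|xI] := boolP (x \in `]0, 1[%classic); last by rewrite mule0.
  rewrite /G patchE ifT//; move: xI; rewrite !mem_setE !in_itv/=; exact: powR_lt1.
rewrite -E// (eq_measure_integral (powR_image_measure 1)); last first.
  by move=> A mA _; exact: powR_image_measureE.
rewrite E//; apply: eq_integral => x; rewrite mem_setE in_itv/= => /andP[x0 _].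
by rewrite powRr1 ?ltW// /powR_density subrr powRr0 normr1 mulr1 mule1.
Qed.

End PowerSubstitution.

(** * Integrability, null sets and absolute continuity under the substitution *)

Section PowerComposition.
Context {R : realType}.
Notation mu := (@lebesgue_measure R).
Notation "\int01 f" := (Rintegral mu (`]0%R, 1%R[%classic : set (measurableTypeR R)) f)
  (at level 10).
Implicit Types (f g h w u v : R -> R) (a b c x y t lam : R).

Lemma ler_powR_pos lam x y : 0 < lam -> 0 < x -> 0 < y ->
  (x `^ lam <= y `^ lam) = (x <= y).
Proof.
move=> l0 x0 y0; apply/idP/idP; last first.
  by apply: ge0_ler_powR; rewrite ?nnegrE; exact: ltW.
apply: contraTT; rewrite -!ltNge => yx.
by apply: gt0_ltr_powR => //; rewrite nnegrE ltW.
Qed.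

Lemma measurable_comp_powR lam f : 0 < lam ->
  measurable_fun (`]0, 1[%classic : set (measurableTypeR R)) f ->
  measurable_fun (`]0, 1[%classic : set (measurableTypeR R)) (fun x => f (x `^ lam)).
Proof.
move=> l0 mf; apply: (measurable_comp (F := (`]0, 1[%classic : set (measurableTypeR R)))
    (f := f) (g := powR_map lam)) => //.
  by move=> _ [x x01 <-]; move: x01; rewrite /= !in_itv/=; exact: powR_lt1.
by apply: measurable_funTS; exact: measurable_powR.
Qed.

Lemma Rintegral_ge0_powR lam f : 0 < lam -> (forall x, 0 <= f x) ->
  measurable_fun (`]0, 1[%classic : set (measurableTypeR R)) f ->
  \int01 (fun x => f (x `^ lam) * powR_density lam x) = \int01 f.
Proof.
move=> l0 f0 mf; rewrite /Rintegral -(@ge0_integral_powR _ lam (EFin \o f))//.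
exact/measurable_EFinP.
Qed.

Lemma Rintegrable_powR lam f : 0 < lam -> Rintegrable `]0, 1[ f ->
  Rintegrable `]0, 1[ (fun x => f (x `^ lam) * powR_density lam x).
Proof.
move=> l0 fi; have mf := Rintegrable_measurable fi.
apply/integrableP; split.
  apply/measurable_EFinP; apply: measurable_funM; first exact: measurable_comp_powR.
  exact: measurable_powR_density.
under eq_integral do rewrite /= normrM [`|powR_density _ _|]ger0_norm ?powR_density_ge0// EFinM.
rewrite (@ge0_integral_powR _ lam (fun y => `|f y|%:E))//.
- by move/integrableP : fi => [].
- by apply/measurable_EFinP; exact: measurableT_comp.
Qed.

(** Reduced to nonnegative functions by [f = |f| - (|f| - f)]. *)
Lemma Rintegral_powR lam f : 0 < lam -> Rintegrable `]0, 1[ f ->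
  \int01 (fun x => f (x `^ lam) * powR_density lam x) = \int01 f.
Proof.
move=> l0 fi; have mf := Rintegrable_measurable fi.
have mI : measurable (`]0, 1[%classic : set (measurableTypeR R)) by [].
have ni := Rintegrable_norm mI fi.
have pi : Rintegrable `]0, 1[ (fun x => `|f x| - f x) by exact: RintegrableB.
have E g : Rintegrable `]0, 1[ g -> (forall x, 0 <= g x) ->
    \int01 (fun x => g (x `^ lam) * powR_density lam x) = \int01 g.
  by move=> gi g0; rewrite Rintegral_ge0_powR//; exact: Rintegrable_measurable.
have -> : \int01 f = \int01 (fun x => `|f x|) - \int01 (fun x => `|f x| - f x).
  by rewrite RintegralB// opprB addrC subrK.
rewrite -(E _ ni)// -(E _ pi); last by move=> x; rewrite subr_ge0 ler_norm.
rewrite -RintegralB//; first by apply: eq_Rintegral => x _; ring.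
- exact: (Rintegrable_powR l0 ni).
- exact: (Rintegrable_powR l0 pi).
Qed.

Lemma itv_powR lam a b x : 0 < lam -> 0 < a -> 0 < b -> 0 < x ->
  (x `^ lam \in `[a `^ lam, b `^ lam]) = (x \in `[a, b]).
Proof. by move=> l0 a0 b0 x0; rewrite !in_itv/= !ler_powR_pos. Qed.

(** As [f] need not be integrable on the whole interval, the substitution is applied to its
    restriction to the image segment. *)
Lemma locint_powR lam f : 0 < lam -> locint f ->
  locint (fun x => f (x `^ lam) * powR_density lam x).
Proof.
move=> l0 lf a b a0 b1; have [ab|ba] := leP a b; last first.
  rewrite set_itv_ge ?bnd_simp -?ltNge//; exact: integrable_set0.
have b0 := lt_le_trans a0 ab.
have /andP[bl0 bl1] := @powR_lt1 _ lam b l0 (introT andP (conj b0 b1)).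
have fi : Rintegrable `[a `^ lam, b `^ lam] f by apply: lf => //; rewrite powR_gt0.
have := Rintegrable_restrictT (measurable_itv _) fi.
move=> /(RintegrableS (measurable_itv `]0, 1[) measurableT (@subsetT _ _)).
move=> /(Rintegrable_powR l0)/Rintegrable_locint/(_ a b a0 b1).
apply: eq_Rintegrable => // x /= xab.
have x0 : 0 < x by move: xab; rewrite in_itv/= => /andP[+ _]; exact: lt_le_trans.
by rewrite patchE mem_setE itv_powR// xab.
Qed.

Lemma Rintegral_itv_powR lam f a b : 0 < lam -> locint f ->
  0 < a -> a <= b -> b < 1 ->
  \int[mu]_(x in `[a, b]) (f (x `^ lam) * powR_density lam x) =
  \int[mu]_(x in `[a `^ lam, b `^ lam]) f x.
Proof.
move=> l0 lf a0 ab b1.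
have b0 := lt_le_trans a0 ab.
have /andP[bl0 bl1] := @powR_lt1 _ lam b l0 (introT andP (conj b0 b1)).
have al0 : 0 < a `^ lam by rewrite powR_gt0.
have fi : Rintegrable `[a `^ lam, b `^ lam] f by exact: lf.
have := Rintegrable_restrictT (measurable_itv _) fi.
move=> /(RintegrableS (measurable_itv `]0, 1[) measurableT (@subsetT _ _)).
move=> /(Rintegral_powR l0) E.
have S c d : 0 < c -> d < 1 -> `[c, d]%classic = `]0, 1[ `&` `[c, d] :> set R.
  by move=> c0 d1; rewrite setIidr//; exact: subset_cc_oo.
rewrite (S a b)// (S (a `^ lam) (b `^ lam))// !Rintegral_mkcondr -E.
apply: eq_Rintegral => x; rewrite mem_setE in_itv/= => /andP[x0 _].
by rewrite !patchE !mem_setE itv_powR//; case: ifP => //; rewrite mul0r.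
Qed.

Lemma lac_powR_comp lam w f : 0 < lam -> lac w f ->
  lac (fun x => w (x `^ lam)) (fun x => f (x `^ lam) * powR_density lam x).
Proof.
move=> l0 [lf wE]; split; first exact: locint_powR.
move=> a b a0 ab b1; rewrite Rintegral_itv_powR//.
have b0 := lt_le_trans a0 ab.
have /andP[bl0 bl1] := @powR_lt1 _ lam b l0 (introT andP (conj b0 b1)).
by apply: wE => //; rewrite ?powR_gt0// ler_powR_pos.
Qed.

(** Null sets pull back to null sets: the substituted integral of the indicator of [B] is 0, and the
    density is positive. *)
Lemma ae_powR lam (P : R -> Prop) : 0 < lam ->
  {ae mu, forall y, 0 < y < 1 -> P y} ->
  {ae mu, forall x, 0 < x < 1 -> P (x `^ lam)}.
Proof.
move=> l0 [B [mB B0 PB]].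
pose F y : \bar R := (\1_B y)%:E.
have F0 y : (0 <= F y)%E by rewrite lee_fin.
have mF : measurable_fun (`]0%R, 1%R[%classic : set (measurableTypeR R)) F.
  by apply/measurable_EFinP; apply: measurable_funTS; exact: measurable_indic.
have E := ge0_integral_powR l0 F0 mF.
have I0 : (\int[mu]_(x in `]0%R, 1%R[) F x)%E = 0%E.
  rewrite integral_indic//; apply/eqP; rewrite eq_le measure_ge0 andbT -B0.
  by apply: le_measure; rewrite ?inE//; exact: measurableI.
rewrite I0 in E.
have mFl : measurable_fun (`]0%R, 1%R[%classic : set (measurableTypeR R))
    (fun x => F (x `^ lam)%R * (powR_density lam x)%:E)%E.
  apply/measurable_EFinP/measurable_funM; last exact: measurable_powR_density.
  by apply: (measurable_comp_powR l0 (f := \1_B)); apply: measurable_funTS; exact: measurable_indic.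
have mI : measurable (`]0, 1[%classic : set (measurableTypeR R)) by [].
have := (ae_eq_integral_abs mu mI mFl).1; case.
  rewrite -E; apply: eq_integral => x _.
  by rewrite gee0_abs// mule_ge0// lee_fin powR_density_ge0.
move=> C [mC C0 CP]; exists C; split=> // x /= nP; apply: CP => /= H; apply: nP => x01.
apply: contrapT => nPx.
have xB : B (x `^ lam).
  by apply: PB => /= H'; apply: nPx; apply: H'; exact: powR_lt1.
move: H; rewrite /F indicE mem_set//= mul1e in_itv/= => /(_ x01)[] /eqP.
by rewrite mulf_eq0 normr_eq0 gt_eqF//= gt_eqF// powR_gt0; case/andP : x01.
Qed.

End PowerComposition.

(** * Orthogonal projection onto polynomials *)

Section WeightedProjection.
Context {R : realType}.
Notation mu := (@lebesgue_measure R).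
Notation "\int01 f" := (Rintegral mu (`]0%R, 1%R[%classic : set (measurableTypeR R)) f)
  (at level 10).
Implicit Types (f g h : R -> R) (c : R) (p q : {poly R}).
Variable w : R -> R.
Hypothesis wi : Rintegrable `]0, 1[ w.
Hypothesis w0 : forall x, 0 <= w x.

Definition L2w f := measurable_fun (`]0, 1[%classic : set (measurableTypeR R)) f /\
  Rintegrable `]0, 1[ (fun x => f x ^+ 2 * w x).

Let dot f g := \int01 (fun x => f x * g x * w x).

Lemma L2w_mul f g : L2w f -> L2w g ->
  Rintegrable `]0, 1[ (fun x => f x * g x * w x).
Proof.
move=> [mf fi] [mg gi]; apply: RintegrableM_sqr => //.
exact: Rintegrable_measurable.
Qed.

Lemma L2w_lin f g c : L2w f -> L2w g -> L2w (fun x => f x + c * g x).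
Proof.
move=> fL gL; split.
  by apply: measurable_funD; [exact: fL.1|apply: measurable_funM => //; exact: gL.1].
have mI : measurable (`]0, 1[%classic : set (measurableTypeR R)) by [].
have := RintegrableD mI (RintegrableD mI fL.2 (RintegrableZ (2 * c) mI (L2w_mul fL gL)))
  (RintegrableZ (c ^+ 2) mI gL.2).
by apply: eq_Rintegrable => // x _ /=; ring.
Qed.

Lemma L2w_horner p : L2w (horner p).
Proof. by split; [exact: measurable_horner|exact: Rintegrable_horner_sqr_weight]. Qed.

Lemma L2w_subr_horner f p : L2w f -> L2w (fun x => f x - p.[x]).
Proof.
move=> fL; have := L2w_lin (- 1) fL (L2w_horner p).
by congr L2w; apply/funext => x; rewrite mulN1r.
Qed.

Lemma int_mul_linl f g h c : L2w f -> L2w g -> L2w h ->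
  \int01 (fun x => (f x + c * g x) * h x * w x) =
  \int01 (fun x => f x * h x * w x) + c * \int01 (fun x => g x * h x * w x).
Proof.
move=> fL gL hL.
have fi := L2w_mul fL hL; have gi := L2w_mul gL hL.
rewrite -RintegralZl// -(Rintegral01D fi (RintegrableZ c _ gi))//.
by apply: eq_Rintegral => x _; ring.
Qed.

Lemma int_mulC f g : \int01 (fun x => f x * g x * w x) = \int01 (fun x => g x * f x * w x).
Proof. by apply: eq_Rintegral => x _; rewrite (mulrC (f x)). Qed.

Lemma poly_projection n f : L2w f -> exists2 p : {poly R}, (size p <= n)%N &
  forall q, (size q <= n)%N -> \int01 (fun x => (f x - p.[x]) * q.[x] * w x) = 0.
Proof.
elim: n f => [|n IH] f fL.
  exists 0; first by rewrite size_poly0.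
  move=> q; rewrite leqn0 size_poly_eq0 => /eqP ->.
  under eq_Rintegral do rewrite [(0 : {poly R}).[_]]horner0 mulr0 mul0r.
  by rewrite Rintegral_cst// mul0r.
have [p0 p0n p0P] := IH _ (L2w_horner 'X^n).
have [p1 p1n p1P] := IH _ fL.
pose e := 'X^n - p0; pose r := fun x => f x - p1.[x].
have eL := L2w_horner e; have rL : L2w r := L2w_subr_horner p1 fL.
pose c := dot r (horner e) / dot (horner e) (horner e).
have ce : c * dot (horner e) (horner e) = dot r (horner e).
  (* If [e] has norm 0, which a merely nonnegative weight allows, Cauchy-Schwarz makes the numerator
     0, so the value of the division by 0 does no harm. *)
  rewrite /c; have [d0|dn0] := eqVneq (dot (horner e) (horner e)) 0; last by rewrite divfK.
  have := Rintegral_cauchy_schwarz (measurable_itv `]0%R, 1%R[) rL.1 eL.1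
    (Rintegrable_measurable wi) (fun x _ => w0 x) rL.2 eL.2.
  have -> : \int01 (fun x => e.[x] ^+ 2 * w x) = 0.
    by apply: etrans d0; apply: eq_Rintegral => x _; rewrite expr2.
  rewrite mulr0 => H; rewrite d0 mulr0; apply/esym/eqP.
  by rewrite -sqrf_eq0 eq_le sqr_ge0 andbT.
exists (p1 + c *: e).
  rewrite (leq_trans (size_polyD _ _))// geq_max (leqW p1n)/=.
  rewrite (leq_trans (size_scale_leq _ _))// (leq_trans (size_polyD _ _))//.
  by rewrite geq_max size_polyN size_polyXn ltnSn leqW.
(* As [e] is monic, removing its multiple by the coefficient of degree [n] leaves [s] of size at
   most [n]. *)
move=> q qn; pose s := q - q`_n *: e.
have sn : (size s <= n)%N.
  apply/leq_sizeP => j; rewrite leq_eqVlt => /predU1P[<-|nj].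
    by rewrite /s /e !coefE eqxx (leq_sizeP _ _ p0n) // subr0 mulr1 subrr.
  rewrite /s /e !coefE (leq_sizeP _ _ qn)// gtn_eqF// (leq_sizeP _ _ p0n) 1?ltnW//.
  by rewrite subr0 mulr0 subrr.
have sL := L2w_horner s.
have es : \int01 (fun x => e.[x] * s.[x] * w x) = 0.
  by apply: etrans (p0P _ sn); apply: eq_Rintegral => x _; rewrite /e !hornerE.
have rs : \int01 (fun x => r x * s.[x] * w x) = 0 by exact: p1P.
transitivity (\int01 (fun x => (s.[x] + q`_n * e.[x]) * (r x + (- c) * e.[x]) * w x)).
  by apply: eq_Rintegral => x _; rewrite /r /s /e !hornerE; ring.
rewrite int_mul_linl//; last exact: L2w_lin.
rewrite int_mulC int_mul_linl// [X in _ + _ * X]int_mulC int_mul_linl//.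
rewrite es rs mulr0 addr0 add0r mulNr; rewrite /dot in ce; rewrite ce subrr mulr0 //.
Qed.

End WeightedProjection.

(** * Weighted norms and representatives of weak derivatives *)

Section WeightedNorm.
Context {R : realType}.
Notation mu := (@lebesgue_measure R).
Notation "\int01 f" := (Rintegral mu (`]0%R, 1%R[%classic : set (measurableTypeR R)) f)
  (at level 10).
Notation I01 := (`]0%R, 1%R[%classic : set (measurableTypeR R)).
Implicit Types (f g h w u v e : R -> R) (a b c x y al be lam : R) (k n N : nat).

Lemma ae_eq_integral01 f g : measurable_fun I01 f -> measurable_fun I01 g ->
  {ae mu, forall x, 0 < x < 1 -> f x = g x} ->
  (\int[mu]_(x in I01) (f x)%:E = \int[mu]_(x in I01) (g x)%:E)%E.
Proof.
move=> mf mg fg; apply: ae_eq_integral => //; try exact/measurable_EFinP.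
by move: fg => /ae_imp; apply => x H; rewrite /= in_itv/= => /H ->.
Qed.

Lemma ae_Rintegrable01 f g : measurable_fun I01 g -> Rintegrable I01 f ->
  {ae mu, forall x, 0 < x < 1 -> f x = g x} -> Rintegrable I01 g.
Proof.
move=> mg fi fg; have mf := Rintegrable_measurable fi.
apply/integrableP; split; first exact/measurable_EFinP.
rewrite /= -(@ae_eq_integral01 (fun x => `|f x|)); first by case/integrableP : fi.
- exact: measurableT_comp.
- exact: measurableT_comp.
- by move: fg => /ae_imp; apply => x H /H ->.
Qed.

Lemma wdotE w f g e :
  measurable_fun I01 (fun x => f x * g x * w x) -> Rintegrable I01 e ->
  {ae mu, forall x, 0 < x < 1 -> f x * g x * w x = e x} ->
  wdot w f g = (\int01 e)%:E.
Proof.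
move=> mF ei H; rewrite /wdot integral_itv_bndoo; last exact/measurable_EFinP.
rewrite -EFin_Rintegral//; apply: ae_eq_integral01 => //.
exact: Rintegrable_measurable.
Qed.

Lemma wnormE w f e :
  measurable_fun I01 (fun x => f x * f x * w x) -> Rintegrable I01 e ->
  (forall x, 0 <= e x) ->
  {ae mu, forall x, 0 < x < 1 -> f x * f x * w x = e x} ->
  wnorm w f = (Num.sqrt (\int01 e))%:E.
Proof.
move=> mF ei e0 H; rewrite /wnorm (wdotE mF ei H) poweR_EFin powR12_sqrt//.
exact: Rintegral_ge0.
Qed.

(** The exponent of [x] splits as [lam be + (lam - 1)], so the substitution turns [omega] norms into
    Jacobi norms without residual factor. *)
Lemma omega_powR al be lam x : 0 < lam -> 0 < x ->
  omega al be lam x = jacobi al be (x `^ lam) * powR_density lam x.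
Proof.
move=> l0 x0; rewrite /omega /jacobi /powR_density gtr0_norm// -powRrM.
rewrite (_ : (be + 1) * lam - 1 = lam * be + (lam - 1)); last by ring.
rewrite (@powRD _ x (lam * be) (lam - 1)) ?(gt_eqF x0) ?implybT//.
by rewrite mulrA (mulrCA _ lam) mulrA -!mulrA.
Qed.

Lemma omega1E al be x : 0 < x -> omega al be 1 x = jacobi al be x.
Proof.
move=> x0; rewrite omega_powR// powRr1 ?ltW// /powR_density normr1 subrr powRr0.
by rewrite !mulr1.
Qed.

Lemma measurable_omega al be lam : measurable_fun I01 (omega al be lam).
Proof.
apply: measurable_funM; first apply: measurable_funM => //.
  apply: (measurableT_comp (f := fun x => x `^ al)); first exact: measurable_powR.
  by apply: measurable_funB => //; apply: measurable_funTS; exact: measurable_powR.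
by apply: measurable_funTS; exact: measurable_powR.
Qed.

Lemma wL2_L2w al be g h : wL2 (omega al be 1) g -> locint h ->
  {ae mu, forall x, 0 < x < 1 -> g x = h x} -> L2w (jacobi al be) h.
Proof.
move=> [mg gfin] hi gh; have mh := locint_measurable hi.
split=> //.
have mg1 : measurable_fun I01 g.
  by apply: measurable_funS mg => //; apply: subset_itv; rewrite bnd_simp.
have mJ : measurable_fun I01 (jacobi al be) by exact: measurable_jacobi.
have mgJ : measurable_fun I01 (fun x => g x ^+ 2 * jacobi al be x).
  by apply: measurable_funM => //; exact: measurable_funX.
apply: (@ae_Rintegrable01 (fun x => g x ^+ 2 * jacobi al be x)).
- by apply: measurable_funM => //; exact: measurable_funX.
- apply/integrableP; split; first exact/measurable_EFinP.
  have -> : (\int[mu]_(x in I01) `|(EFin \o (fun x => g x ^+ 2 * jacobi al be x)%R) x| =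
      wdot (omega al be 1) g g)%E.
    rewrite /wdot [RHS]integral_itv_bndoo.
      apply: eq_integral => x; rewrite mem_setE in_itv/= => /andP[x0 _].
      by rewrite ger0_norm ?sqr_jacobi_ge0// omega1E// expr2.
    apply/measurable_EFinP; apply: measurable_funM; first exact: measurable_funM.
    exact: measurable_omega.
  by apply: lty_poweRy gfin; rewrite invr_eq0.
- by move: gh => /ae_imp; apply => x H /H ->.
Qed.

Lemma Plam_horner N lam q : Plam N lam q <->
  exists2 Q : {poly R}, (size Q <= N.+1)%N & q = fun x => Q.[x `^ lam].
Proof.
have E x (i : nat) : x `^ (i%:R * lam) = (x `^ lam) ^+ i.
  by rewrite mulrC powRrM powR_mulrn// powR_ge0.
split=> [[a ->]|[Q QN ->]].
  exists (\poly_(i < N.+1) (if insub i is Some j then a j else 0)).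
    exact: size_poly.
  apply/funext => x; rewrite horner_poly; apply: eq_bigr => i _.
  by rewrite E valK.
exists (fun i => Q`_i); apply/funext => x; rewrite (horner_coef_wide _ QN).
by apply: eq_bigr => i _; rewrite E.
Qed.

Lemma lac_ae w f g : lac w f -> locint g ->
  {ae mu, forall x, 0 < x < 1 -> f x = g x} -> lac w g.
Proof.
move=> [fi wE] gi fg; split=> // a b a0 ab b1; rewrite wE//.
rewrite /Rintegral; congr fine; apply: ae_eq_integral => //.
- by apply/measurable_EFinP; apply: Rintegrable_measurable; exact: fi.
- by apply/measurable_EFinP; apply: Rintegrable_measurable; exact: gi.
- move: fg => /ae_imp; apply => x H /=; rewrite in_itv/= => /andP[ax xb].
  by rewrite H// (lt_le_trans a0 ax) (le_lt_trans xb b1).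
Qed.

Lemma weak_derive_representatives (m : nat) u :
  (forall k, (k <= m)%N -> exists g, is_weak_derive k u g) ->
  exists h : nat -> R -> R,
    [/\ forall k, (k < m)%N -> lac (h k) (h k.+1),
        forall k, (k <= m)%N -> locint (h k) &
        forall k g, (k <= m)%N -> is_weak_derive k u g ->
          {ae mu, forall x, 0 < x < 1 -> g x = h k x}].
Proof.
move=> ex.
have D k : (k <= m)%N -> is_weak_derive k u (weak_derive k u).
  by move=> km; exact: xgetPex (ex k km).
have hex k : exists v, (k <= m)%N ->
    [/\ locint v, {ae mu, forall x, 0 < x < 1 -> weak_derive k u x = v x} &
        (k < m)%N -> lac v (weak_derive k.+1 u)].
  have [km|_] := ltnP k m.
    have [v vl vE] := weak_derive_lac (is_weak_derive_step (D _ (ltnW km)) (D _ km)).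
    by exists v => _; split => //; exact: lac_locint vl.
  exists (weak_derive k u) => km; split => //; last exact: aeW.
  by have [_] := is_weak_derive_locint (D _ km).
have [h hP] := choice hex; exists h; split.
- move=> k km; have [_ _ /(_ km) l1] := hP _ (ltnW km).
  by have [li ae1 _] := hP _ km; exact: lac_ae l1 li ae1.
- by move=> k km; have [] := hP _ km.
- move=> k g km ug; have [_ ae1 _] := hP _ km.
  have uu : {ae mu, forall x, 0 < x < 1 -> u x = u x} by exact: aeW.
  have := ae_and ae1 (is_weak_derive_unique ug (D _ km) uu).
  by move=> /ae_imp; apply => x [H1 H2] xI; rewrite H2// H1.
Qed.

End WeightedNorm.

(** * Derivatives of the projection error, from order l to order m *)

Section ErrorChain.
Context {R : realType}.
Notation mu := (@lebesgue_measure R).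
Notation "\int01 f" := (Rintegral mu (`]0%R, 1%R[%classic : set (measurableTypeR R)) f)
  (at level 10).
Implicit Types (q : {poly R}) (k l : nat).

Lemma size_derivn (p : {poly R}) k : (size (derivn k p) <= size p - k)%N.
Proof.
apply/leq_sizeP => j; rewrite leq_subLR => kj.
by rewrite coef_derivn (leq_sizeP _ _ (leqnn _))// mul0rn.
Qed.

(** The right-hand side is [n + 2 + a + b + k]: the shifts of the two exponents outweigh the loss of
    [k] in the degree, and [a + b > -2]. This keeps the final constant free of [al] and [be]. *)
Lemma shifted_eigenvalue_ge (a b : R) n k : -1 < a -> -1 < b -> (k <= n.+1)%N ->
  n%:R <= (n.+1 - k)%:R + 1 + (a + k%:R) + (b + k%:R).
Proof.
move=> a1 b1 kn; rewrite natrB// -natr1; have := ler0n R k.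
by move: (k%:R) (n%:R) => s t; lra.
Qed.

Variables (al be : R) (N m : nat) (h : nat -> R -> R) (p : {poly R}).
Hypotheses (al1 : -1 < al) (be1 : -1 < be) (mN : (m <= N.+1)%N).
Hypothesis pN : (size p <= N.+1)%N.

Definition jacobi_shift k := jacobi (al + k%:R) (be + k%:R).

Hypothesis hlac : forall k, (k < m)%N -> lac (h k) (h k.+1).
Hypothesis hL2 : forall k, (k <= m)%N -> L2w (jacobi_shift k) (h k).
Hypothesis p_orth : forall q, (size q <= N.+1)%N ->
  \int01 (fun x => (h 0 x - p.[x]) * q.[x] * jacobi_shift 0 x) = 0.

Definition derived_error k x := h k x - (derivn k p).[x].

Let er := derived_error.
Let J := jacobi_shift.
Let E k := \int01 (fun x => er k x ^+ 2 * J k x).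

Let alk k : -1 < al + k%:R.
Proof. by have := ler0n R k; move: al1; lra. Qed.

Let bek k : -1 < be + k%:R.
Proof. by have := ler0n R k; move: be1; lra. Qed.

Let Ji k : Rintegrable `]0, 1[ (J k).
Proof. exact: Rintegrable_jacobi. Qed.

Let J0 k x : 0 <= J k x. Proof. exact: jacobi_ge0. Qed.

Let JS k : jacobi (al + k%:R + 1) (be + k%:R + 1) = jacobi_shift k.+1.
Proof. by rewrite -!addrA natr1. Qed.

Lemma derived_error_L2w k : (k <= m)%N -> L2w (jacobi_shift k) (er k).
Proof. by move=> km; apply: L2w_subr_horner (hL2 km); [exact: Ji|exact: J0]. Qed.

Lemma derived_error_lac k : (k < m)%N -> lac (er k) (er k.+1).
Proof.
move=> km; have := lacB (hlac km) (lac_horner (derivn k p)).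
by apply: eq_lac => x _; rewrite /er /derived_error ?derivnS.
Qed.

(** Each derivative costs one polynomial degree and shifts the weight once; [m <= N.+1] keeps the
    natural subtraction exact. *)
Lemma derived_error_orthogonal k q : (k <= m)%N -> (size q <= N.+1 - k)%N ->
  \int01 (fun x => er k x * q.[x] * jacobi_shift k x) = 0.
Proof.
elim: k q => [|k IH] q km qN; first by move: qN; rewrite subn0; exact: p_orth.
have kN : (k <= N)%N by rewrite -ltnS (leq_trans km mN).
rewrite -JS; apply: (@derive_orthogonal _ _ _ (alk k) (bek k) (N - k)%N
  _ _ (derived_error_lac km)) => //.
- by have [] := derived_error_L2w (ltnW km).
- by have [_] := derived_error_L2w km; rewrite JS.
- by move=> r rN; apply: IH (ltnW km) _; rewrite subSn.
Qed.

Lemma derived_error_step k : (k < m)%N -> (N.+1 - k)%:R * N%:R * E k <= E k.+1.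
Proof.
move=> km; have kN : (k <= N)%N by rewrite -ltnS (leq_trans km mN).
have E0 : 0 <= E k by apply: Rintegral_ge0 => x _; exact: sqr_jacobi_ge0.
have [_ i1] := derived_error_L2w (ltnW km).
have [_ i2] := derived_error_L2w km.
have := poincare (n := N.+1 - k) (alk k) (bek k) (derived_error_lac km) i1.
rewrite JS => /(_ i2) H.
apply: le_trans (H _); last by move=> q; exact: derived_error_orthogonal (ltnW km).
rewrite -/(E k) ler_wpM2r// ler_wpM2l//.
exact: shifted_eigenvalue_ge (leqW kN).
Qed.

(** Pythagoras: [h m] is the error plus the [m]-th derivative of [p], whose size is at most
    [N.+1 - m], so the cross term vanishes. *)
Lemma derived_error_last : E m <= \int01 (fun x => h m x ^+ 2 * J m x).
Proof.
have Pm := @size_derivn p m.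
have eL := derived_error_L2w (leqnn m).
have dL := L2w_horner (Ji m) (derivn m p).
have cL := L2w_mul (Ji m) (@J0 m) eL dL.
have [_ ei] := eL; have [_ di] := dL.
have c2i := RintegrableZ 2 (measurable_itv _) cL.
have -> : \int01 (fun x => h m x ^+ 2 * J m x) =
    E m + (2 * \int01 (fun x => er m x * (derivn m p).[x] * J m x) +
      \int01 (fun x => (derivn m p).[x] ^+ 2 * J m x)).
  rewrite -RintegralZl// -(Rintegral01D c2i di).
  rewrite -(Rintegral01D ei (RintegrableD (measurable_itv _) c2i di)).
  apply: eq_Rintegral => x _; rewrite /er /derived_error /J.
  by move: (h m x) (_.[x]) (jacobi_shift m x) => a b c; ring.
rewrite derived_error_orthogonal// ?(leq_trans Pm) ?leq_sub2r//.
rewrite mulr0 add0r lerDl; apply: Rintegral_ge0 => x _; exact: sqr_jacobi_ge0.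
Qed.

(** The multiplied-out form telescopes through [(N.+1 - l)! = (N.+1 - l) (N - l)!] and covers
    [N = 0] as well. *)
Lemma derived_error_bound l : (l <= m)%N ->
  ((N.+1 - l)`!)%:R * N%:R ^+ (m - l) * E l <=
  ((N.+1 - m)`!)%:R * \int01 (fun x => h m x ^+ 2 * J m x).
Proof.
move=> lm; have {lm}[d dE] : exists d, (d = m - l)%N /\ (l + d = m)%N.
  by exists (m - l)%N; rewrite subnKC.
rewrite -dE.1; have := dE.2; clear dE; elim: d l => [|d IH] l.
  rewrite addn0 => ->; rewrite expr0 mulr1 ler_wpM2l//; exact: derived_error_last.
rewrite addnS -addSn => ld; have lm : (l < m)%N by rewrite -ld addSn ltnS leq_addr.
have lN : (l <= N)%N by rewrite -ltnS (leq_trans lm mN).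
apply: le_trans (IH _ ld); rewrite subSn// factS subSS natrM exprS.
have -> : (N - l).+1%:R * (N - l)`!%:R * (N%:R * N%:R ^+ d) * E l =
  (N - l)`!%:R * N%:R ^+ d * ((N - l).+1%:R * N%:R * E l) :> R by ring.
rewrite ler_wpM2l ?mulr_ge0 ?exprn_ge0//.
by have := derived_error_step lm; rewrite subSn.
Qed.

End ErrorChain.

(** * The operators D_lam and the mapped projection *)

Section MappedDerivatives.
Context {R : realType}.
Notation mu := (@lebesgue_measure R).
Notation "\int01 f" := (Rintegral mu (`]0%R, 1%R[%classic : set (measurableTypeR R)) f)
  (at level 10).
Notation I01 := (`]0%R, 1%R[%classic : set (measurableTypeR R)).
Implicit Types (f g h u v : R -> R) (a b c x y al be lam : R) (k l m n N : nat).
Implicit Types (p q : {poly R}).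

Lemma lac_powR_any c : exists f, lac (fun x => x `^ c) f.
Proof.
exists (fun x => c * x `^ (c - 1)); apply: C1_lac => x /andP[x0 x1].
  exact: is_derive1_powR.
by apply: continuousM; [exact: cst_continuous|exact: powR_continuous].
Qed.

Lemma powR_densityK lam x : 0 < lam -> 0 < x ->
  x `^ (1 - lam) / lam * powR_density lam x = 1.
Proof.
move=> l0 x0; rewrite /powR_density gtr0_norm// mulrA divfK ?gt_eqF//.
rewrite -powRD ?(gt_eqF x0) ?implybT//.
by rewrite addrA subrK subrr powRr0.
Qed.

Lemma locint_comp_powR lam f : 0 < lam -> locint f ->
  locint (fun x => f (x `^ lam)).
Proof.
move=> l0 fi; have [d ld] := lac_powR_any (1 - lam).
apply: eq_locint (locintM (lacZ lam^-1 ld) (locint_powR l0 fi)) => x /andP[x0 _].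
by rewrite -mulrA [_ * (lam^-1 * _)]mulrC [lam^-1 * _]mulrC powR_densityK// mulr1.
Qed.

(** The chain-rule factor [powR_density] cancels the prefactor of [Dlam]. As [weak_derive] is a
    choice up to null sets, the induction carries an almost-everywhere identity together with local
    integrability. *)
Lemma Dlam_iter_powR lam m (w : nat -> R -> R) f : 0 < lam ->
  (forall k, (k < m)%N -> lac (w k) (w k.+1)) -> locint f ->
  {ae mu, forall x, 0 < x < 1 -> f x = w 0 (x `^ lam)} ->
  forall l, (l <= m)%N -> locint (Dlam_iter lam l f) /\
    {ae mu, forall x, 0 < x < 1 -> Dlam_iter lam l f x = w l (x `^ lam)}.
Proof.
move=> l0 wl fi fw; elim=> [//|l IH] lm; have [Fi FE] := IH (ltnW lm).
have Fd := lac_is_weak_derive (lac_powR_comp l0 (wl _ lm)) Fi FE.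
have Fd' : is_weak_derive 1 (Dlam_iter lam l f) (weak_derive 1 (Dlam_iter lam l f)).
  by apply: xgetPex; eexists; exact: Fd.
have [_ di] := is_weak_derive_locint Fd'.
have FF : {ae mu, forall x, 0 < x < 1 -> Dlam_iter lam l f x = Dlam_iter lam l f x}.
  exact: aeW.
have dE := is_weak_derive_unique Fd' Fd FF.
split.
  have [d ld] := lac_powR_any (1 - lam).
  apply: eq_locint (locintM (lacZ lam^-1 ld) di) => x _.
  by rewrite /= /Dlam mulrC [lam^-1 * _]mulrC.
move: dE => /ae_imp; apply => x H xI; have /andP[x0 _] := xI.
by rewrite /= /Dlam H// mulrCA powR_densityK// mulr1.
Qed.

Lemma wnorm_powR al be lam f h : 0 < lam ->
  measurable_fun I01 f -> L2w (jacobi al be) h ->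
  {ae mu, forall x, 0 < x < 1 -> f x = h (x `^ lam)} ->
  wnorm (omega al be lam) f = (Num.sqrt (\int01 (fun x => h x ^+ 2 * jacobi al be x)))%:E.
Proof.
move=> l0 mf [mh hi] fE; rewrite -(Rintegral_powR l0 hi).
apply: wnormE.
- by apply: measurable_funM; [exact: measurable_funM|exact: measurable_omega].
- exact: Rintegrable_powR hi.
- by move=> x; rewrite mulr_ge0 ?sqr_jacobi_ge0 ?powR_density_ge0.
- move: fE => /ae_imp; apply => x H xI; have /andP[x0 _] := xI.
  by rewrite H// omega_powR// -expr2 mulrA.
Qed.

Lemma wdot_powR al be lam f g h q : 0 < lam -> -1 < al -> -1 < be ->
  measurable_fun I01 f -> L2w (jacobi al be) h ->
  {ae mu, forall x, 0 < x < 1 -> f x = h (x `^ lam)} ->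
  g = (fun x => q.[x `^ lam]) ->
  wdot (omega al be lam) f g = (\int01 (fun x => h x * q.[x] * jacobi al be x))%:E.
Proof.
move=> l0 al1 be1 mf hL fE ->.
have Ji := Rintegrable_jacobi al1 be1.
have hq := L2w_mul Ji (jacobi_ge0 al be) hL (L2w_horner Ji q).
rewrite -(Rintegral_powR l0 hq); apply: wdotE.
- apply: measurable_funM; last exact: measurable_omega.
  apply: measurable_funM => //; apply: (measurable_comp_powR l0 (f := horner q)).
  exact: measurable_horner.
- exact: Rintegrable_powR hq.
- move: fE => /ae_imp; apply => x H xI; have /andP[x0 _] := xI.
  by rewrite H// omega_powR// mulrA.
Qed.

Lemma piN_horner N al be lam v h : 0 < lam -> -1 < al -> -1 < be ->
  measurable_fun I01 v -> L2w (jacobi al be) h ->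
  {ae mu, forall x, 0 < x < 1 -> v x = h (x `^ lam)} ->
  exists2 p : {poly R}, (size p <= N.+1)%N & piN N al be lam v = (fun x => p.[x `^ lam]) /\
    forall q, (size q <= N.+1)%N ->
      \int01 (fun x => (h x - p.[x]) * q.[x] * jacobi al be x) = 0.
Proof.
move=> l0 al1 be1 mv hL vE.
have Ji := Rintegrable_jacobi al1 be1.
have key p q : wdot (omega al be lam) (v \- (fun x => p.[x `^ lam]))
    (fun x => q.[x `^ lam]) =
    (\int01 (fun x => (h x - p.[x]) * q.[x] * jacobi al be x))%:E.
  apply: (wdot_powR (q := q) l0 al1 be1) => //.
  - apply: measurable_funB => //; apply: (measurable_comp_powR l0 (f := horner p)).
    exact: measurable_horner.
  - exact: (L2w_subr_horner Ji (jacobi_ge0 al be)).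
  - by move: vE => /ae_imp; apply => x H xI; rewrite /= H.
(* Existence of the projection rules out the default value of [xget]. *)
have : is_piN N al be lam v (piN N al be lam v).
  apply: xgetPex.
  have [p pN pP] := poly_projection Ji (jacobi_ge0 al be) N.+1 hL.
  exists (fun x => p.[x `^ lam]); split; first by apply/Plam_horner; exists p.
  by move=> _ /Plam_horner[q qN ->]; rewrite key pP.
move=> [/Plam_horner[p pN pE] orth]; exists p => //; split=> // q qN.
have := orth (fun x => q.[x `^ lam]); rewrite pE key => H.
by apply: EFin_inj; apply: H; apply/Plam_horner; exists q.
Qed.

(** At positive points [omega_tilde] is [omega (al + 1) (be + 1) lam] times the square of the
    prefactor [x^(1-lam) / lam] of [Dlam]. *)
Lemma omega_tilde_Dlam al be lam f : 0 < lam -> locint (weak_derive 1 f) ->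
  wnorm (omega_tilde al be lam) (weak_derive 1 f) =
  wnorm (omega (al + 1) (be + 1) lam) (Dlam lam f).
Proof.
move=> l0 di; have md := locint_measurable di.
have mp c : measurable_fun I01 (fun x : R => x `^ c).
  by apply: measurable_funTS; exact: measurable_powR.
suff H : wdot (omega_tilde al be lam) (weak_derive 1 f) (weak_derive 1 f) =
    wdot (omega (al + 1) (be + 1) lam) (Dlam lam f) (Dlam lam f) by rewrite /wnorm H.
rewrite /wdot.
rewrite [LHS]integral_itv_bndoo; last first.
  apply/measurable_EFinP; apply: measurable_funM; first exact: measurable_funM.
  apply: measurable_funM; last exact: mp.
  apply: measurable_funM => //.
  apply: (measurableT_comp (f := fun x => x `^ (al + 1))); first exact: measurable_powR.
  by apply: measurable_funB => //; exact: mp.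
rewrite [RHS]integral_itv_bndoo; last first.
  have mD : measurable_fun I01 (Dlam lam f).
    by apply: measurable_funM => //; apply: measurable_funM => //; exact: mp.
  apply/measurable_EFinP; apply: measurable_funM; first exact: measurable_funM.
  exact: measurable_omega.
apply: eq_integral => x; rewrite mem_setE in_itv/= => /andP[x0 _]; congr EFin.
rewrite /omega_tilde /omega /Dlam.
have -> : x `^ (be * lam + 1) = x `^ (1 - lam) * x `^ (1 - lam) * x `^ ((be + 1 + 1) * lam - 1).
  rewrite -!powRD ?(gt_eqF x0) ?implybT//; congr (_ `^ _); ring.
have ln : lam != 0 by rewrite gt_eqF.
move: (x `^ (1 - lam)) (x `^ ((be + 1 + 1) * lam - 1)) (weak_derive 1 f x).
by move: ((1 - x `^ lam) `^ (al + 1)) => a b c d; field.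
Qed.

End MappedDerivatives.

(** * The projection error and the constants of the estimates *)

Section ProjectionError.
Context {R : realType}.
Notation mu := (@lebesgue_measure R).
Notation "\int01 f" := (Rintegral mu (`]0%R, 1%R[%classic : set (measurableTypeR R)) f)
  (at level 10).
Notation I01 := (`]0%R, 1%R[%classic : set (measurableTypeR R)).
Implicit Types (f g h u v : R -> R) (a b c x y al be lam : R) (k l m n N : nat).

(** Multiplication by [lam x^(lam-1)], continuous inside the interval, undoes the prefactor of
    [Dlam]. *)
Lemma locint_Dlam lam f : 0 < lam -> locint (Dlam lam f) ->
  locint (weak_derive 1 f).
Proof.
move=> l0 Di; have [d ld] := @lac_powR_any R (lam - 1).
apply: eq_locint (locintM (lacZ lam ld) Di) => x /andP[x0 _].
have := powR_densityK l0 x0; rewrite /powR_density gtr0_norm// => H.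
by rewrite /Dlam mulrAC H mul1r.
Qed.

Lemma is_weak_derive0_refl u : locint u -> is_weak_derive 0 u u.
Proof.
move=> ui; split; try exact/locally_integrableP.
by move=> phi _; rewrite expr0 mul1r.
Qed.

(** All norms involved are finite, which reduces each estimate to an inequality between the real
    numbers [E l] and [G]. *)
Lemma projection_error al be lam N m v : -1 < al -> -1 < be -> 0 < lam ->
  (m <= N.+1)%N -> Bspace m al be (compose_root lam v) ->
  exists (E : nat -> R) (G : R),
  [/\ 0 <= G,
      wnorm (omega (al + m%:R) (be + m%:R) 1) (weak_derive m (compose_root lam v)) =
        (Num.sqrt G)%:E,
      forall l, (l <= m)%N ->
        wnorm (omega (al + l%:R) (be + l%:R) lam)
          (Dlam_iter lam l (v \- piN N al be lam v)) = (Num.sqrt (E l))%:E,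
      (0 < m)%N ->
        wnorm (omega_tilde al be lam) (weak_derive 1 (v \- piN N al be lam v)) =
        (Num.sqrt (E 1))%:E &
      forall l, (l <= m)%N ->
        ((N.+1 - l)`!)%:R * N%:R ^+ (m - l) * E l <= ((N.+1 - m)`!)%:R * G].
Proof.
move=> al1 be1 l0 mN; set u := compose_root lam v => uB.
have [h [hlac hloc hP]] : exists h : nat -> R -> R,
    [/\ forall k, (k < m)%N -> lac (h k) (h k.+1),
        forall k, (k <= m)%N -> locint (h k) &
        forall k g, (k <= m)%N -> is_weak_derive k u g ->
          {ae mu, forall x, 0 < x < 1 -> g x = h k x}].
  by apply: weak_derive_representatives => k /uB[g ug _]; exists g.
have hL k : (k <= m)%N -> L2w (jacobi_shift al be k) (h k).
  move=> km; have [g ug gL] := uB _ km.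
  exact: wL2_L2w gL (hloc _ km) (hP _ _ km ug).
have ui : locint u by have [g ug _] := uB _ (leq0n m); have [] := is_weak_derive_locint ug.
have uE : {ae mu, forall x, 0 < x < 1 -> u x = h 0 x}.
  by apply: hP => //; exact: is_weak_derive0_refl.
have vu x : 0 < x < 1 -> v x = u (x `^ lam).
  by move=> /andP[x0 _]; rewrite /u /compose_root -powRrM mulfV ?gt_eqF// powRr1 ?ltW.
have vi : locint v.
  by apply: eq_locint (locint_comp_powR l0 ui) => x /vu ->.
have vE : {ae mu, forall x, 0 < x < 1 -> v x = h 0 (x `^ lam)}.
  by have := ae_powR l0 uE; move=> /ae_imp; apply => x H xI; rewrite vu// H.
have hL0 : L2w (jacobi al be) (h 0).
  by have := hL 0 (leq0n m); rewrite /jacobi_shift !addr0.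
have [p pN [pE p_orth]] := piN_horner N l0 al1 be1 (locint_measurable vi) hL0 vE.
have p_orth' (q : {poly R}) : (size q <= N.+1)%N ->
    \int01 (fun x => (h 0 x - p.[x]) * q.[x] * jacobi_shift al be 0 x) = 0.
  by rewrite /jacobi_shift !addr0; exact: p_orth.
pose w := derived_error h p.
have wlac k : (k < m)%N -> lac (w k) (w k.+1).
  by move=> km; exact: (derived_error_lac p hlac km).
have wL k : (k <= m)%N -> L2w (jacobi_shift al be k) (w k).
  by move=> km; exact: (derived_error_L2w p al1 be1 hL km).
pose err := v \- piN N al be lam v.
have erri : locint err.
  rewrite /err pE.
  apply: locintB vi _; apply: (locint_comp_powR l0 (f := horner p)).
  exact: lac_locint (lac_horner p).
have errE : {ae mu, forall x, 0 < x < 1 -> err x = w 0 (x `^ lam)}.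
  by move: vE => /ae_imp; apply => x H xI; rewrite /err pE /= H.
have D := Dlam_iter_powR l0 wlac erri errE.
exists (fun l => \int01 (fun x => w l x ^+ 2 * jacobi_shift al be l x)).
exists (\int01 (fun x => h m x ^+ 2 * jacobi_shift al be m x)).
have wE l : (l <= m)%N -> wnorm (omega (al + l%:R) (be + l%:R) lam)
    (Dlam_iter lam l err) =
    (Num.sqrt (\int01 (fun x => w l x ^+ 2 * jacobi_shift al be l x)))%:E.
  move=> lm; have [Di DE] := D _ lm.
  by apply: wnorm_powR DE => //; [exact: locint_measurable|exact: wL].
split.
- by apply: Rintegral_ge0 => x _; exact: sqr_jacobi_ge0.
- have uD : is_weak_derive m u (weak_derive m u).
    by apply: xgetPex; have [g ug _] := uB _ (leqnn m); exists g.
  have [_ di] := is_weak_derive_locint uD.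
  apply: wnorm_powR => //; [exact: locint_measurable|exact: hL|].
  have := hP _ _ (leqnn m) uD; move=> /ae_imp; apply => x H xI.
  by rewrite powRr1 ?H//; case/andP : xI => /ltW.
- exact: wE.
- move=> m0; rewrite omega_tilde_Dlam//; first exact: (wE 1).
  by apply: (@locint_Dlam lam) => //; have [] := D _ m0.
- by move=> l lm; exact: (derived_error_bound al1 be1 mN pN hlac hL p_orth' lm).
Qed.

(* For [N.+1 < m] the truncated subtraction gives factors [1 + j / 0 = 1]. *)
Definition projection_constant m N : R :=
  \prod_(j < m) (1 + j%:R / (N.+1 - j)%:R).

Lemma projection_constant_ge1 m N : 1 <= projection_constant m N.
Proof.
rewrite /projection_constant; elim: m => [|m IH]; first by rewrite big_ord0.
rewrite big_ord_recr/= -[leLHS]mulr1 ler_pM//.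
by rewrite lerDl divr_ge0.
Qed.

Lemma projection_constant_cvg m : projection_constant m @ \oo --> (1 : R).
Proof.
elim: m => [|m IH].
  rewrite (_ : projection_constant 0 = fun=> 1); first exact: cvg_cst.
  by apply/funext => N; rewrite /projection_constant big_ord0.
rewrite (_ : projection_constant m.+1 =
    fun N => projection_constant m N * (1 + m%:R / (N.+1 - m)%:R)); last first.
  by apply/funext => N; rewrite /projection_constant big_ord_recr.
rewrite -[X in _ --> X]mulr1; apply: cvgM => //.
(* Shifted by [m], the last factor is [1 + m / (n + 1)]. *)
rewrite -(cvg_shiftn m).
rewrite (_ : [sequence _]_n = fun n => 1 + m%:R * harmonic n); last first.
  by apply/funext => n; rewrite /= subSn ?leq_addl// addnK.
have : 1 + m%:R * harmonic n @[n --> \oo] --> (1 + m%:R * 0 : R).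
  by apply: cvgD; [exact: cvg_cst|apply: cvgM; [exact: cvg_cst|exact: cvg_harmonic]].
by rewrite mulr0 addr0.
Qed.

(** Each order [j] from [l] to [m - 1] contributes [N / (N.+1 - j)], at most
    [N.+1 / (N.+1 - j) = 1 + j / (N.+1 - j)]. The factors with [j < l] are at least 1; including
    them makes the constant independent of [l]. *)
Lemma fact_projection_constant N m l : (l <= m)%N -> (m <= N.+1)%N ->
  ((N.+1 - m)`!)%:R * N%:R ^+ (m - l) <=
  projection_constant m N * ((N.+1 - l)`!)%:R.
Proof.
elim: m => [|m IH] lm mN.
  by move: lm; rewrite leqn0 => /eqP ->; rewrite /projection_constant big_ord0 expr0 mulr1 mul1r.
move: lm; rewrite leq_eqVlt => /predU1P[->|lm].
  by rewrite subnn expr0 mulr1 ler_peMl// projection_constant_ge1.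
have {}IH := IH lm (ltnW mN).
have Nm : (N.+1 - m)%:R > 0 :> R by rewrite ltr0n subn_gt0.
rewrite /projection_constant big_ord_recr/= -/(projection_constant m N).
rewrite (subSn (ltnSE lm)) exprS.
have -> : (N.+1 - m.+1)`!%:R * (N%:R * N%:R ^+ (m - l)) =
    (N.+1 - m)`!%:R * N%:R ^+ (m - l) * (N%:R / (N.+1 - m)%:R) :> R.
  rewrite subSS; move: Nm; rewrite (subSn (ltnSE mN)) factS natrM.
  by move: ((N - m).+1%:R) => t t0; field; rewrite gt_eqF.
rewrite [leRHS]mulrAC; apply: ler_pM => //; rewrite ?mulr_ge0 ?exprn_ge0 ?invr_ge0//.
rewrite ler_pdivrMr// mulrDl divfK ?gt_eqF// mul1r.
by rewrite -natrD ler_nat subnK// ltnW.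
Qed.

Lemma powR_natB c l m : 0 < c -> (l <= m)%N ->
  c `^ (l%:R - m%:R) = (c ^+ (m - l))^-1.
Proof.
by move=> c0 lm; rewrite -opprB powRN -natrB// powR_mulrn ?ltW.
Qed.

End ProjectionError.

Theorem proposition2p1 (R : realType) (al be lam : R)
    (hal : -1 < al) (hbe : -1 < be) (hlam0 : 0 < lam) (hlam1 : lam <= 1) :
  (exists2 c : R, 0 < c &
    forall (N l m : nat), (1 <= N)%N -> (l <= m)%N -> (m <= N.+1)%N ->
    forall v : R -> R, Bspace m al be (compose_root lam v) ->
      (wnorm (omega (al + l%:R) (be + l%:R) lam)
             (Dlam_iter lam l (v \- piN N al be lam v)%R)
       <= (c * Num.sqrt (((N.+1 - m)`!)%:R / ((N.+1 - l)`!)%:R)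
             * N%:R `^ ((l%:R - m%:R) / 2))%:E
          * wnorm (omega (al + m%:R) (be + m%:R) 1)
                  (weak_derive m (compose_root lam v)))%E)
  /\
  (forall m : nat, exists cN : nat -> R,
    [/\ bounded_fun cN,
        cN @ \oo --> (1 : R),
        forall (N l : nat), (1 <= N)%N -> (l <= m)%N -> (m <= N.+1)%N ->
        forall v : R -> R, Bspace m al be (compose_root lam v) ->
          (wnorm (omega (al + l%:R) (be + l%:R) lam)
                 (Dlam_iter lam l (v \- piN N al be lam v)%R)
           <= (cN N * N%:R `^ (l%:R - m%:R))%:E
              * wnorm (omega (al + m%:R) (be + m%:R) 1)
                      (weak_derive m (compose_root lam v)))%E,
        forall N : nat, (1 <= N)%N -> (m <= N.+1)%N ->
        forall v : R -> R, Bspace m al be (compose_root lam v) ->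
          (wnorm (omega al be lam) (v \- piN N al be lam v)%R
           <= (cN N * N%:R `^ (- m%:R))%:E
              * wnorm (omega (al + m%:R) (be + m%:R) 1)
                      (weak_derive m (compose_root lam v)))%E
      & forall N : nat, (1 <= N)%N -> (1 <= m)%N -> (m <= N.+1)%N ->
        forall v : R -> R, Bspace m al be (compose_root lam v) ->
          (wnorm (omega_tilde al be lam)
                 (weak_derive 1 (v \- piN N al be lam v)%R)
           <= (cN N * N%:R `^ (1 - m%:R))%:E
              * wnorm (omega (al + m%:R) (be + m%:R) 1)
                      (weak_derive m (compose_root lam v)))%E]).
Proof.
split.
  (* The chain of derivatives loses no constant. *)
  exists 1 => // N l m N1 lm mN v vB.
  have [E [G [G0 -> wE _ H]]] := projection_error hal hbe hlam0 mN vB.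
  rewrite wE// -EFinM lee_fin mul1r.
  have N0 : 0 < N%:R :> R by rewrite ltr0n.
  rewrite powRrM powR_natB// powR12_sqrt ?invr_ge0 ?exprn_ge0 ?ler0n//.
  rewrite -!sqrtrM ?mulr_ge0 ?invr_ge0 ?exprn_ge0//.
  apply: ler_wsqrtr.
  have b0 : 0 < ((N.+1 - l)`!)%:R :> R by rewrite ltr0n fact_gt0.
  have cd : 0 < N%:R ^+ (m - l) :> R by rewrite exprn_gt0.
  rewrite mulrAC ler_pdivlMr// mulrAC ler_pdivlMr//.
  by rewrite mulrC [E l * _]mulrC mulrA; exact: H.
move=> m.
(* The square root of [projection_constant m N] would do; being at least 1, the constant itself
   dominates it. *)
have key N l : (1 <= N)%N -> (l <= m)%N -> (m <= N.+1)%N ->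
  forall E G : R, 0 <= G -> ((N.+1 - l)`!)%:R * N%:R ^+ (m - l) * E <= ((N.+1 - m)`!)%:R * G ->
  Num.sqrt E <= projection_constant m N * N%:R `^ (l%:R - m%:R) * Num.sqrt G.
  move=> N1 lm mN E G G0 H.
  have N0 : 0 < N%:R :> R by rewrite ltr0n.
  have b0 : 0 < ((N.+1 - l)`!)%:R :> R by rewrite ltr0n fact_gt0.
  have cd : 0 < N%:R ^+ (m - l) :> R by rewrite exprn_gt0.
  have K1 := projection_constant_ge1 m N : 1 <= projection_constant m N :> R.
  have K := fact_projection_constant lm mN : _ <= _ :> R.
  rewrite powR_natB//.
  have K0 := le_trans ler01 K1.
  have c0 : 0 <= projection_constant m N / N%:R ^+ (m - l) :> R.
    by rewrite divr_ge0// ltW.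
  rewrite -[X in X * Num.sqrt G](ger0_norm c0) -sqrtr_sqr -sqrtrM ?sqr_ge0//.
  apply: ler_wsqrtr; rewrite expr_div_n mulrAC ler_pdivlMr ?exprn_gt0//.
  rewrite -(ler_pM2l b0).
  apply: (@le_trans _ _ (projection_constant m N * ((N.+1 - l)`!)%:R * G)); last first.
    rewrite [_ * (N.+1 - l)`!%:R]mulrC -mulrA.
    apply: (ler_wpM2l (ltW b0)); apply: (ler_wpM2r G0).
    by rewrite expr2 ler_peMl.
  apply: le_trans (ler_wpM2r G0 K).
  have := ler_wpM2r (ltW cd) H; congr (_ <= _); ring.
exists (projection_constant m); split.
- by apply: cvg_seq_bounded; apply/cvg_ex; exists 1; exact: projection_constant_cvg.
- exact: projection_constant_cvg.
- move=> N l N1 lm mN v vB.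
  have [E [G [G0 -> wE _ H]]] := projection_error hal hbe hlam0 mN vB.
  by rewrite wE// -EFinM lee_fin; apply: key => //; exact: H.
- move=> N N1 mN v vB.
  have [E [G [G0 -> wE _ H]]] := projection_error hal hbe hlam0 mN vB.
  have := wE 0 (leq0n m); rewrite !addr0 => ->; rewrite -EFinM lee_fin.
  have := key N 0 N1 (leq0n m) mN _ _ G0 (H 0 (leq0n m)).
  by rewrite sub0r.
- move=> N N1 m1 mN v vB.
  have [E [G [G0 -> _ wE H]]] := projection_error hal hbe hlam0 mN vB.
  rewrite wE// -EFinM lee_fin.
  exact: (key N 1 N1 m1 mN _ _ G0 (H 1 m1)).
Qed.
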